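(* Consider the balanced distributed multicategory setting described in the context. Suppose that the class-conditional distributions satisfy the sub-Gaussian condition with some parameter $\sigma^2>0$, that $\sup_j \boldsymbol\Sigma_{jj}\le c_0$ for some constant $c_0$, and that, with $\mathcal S=\{(j,k):\mathbf W^*_{jk}\ne 0\}$ the support of $\mathbf W^*$ and $s=|\mathcal S|$ its cardinality, $\boldsymbol\Sigma$ satisfies the RE$(\kappa_0,s)$ condition for some constant $\kappa_0>0$. Then there exist some universal constants $c_1,c_2,c_3$ such that the following holds. Put $$a_n=c_1\sqrt{\frac{\log(dM/\delta)}{N}}\,\|\mathbf W^*\|_{1,1}+c_2\sqrt{\frac{K\log(dMK/\delta)}{N}},\qquad b_n=2c_1\sqrt{\frac{\log(dM/\delta)}{n}},$$ and let $(\hat{\mathbf W}_t)_{t\ge0}$ be the dmSLDA iterates defined in the context, with regularization parameters $$\lambda_{t+1}=2a_n+2b_n\|\hat{\mathbf W}_t-\mathbf W^*\|_{1,1}.$$ Then for $n\ge c_3 s\log(d/\delta)$, the recursive estimation error bounds $$\|\hat{\mathbf W}_{t+1}-\mathbf W^*\|_{2,2}\le \frac{48a_n\sqrt s}{\kappa_0}+\frac{48b_n\sqrt s}{\kappa_0}\|\hat{\mathbf W}_t-\mathbf W^*\|_{1,1},$$ $$\|\hat{\mathbf W}_{t+1}-\mathbf W^*\|_{1,1}\le \frac{192a_n s}{\kappa_0}+\frac{192b_n s}{\kappa_0}\|\hat{\mathbf W}_t-\mathbf W^*\|_{1,1}$$ hold for all $t\ge 0$ with probability at least $1-3\delta$.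
   Context: Norms: for a matrix $\mathbf A$ with rows $\mathbf A_{i\cdot}$, $\|\mathbf A\|_{p,q}$ is the $\ell_q$ norm of the vector $(\|\mathbf A_{i\cdot}\|_p)_i$; so $\|\cdot\|_{1,1}$ is the sum of absolute entries and $\|\cdot\|_{2,2}$ the Frobenius norm. $\langle\mathbf A,\mathbf B\rangle=\mathrm{Tr}(\mathbf A^\top\mathbf B)$. Here $\delta\in(0,1)$. Balanced setting: $K\ge2$ classes with equal prior probabilities $\pi_k=1/K$, dimension $d$, $M$ machines. On each machine $m\in\{1,\dots,M\}$ there are $n=Kb$ independent samples $(\mathbf x_i^m,y_i^m)$, $1\le i\le n$, $\mathbf x_i^m\in\mathbb R^d$, $y_i^m\in\{1,\dots,K\}$, with exactly $b\ge2$ samples of each class; samples on different machines are independent; $N=Mn$ is the full sample size. Given $y_i^m=k$, $\mathbf x_i^m$ has mean $\boldsymbol\mu_k\in\mathbb R^d$ and covariance $\boldsymbol\Sigma$ (the same nonsingular matrix for all classes). Sub-Gaussian condition with parameter $\sigma^2$: given $y=k$, $\mathbf z^k=\boldsymbol\Sigma^{-1/2}(\mathbf x-\boldsymbol\mu_k)$ (mean $\mathbf 0$, covariance $\mathbf I_d$) satisfies $\mathbb E[e^{\lambda\langle \mathbf v,\mathbf z^k\rangle}\mid y=k]\le e^{\lambda^2\sigma^2/2}$ for all $\lambda\in\mathbb R$ and all $\mathbf v\in\mathbb R^d$ with $\|\mathbf v\|_2=1$. RE$(\kappa_0,s)$ condition: for $\mathcal A\subset\{1,\dots,d\}$ let $\mathcal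 C(\mathcal A,3)=\{\boldsymbol\zeta\in\mathbb R^d:\|\boldsymbol\zeta_{\mathcal A^c}\|_1\le3\|\boldsymbol\zeta_{\mathcal A}\|_1\}$, where $\boldsymbol\zeta_{\mathcal A}$ keeps the coordinates in $\mathcal A$ and sets the others to $0$. The condition is $\boldsymbol\zeta^\top\boldsymbol\Sigma\boldsymbol\zeta\ge\kappa_0\|\boldsymbol\zeta\|_2^2$ for all $\boldsymbol\zeta\in\mathcal C(\mathcal A,3)$ and all $\mathcal A$ with $|\mathcal A|\le s$. Target: $\bar{\boldsymbol\mu}=\sum_k\pi_k\boldsymbol\mu_k$, $\mathbf U=(\boldsymbol\mu_1-\bar{\boldsymbol\mu},\dots,\boldsymbol\mu_{K-1}-\bar{\boldsymbol\mu})\in\mathbb R^{d\times(K-1)}$, and $\mathbf W^*=\arg\min_{\mathbf W\in\mathbb R^{d\times(K-1)}}\{\tfrac12\langle\mathbf W,\boldsymbol\Sigma\mathbf W\rangle-\langle\mathbf W,\mathbf U\rangle\}=\boldsymbol\Sigma^{-1}\mathbf U$. Local statistics on machine $m$: $\hat{\boldsymbol\mu}_k^m=\frac1b\sum_{i:y_i^m=k}\mathbf x_i^m$, $\hat{\bar{\boldsymbol\mu}}^m=\frac1n\sum_i\mathbf x_i^m$, $\hat{\boldsymbol\Sigma}^m=\frac1{n-K}\sum_{k=1}^K\sum_{i:y_i^m=k}(\mathbf x_i^m-\hat{\boldsymbol\mu}_k^m)(\mathbf x_i^m-\hat{\boldsymbol\mu}_k^m)^\top$, $\hat{\mathbf U}^m=(\hat{\boldsymbol\mu}_1^m-\hat{\bar{\boldsymbol\mu}}^m,\dots,\hat{\boldsymbol\mu}_{K-1}^m-\hat{\bar{\boldsymbol\mu}}^m)$.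 Local loss: $\mathcal L_m(\mathbf W)=\frac12\langle\mathbf W,\hat{\boldsymbol\Sigma}^m\mathbf W\rangle-\langle\mathbf W,\hat{\mathbf U}^m\rangle$. dmSLDA (distributed multicategory sparse linear discriminant analysis) iterates: $\hat{\mathbf W}_0\in\arg\min_{\mathbf W\in\mathbb R^{d\times(K-1)}}\{\mathcal L_1(\mathbf W)+\lambda_0\|\mathbf W\|_{1,1}\}$ with $\lambda_0>0$, and for $t\ge1$, $\hat{\mathbf W}_t\in\arg\min_{\mathbf W\in\mathbb R^{d\times(K-1)}}\{\mathcal L_1(\mathbf W)+\langle\frac1M\sum_{m=1}^M\nabla\mathcal L_m(\hat{\mathbf W}_{t-1})-\nabla\mathcal L_1(\hat{\mathbf W}_{t-1}),\mathbf W\rangle+\lambda_t\|\mathbf W\|_{1,1}\}$.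
   Formalization: The sample-size condition is taken as n ≥ c_3 max(s,1) log(d/δ), because for s = 0 the stated condition is empty and the claim fails; the universal constants c_1, c_2, c_3 may depend on σ², c_0 and κ_0. *)

(* Defs.v *)
From HB Require Import structures.
From mathcomp Require Import all_boot all_order all_algebra.
From mathcomp Require Import all_classical all_reals all_analysis.

Set Implicit Arguments.
Unset Strict Implicit.
Unset Printing Implicit Defensive.

Import Order.TTheory GRing.Theory Num.Theory.
Import numFieldNormedType.Exports.

Local Open Scope classical_set_scope.
Local Open Scope ring_scope.

Definition lpnorm (R : realType) (p : R) (d : nat) (u : 'cV[R]_d) : R :=
  (\sum_i `|u i 0| `^ p) `^ p^-1.

(* The l_q norm of the vector of l_p norms of the rows. *)
Definition mxnorm (R : realType) (p q : R) (d r : nat) (A : 'M[R]_(d, r)) : R :=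
  lpnorm q (\col_i lpnorm p (row i A)^T).

Definition mxdot (R : realType) (d r : nat) (A B : 'M[R]_(d, r)) : R :=
  \tr (A^T *m B).

Definition is_argmin (R : realType) (T : Type) (f : T -> R) (w : T) : Prop :=
  forall v, f w <= f v.

Definition gradient (R : realType) (d r : nat) (f : 'M[R]_(d, r) -> R)
    (W : 'M[R]_(d, r)) : 'M[R]_(d, r) :=
  \matrix_(j, k) 'D_(delta_mx j k) f W.

Definition msupport (R : realType) (d r : nat) (A : 'M[R]_(d, r)) :
    {set 'I_d * 'I_r} :=
  [set jk | A jk.1 jk.2 != 0]%SET.

Definition restrict_coords (R : realType) (d : nat) (A : {set 'I_d})
    (z : 'cV[R]_d) : 'cV[R]_d :=
  \col_j (if j \in A then z j 0 else 0).

Definition re_cone (R : realType) (d : nat) (A : {set 'I_d}) (c : R) :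
    set 'cV[R]_d :=
  [set z | lpnorm 1 (restrict_coords (~: A)%SET z)
           <= c * lpnorm 1 (restrict_coords A z)].

Definition RE_condition (R : realType) (kappa0 : R) (s d : nat)
    (Sigma : 'M[R]_d) : Prop :=
  forall (A : {set 'I_d}) (z : 'cV[R]_d), (#|A| <= s)%N -> re_cone A 3 z ->
    kappa0 * lpnorm 2 z ^+ 2 <= (z^T *m Sigma *m z) 0 0.

(* Q = Sigma^(1/2): for symmetric positive semidefinite Sigma there is exactly
   one such Q. *)
Definition is_psd_sqrt (R : realType) (d : nat) (Sigma Q : 'M[R]_d) : Prop :=
  [/\ Q^T = Q, forall v : 'cV[R]_d, 0 <= (v^T *m Q *m v) 0 0
    & Q *m Q = Sigma].

Definition tuple_col (R : realType) (d : nat) (t : d.-tuple R) : 'cV[R]_d :=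
  \col_j tnth t j.

(* Since B i = setT is allowed, the product rule over the whole (finite) family
   contains the product rule over every subfamily. *)
Definition mutually_independent (d d' : measure_display)
    (Omega : measurableType d) (T : measurableType d') (R : realType)
    (P : probability Omega R) (I : finType) (X : I -> {mfun Omega >-> T}) :
    Prop :=
  forall B : I -> set T, (forall i, measurable (B i)) ->
    P (\bigcap_i (X i @^-1` B i)) = (\prod_i P (X i @^-1` B i))%E.

(* The expectations and covariances are extended reals: equality with a real
   number includes the integrability of the integrand. *)
Definition has_mean_cov (dO : measure_display) (Omega : measurableType dO)
    (R : realType) (P : probability Omega R) (d : nat)
    (X : Omega -> 'cV[R]_d) (mu : 'cV[R]_d) (Sigma : 'M[R]_d) : Prop :=
  (forall j, 'E_P[fun w => X w j 0%R] = (mu j 0%R)%:E)%E /\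
  (forall j l, covariance P (fun w => X w j 0) (fun w => X w l 0)
               = (Sigma j l)%:E).

Definition subgaussian (dO : measure_display) (Omega : measurableType dO)
    (R : realType) (P : probability Omega R) (sigma2 : R) (d : nat)
    (Z : Omega -> 'cV[R]_d) : Prop :=
  forall (lambda : R) (v : 'cV[R]_d), lpnorm 2 v = 1 ->
    ('E_P[fun w => expR (lambda * (v^T *m Z w) 0%R 0%R)]
     <= (expR (lambda ^+ 2 * sigma2 / 2))%:E)%E.

(* The first K - 1 of the K classes. *)
Definition class_of_col (K : nat) (k : 'I_K.-1) : 'I_K :=
  widen_ord (leq_pred K) k.

Definition quad_loss (R : realType) (d r : nat) (Sigma : 'M[R]_d)
    (U W : 'M[R]_(d, r)) : R :=
  2^-1 * mxdot W (Sigma *m W) - mxdot W U.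

Definition pop_mean (R : realType) (d K : nat) (mu : 'I_K -> 'cV[R]_d) :
    'cV[R]_d :=
  \sum_k (K%:R^-1 : R) *: mu k.

Definition pop_U (R : realType) (d K : nat) (mu : 'I_K -> 'cV[R]_d) :
    'M[R]_(d, K.-1) :=
  \matrix_(j, k) (mu (class_of_col k) - pop_mean mu) j 0.

(* Statistics of one machine holding the samples x with labels y, b of each
   class. *)
Definition class_mean (R : realType) (d K b n : nat) (x : 'I_n -> 'cV[R]_d)
    (y : 'I_n -> 'I_K) (k : 'I_K) : 'cV[R]_d :=
  (b%:R^-1 : R) *: \sum_(i | y i == k) x i.

Definition grand_mean (R : realType) (d n : nat) (x : 'I_n -> 'cV[R]_d) :
    'cV[R]_d :=
  (n%:R^-1 : R) *: \sum_i x i.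

Definition within_cov (R : realType) (d K b n : nat) (x : 'I_n -> 'cV[R]_d)
    (y : 'I_n -> 'I_K) : 'M[R]_d :=
  ((n%:R - K%:R)^-1 : R) *:
    \sum_k \sum_(i | y i == k)
      (x i - class_mean b x y k) *m (x i - class_mean b x y k)^T.

Definition local_U (R : realType) (d K b n : nat) (x : 'I_n -> 'cV[R]_d)
    (y : 'I_n -> 'I_K) : 'M[R]_(d, K.-1) :=
  \matrix_(j, k) (class_mean b x y (class_of_col k) - grand_mean x) j 0.

Definition local_loss (R : realType) (d K b n : nat) (x : 'I_n -> 'cV[R]_d)
    (y : 'I_n -> 'I_K) (W : 'M[R]_(d, K.-1)) : R :=
  quad_loss (within_cov b x y) (local_U b x y) W.

(* W is a run of the distributed iteration for the local losses L, with m1 the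
   machine on which the penalized problems are solved and lambda t the penalty
   of step t. *)
Definition is_dmSLDA (R : realType) (d r M : nat)
    (L : 'I_M -> 'M[R]_(d, r) -> R) (m1 : 'I_M) (lambda : nat -> R)
    (W : nat -> 'M[R]_(d, r)) : Prop :=
  is_argmin (fun V => L m1 V + lambda 0%N * mxnorm 1 1 V) (W 0%N) /\
  forall t,
    is_argmin
      (fun V => L m1 V
         + mxdot ((M%:R^-1 : R) *: (\sum_m gradient (L m) (W t))
                  - gradient (L m1) (W t)) V
         + lambda t.+1 * mxnorm 1 1 V)
      (W t.+1).

(* Main.v *)
Require Import Defs.
From HB Require Import structures.
From mathcomp Require Import all_boot all_order all_algebra.
From mathcomp Require Import all_classical all_reals all_analysis.
From mathcomp Require Import measurable_realfun ring lra.

(** The quadratic part of the penalized problem and the (1,1)-norm both split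
    over the columns of [W], so every step solves [K - 1] separate Lasso
    problems.  The regularization dominates twice the noise, hence each column
    of the error lies in the cone [C(S_k, 3)] of the support [S_k] of its own
    column of [W*]; since [sum_k |S_k| = s], the vector restricted eigenvalue
    condition for the first machine's covariance gives both bounds.  (For the
    error matrix as a whole the vector RE condition would not suffice.)

    That covariance inherits the RE condition with constant [kappa0 / 2] from
    [n >= c3 s log (d / delta)] although only the diagonal of [Sigma] is
    bounded.  By Maurey's empirical method, a quadratic form that is
    nonnegative on all sums of [k] signed unit vectors is at least
    [- L^2 max_j B_jj / (k - 1)] at vectors of l1-norm [L]; on the cone
    [L^2 <= 16 s |v|_2^2], so [k] of order [s] and a union bound over
    [(2 d)^k] directions suffice.

    In a fixed direction the within-class scatter is a sum of squares of the
    samples minus a sum of squares of normalized class sums.  Both families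
    are independent, sub-Gaussian with unit variance, so Chernoff bounds apply
    to the centered squares. *)

Set Implicit Arguments.
Unset Strict Implicit.
Unset Printing Implicit Defensive.

Import Order.TTheory GRing.Theory Num.Theory.
Import numFieldNormedType.Exports.

Local Open Scope classical_set_scope.
Local Open Scope ring_scope.

(** * Independence of real random variables and of block sums *)

(** Each penalized problem depends on the previous iterate, hence on all the data, so no
    concentration bound applies to an iterate directly. All randomness is therefore confined to four
    events about the data alone: the restricted eigenvalue condition on the first machine, the
    entrywise errors of its covariance and of the averaged one, and the error of the averaged mean
    differences. On their complement the recursion is deterministic and holds for every [t] at once.
    The first machine's covariance multiplies only the previous error [W0 - Ws]; [Ws] itself meets
    only averaged statistics, which is why [a] has the full-sample rate. Deviations of quadratic
    forms are measured relative to [bil Sigma u u], because no dimension-free bound on the operator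
    norm of [Sigma] is assumed. Both covariances are scatter matrices about block means, the blocks
    being the classes of one machine or the pairs of a machine and a class, so one concentration
    bound covers both. Independence is given for the samples but needed for class sums. These are
    built by adding two members of the family at a time, which uses only products of two
    measures. *)

Section MfunOf.
Context {d d' : measure_display} {aT : measurableType d} {rT : measurableType d'}.
Variables (f : aT -> rT) (mf : measurable_fun setT f).
Let mixin := isMeasurableFun.Build _ _ _ _ _ mf.
Definition mfun_of : {mfun aT >-> rT} := HB.pack f mixin.
End MfunOf.

Section Independence.
Context {dO : measure_display} {Omega : measurableType dO} {R : realType}.
Variable P : probability Omega R.

(** Restricting [P] to [D], dividing by [P D] and pushing forward by the pair gives a measure that
    agrees with the product law on rectangles, hence everywhere by uniqueness of product measures.
    [D] is carried along because merging two members of a family needs their law jointly with the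
    rest. *)
Lemma pair_law_product (A B : {mfun Omega >-> R}) (D : set Omega) :
    measurable D ->
    (forall S T : set R, measurable S -> measurable T ->
      P (A @^-1` S `&` B @^-1` T `&` D)
      = (P (A @^-1` S) * P (B @^-1` T) * P D)%E) ->
  forall C : set (R * R), measurable C ->
    P ((fun w => (A w, B w)) @^-1` C `&` D)
    = ((distribution P A \x distribution P B) C * P D)%E.
Proof.
move=> mD indABD C mC.
have mAB : measurable_fun setT (fun w => (A w, B w)).
  exact: measurable_fun_pair.
pose AB := mfun_of mAB.
have mpre S : measurable S -> measurable (AB @^-1` S).
  by move=> mS; rewrite -[_ @^-1` _]setTI; exact: (mAB measurableT).
have PDfin : P D \is a fin_num by exact: fin_num_measure.
(* A null event cannot be normalized, but then both sides vanish. *)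
have [PD0|PDN0] := eqVneq (P D) 0%E.
  rewrite PD0 mule0; apply/eqP; rewrite eq_le measure_ge0 andbT -PD0.
  by apply: le_measure; rewrite ?inE//; apply: measurableI => //; exact: mpre.
have PDgt0 : 0 < fine (P D).
  by rewrite fine_gt0// lt0e PDN0 measure_ge0/= ltey_eq PDfin.
have rge0 : 0 <= (fine (P D))^-1 by rewrite invr_ge0 ltW.
have [nu nuE] : exists nu : {measure set (R * R) -> \bar R},
    nu = pushforward (mrestr P mD) AB :> (set (R * R) -> \bar R).
  by unshelve eexists (pushforward (mrestr P mD) AB : {measure set (R * R) -> \bar R}).
pose m' := mscale (NngNum rge0) nu.
have m'E (X : set (R * R)) :
    m' X = ((fine (P D))^-1%:E * P ((fun w => (A w, B w)) @^-1` X `&` D))%E.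
  by rewrite /m' /mscale nuE.
have cancelD (x : \bar R) : ((fine (P D))^-1%:E * (x * P D))%E = x.
  rewrite muleC -muleA -[X in (_ * (X * _))%E](fineK PDfin) -EFinM.
  by rewrite divff ?mule1// gt_eqF.
have <- : m' C = ((distribution P A \x distribution P B) C)%E.
  apply/esym; apply: product_measure_unique => // S T mS mT.
  by rewrite [LHS]m'E -[RHS]cancelD -indABD.
by rewrite m'E -muleA cancelD.
Qed.

(** Unlike [mutually_independent], this takes bare functions, so sums and compositions need not be
    packaged as measurable maps. *)
Definition mutually_indep (d' : measure_display) (T : measurableType d')
    (I : finType) (Y : I -> Omega -> T) : Prop :=
  forall B : I -> set T, (forall i, measurable (B i)) ->
    P (\bigcap_i (Y i @^-1` B i)) = (\prod_i P (Y i @^-1` B i))%E.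

Definition indep2 (A B : Omega -> R) : Prop :=
  forall S T : set R, measurable S -> measurable T ->
    P (A @^-1` S `&` B @^-1` T) = (P (A @^-1` S) * P (B @^-1` T))%E.

(** The event [setT] in [pair_law_product] identifies the joint law, and Tonelli factors the
    integral; nonnegativity replaces integrability. *)
Lemma integral_indep2 (A B : {mfun Omega >-> R}) (f g : R -> \bar R) :
    indep2 A B -> measurable_fun [set: R] f -> measurable_fun [set: R] g ->
    (forall x, 0 <= f x)%E -> (forall x, 0 <= g x)%E ->
  (\int[P]_w (f (A w) * g (B w)) =
   \int[P]_w (f (A w)) * \int[P]_w (g (B w)))%E.
Proof.
move=> indAB mf mg f0 g0.
have mAB : measurable_fun setT (fun w => (A w, B w)).
  exact: measurable_fun_pair.
pose AB := mfun_of mAB.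
have lawE C : measurable C ->
    pushforward P AB C = (distribution P A \x distribution P B)%E C.
  move=> mC; rewrite -[RHS]mule1 -(probability_setT P) -pair_law_product//.
    by rewrite setIT.
  by move=> S T mS mT; rewrite setIT probability_setT mule1 indAB.
pose h (z : R * R) := (f z.1 * g z.2)%E.
have mh : measurable_fun setT h.
  by apply: emeasurable_funM; apply: measurableT_comp.
have h0 z : (0 <= h z)%E by rewrite mule_ge0.
transitivity (\int[pushforward P AB]_z h z)%E.
  by rewrite ge0_integral_pushforward.
transitivity (\int[distribution P A \x distribution P B]_z h z)%E.
  by apply: eq_measure_integral => C mC _; exact: lawE.
rewrite fubini_tonelli1//=; rewrite /fubini_F /h/=.
under eq_integral do rewrite ge0_integralZl//.
rewrite -ge0_integral_distribution// -[X in (_ * X)%E]ge0_integral_distribution//.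
rewrite ge0_integralZr//.
by apply: integral_ge0.
Qed.
End Independence.

Section BlockSums.
Context {dO : measure_display} {Omega : measurableType dO} {R : realType}.
Variable P : probability Omega R.

Lemma measurable_preimT (f : Omega -> R) (B : set R) :
  measurable_fun setT f -> measurable B -> measurable (f @^-1` B).
Proof. by move=> mf mB; rewrite -[_ @^-1` _]setTI; exact: mf. Qed.

Lemma mutually_indep_comp (d' : measure_display) (T : measurableType d')
    (I : finType) (X : I -> {mfun Omega >-> T}) (phi : I -> T -> R) :
    mutually_independent P X -> (forall i, measurable_fun setT (phi i)) ->
  mutually_indep P (fun i w => phi i (X i w)).
Proof.
move=> indX mphi B mB.
have mpB i : measurable (phi i @^-1` B i).
  by rewrite -[_ @^-1` _]setTI; exact: mphi.
exact: (indX (fun i => phi i @^-1` B i) mpB).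
Qed.

Lemma mutually_indep_inj (d' : measure_display) (T : measurableType d')
    (I J : finType) (h : J -> I) (Y : I -> Omega -> T) :
  injective h -> mutually_indep P Y -> mutually_indep P (fun j => Y (h j)).
Proof.
move=> injh indY B mB.
(* Indices outside the image of [h] are tested against [setT], which has probability 1, so the
   product over [I] collapses to one over [J]. *)
pose B' i := if [pick j | h j == i] is Some j then B j else setT.
have B'h j : B' (h j) = B j.
  rewrite /B'; case: pickP => [k /eqP/injh->//|/(_ j)]; by rewrite eqxx.
have B'n i : i \notin codom h -> B' i = setT.
  rewrite /B'; case: pickP => [k /eqP <-|//]; by rewrite codom_f.
have mB' i : measurable (B' i) by rewrite /B'; case: pickP.
have := indY B' mB'; rewrite [X in P X](_ : _ = \bigcap_j (Y (h j) @^-1` B j)).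
  move=> ->; rewrite (bigID (fun i => i \in codom h))/=.
  rewrite [X in (_ * X)%E]big1 ?mule1; last first.
    by move=> i /B'n ->; rewrite preimage_setT probability_setT.
  pose G i := P (Y i @^-1` B' i).
  transitivity (\prod_j G (h j))%E; last first.
    by apply: eq_bigr => j _; rewrite /G B'h.
  rewrite -(big_map h predT G).
  rewrite -big_filter; apply: perm_big; apply: uniq_perm.
  - by rewrite filter_uniq// index_enum_uniq.
  - by rewrite map_inj_uniq// index_enum_uniq.
  move=> i; rewrite mem_filter mem_index_enum andbT.
  by apply/codomP/mapP => [[j ->]|[j _ ->]]; exists j; rewrite ?mem_index_enum.
apply/seteqP; split=> w Hw.
  by move=> j _; have := Hw (h j) Logic.I; rewrite B'h.
move=> i _; have [/codomP[j ->]|/B'n ->//] := boolP (i \in codom h).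
by rewrite B'h; exact: Hw.
Qed.

Lemma mutually_indep_indep2 (I : finType) (Y : I -> Omega -> R) (i j : I) :
  i != j -> mutually_indep P Y -> indep2 P (Y i) (Y j).
Proof.
move=> neij indY S T mS mT.
pose B k := if k == i then S else if k == j then T else setT.
have Bi : B i = S by rewrite /B eqxx.
have Bj : B j = T by rewrite /B eq_sym (negbTE neij) eqxx.
have Bk k : k != i -> k != j -> B k = setT.
  by rewrite /B => /negbTE-> /negbTE->.
have mB k : measurable (B k) by rewrite /B; case: ifP => // _; case: ifP.
have := indY B mB; rewrite [X in P X](_ : _ = Y i @^-1` S `&` Y j @^-1` T).
  move=> ->; rewrite (bigD1 i)//= (bigD1 j) 1?eq_sym//= Bi Bj big1 ?mule1//.
  by move=> k /andP[ki kj]; rewrite Bk// preimage_setT probability_setT.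
apply/seteqP; split=> w.
  by move=> Hw; split; [have := Hw i Logic.I|have := Hw j Logic.I]; rewrite ?Bi ?Bj.
move=> [Hi Hj] k _; rewrite /= /B; case: ifPn => [/eqP->//|_].
by case: ifPn => [/eqP->|].
Qed.

(** The slot [a] receives the constant 0 instead of being removed, so the index type is unchanged
    and the lemma can be iterated. Jointly with any event about the other members, the pair [F a],
    [F b] keeps its product law; hence the sum is independent of them. *)
Lemma mutually_indep_merge (L : finType) (F : L -> Omega -> R) (a b : L) :
    a != b -> (forall l, measurable_fun setT (F l)) -> mutually_indep P F ->
  mutually_indep P (fun l => if l == a then cst 0
                             else if l == b then F a \+ F b else F l).
Proof.
move=> neab mF indF B mB; pose F' l := if l == a then cst 0 else if l == b then F a \+ F b else F l.
change (P (\bigcap_i (F' i @^-1` B i)) = (\prod_i P (F' i @^-1` B i))%E).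
have F'a : F' a = cst 0 by rewrite /F' eqxx.
have F'b : F' b = F a \+ F b by rewrite /F' eq_sym (negbTE neab) eqxx.
have F'l l : l != a -> l != b -> F' l = F l.
  by rewrite /F' => /negbTE-> /negbTE->.
pose C : set (R * R) := (fun z => z.1 + z.2) @^-1` B b.
have mC : measurable C.
  rewrite -[C]setTI; have m : measurable_fun setT (fun z : R * R => z.1 + z.2).
    by apply: measurable_funD.
  exact: (m measurableT).
pose D := \bigcap_(l in [set l | (l != a) && (l != b)]) (F l @^-1` B l).
have mD : measurable D.
  apply: fin_bigcap_measurable; first exact: finite_finset.
  by move=> l _; exact: measurable_preimT.
pose mfF l := mfun_of (mF l).
(* [D' = setT] yields the law of the sum alone and [D' = D] its law together with the other members;
   comparing the two gives the product rule. *)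
have rect (D' : set Omega) : (D' = setT \/ D' = D) ->
    forall S T : set R, measurable S -> measurable T ->
      P (F a @^-1` S `&` F b @^-1` T `&` D')
      = (P (F a @^-1` S) * P (F b @^-1` T) * P D')%E.
  move=> D'E.
  pose G l := if D' == D then B l else setT.
  pose B2 S T l := if l == a then S else if l == b then T else G l.
  have mG l : measurable (G l) by rewrite /G; case: ifP.
  have B2a S T : B2 S T a = S by rewrite /B2 eqxx.
  have B2b S T : B2 S T b = T by rewrite /B2 eq_sym (negbTE neab) eqxx.
  have B2l S T l : l != a -> l != b -> B2 S T l = G l.
    by rewrite /B2 => /negbTE-> /negbTE->.
  have D'G : D' = \bigcap_(l in [set l | (l != a) && (l != b)]) (F l @^-1` G l).
    rewrite /G; case: D'E => [->|->]; last by rewrite eqxx.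
    apply/seteqP; split=> // w _ l /= lab; case: eqP => // TD.
    by have : D w by [rewrite -TD]; apply.
  have key S T : measurable S -> measurable T ->
     P (F a @^-1` S `&` F b @^-1` T `&` D') =
     (P (F a @^-1` S) * (P (F b @^-1` T) *
       \prod_(l | (l != a) && (l != b)) P (F l @^-1` G l)))%E.
    move=> mS mT; have mB2 l : measurable (B2 S T l).
      by rewrite /B2; case: ifP => // _; case: ifP.
    have := indF _ mB2.
    rewrite [X in P X](_ : _ = F a @^-1` S `&` F b @^-1` T `&` D').
      move=> ->; rewrite (bigD1 a)//= (bigD1 b) 1?eq_sym//= B2a B2b.
      congr (_ * (_ * _))%E; apply: eq_bigr => l /andP[la lb].
      by rewrite B2l.
    rewrite D'G; apply/seteqP; split=> w.
      move=> Hw; split; first split.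
      - by have := Hw a Logic.I; rewrite B2a.
      - by have := Hw b Logic.I; rewrite B2b.
      by move=> l /andP[la lb]; have := Hw l Logic.I; rewrite B2l.
    move=> [[Ha Hb] Hl] l _; rewrite /= /B2; case: ifPn => [/eqP->//|la].
    by case: ifPn => [/eqP->//|lb]; apply: Hl; apply/andP.
  have PD' : P D' = (\prod_(l | (l != a) && (l != b)) P (F l @^-1` G l))%E.
    have := key setT setT measurableT measurableT.
    by rewrite !preimage_setT !setTI probability_setT !mul1e.
  by move=> S T mS mT; rewrite key// -PD' muleA.
have PF'b : P (F' b @^-1` B b)
    = (distribution P (mfF a) \x distribution P (mfF b))%E C.
  rewrite F'b; have := @pair_law_product _ _ _ P (mfF a) (mfF b) setT measurableT
    (rect setT (or_introl erefl)) C mC.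
  by rewrite setIT probability_setT mule1.
have PD : P D = (\prod_(l | (l != a) && (l != b)) P (F l @^-1` B l))%E.
  pose B2 l := if (l == a) || (l == b) then setT else B l.
  have mB2 l : measurable (B2 l) by rewrite /B2; case: ifP.
  have := indF _ mB2; rewrite [X in P X](_ : _ = D).
    move=> ->; rewrite (bigID (fun l => (l != a) && (l != b)))/=.
    rewrite [X in (_ * X)%E]big1 ?mule1.
      by apply: eq_bigr => l /andP[/negbTE la /negbTE lb]; rewrite /B2 la lb.
    move=> l; rewrite negb_and !negbK /B2 => ->.
    by rewrite preimage_setT probability_setT.
  apply/seteqP; split=> w Hw l.
    by move=> /andP[/negbTE la /negbTE lb]; have := Hw l Logic.I; rewrite /B2 la lb.
  move=> _; rewrite /= /B2; case: ifPn => //; rewrite negb_or => lab.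
  exact: Hw.
have -> : (\prod_i P (F' i @^-1` B i) =
    P (F' a @^-1` B a) * (P (F' b @^-1` B b) * P D))%E.
  rewrite (bigD1 a)//= (bigD1 b) 1?eq_sym//= PD.
  by congr (_ * (_ * _))%E; apply: eq_bigr => l /andP[la lb]; rewrite F'l.
have -> : \bigcap_i F' i @^-1` B i =
    F' a @^-1` B a `&` (F' b @^-1` B b `&` D).
  apply/seteqP; split=> w.
    move=> Hw; split; first exact: (Hw a).
    split; first exact: (Hw b).
    by move=> l /andP[la lb]; have := Hw l Logic.I; rewrite F'l.
  move=> [Ha [Hb HD]] l _.
  have [->//|la] := eqVneq l a; have [->//|lb] := eqVneq l b.
  by rewrite F'l//; apply: HD; apply/andP.
(* A test set for the constant slot either contains 0 and has preimage [setT], or makes both sides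
   0. *)
rewrite F'a preimage_cst; case: ifPn => B0; last first.
  by rewrite set0I measure0 mul0e.
rewrite setTI probability_setT mul1e PF'b F'b.
exact: (@pair_law_product _ _ _ P (mfF a) (mfF b) D mD
    (rect D (or_intror erefl)) C mC).
Qed.

End BlockSums.

Section PartialBlockSums.
Context {dO : measure_display} {Omega : measurableType dO} {R : realType}.
Variable P : probability Omega R.

(** Samples and block totals sit side by side in [I + J], so an induction over [l] never changes the
    index type. With a one-point [J] the same family shows that a sample outside [l] is independent
    of the sum over [l]. *)
Definition partial_block_sums (I J : finType) (g : I -> J)
    (Y : I -> Omega -> R) (l : seq I) (k : I + J) : Omega -> R :=
  match k with
  | inl i => if i \in l then cst 0 else Y i
  | inr j => fun w => \sum_(i <- l | g i == j) Y i w
  end.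

(* The summands move one at a time from their own slot, which becomes the
   constant 0, to the slot of their block. *)
Lemma mutually_indep_partial_block_sums (I J : finType) (g : I -> J)
    (Y : I -> Omega -> R) (l : seq I) :
    (forall i, measurable_fun setT (Y i)) -> mutually_indep P Y -> uniq l ->
  mutually_indep P (partial_block_sums g Y l).
Proof.
move=> mY indY; elim: l => [_|i l IHl /= /andP[il ul]].
  move=> B mB.
  have EY i : partial_block_sums g Y [::] (inl i) = Y i by [].
  have E0 j : partial_block_sums g Y [::] (inr j) = cst 0.
    by apply/funext => w /=; rewrite big_nil.
  have := indY (fun i => B (inl i)) (fun i => mB (inl i)).
  have [B0|] := pselect (forall j, (B (inr j)) 0); last first.
    move=> /existsNP[j Bj] _.
    have Ej : partial_block_sums g Y [::] (inr j) @^-1` B (inr j) = set0.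
      by rewrite E0 preimage_cst; case: ifPn => //; rewrite inE.
    rewrite (bigD1 (inr j))//= Ej measure0 mul0e.
    rewrite [X in P X](_ : _ = set0) ?measure0//.
    apply/seteqP; split=> // w Hw; have := Hw (inr j) Logic.I.
    by rewrite Ej.
  rewrite big_sumType/= => EP.
  have Ej j : partial_block_sums g Y [::] (inr j) @^-1` B (inr j) = setT.
    by rewrite E0 preimage_cst mem_set.
  under [X in (_ * X)%E]eq_bigr do rewrite Ej probability_setT.
  rewrite [X in (_ * X)%E]big1// mule1 -EP; congr (P _); apply/seteqP; split=> w Hw.
    by move=> i _; have := Hw (inl i) Logic.I.
  by move=> [i|j] _; [exact: Hw|rewrite Ej].
have neq : inl i != inr (g i) :> I + J by [].
have mpb k : measurable_fun setT (partial_block_sums g Y l k).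
  case: k => [i'|j] /=; first by case: ifP.
  rewrite (_ : (fun w => _) =
      fun w => \sum_(i' <- l) (if g i' == j then Y i' w else 0)).
    by apply: measurable_sum => i'; case: (g i' == j).
  by apply/funext => w; rewrite big_mkcond.
have := mutually_indep_merge neq mpb (IHl ul).
congr mutually_indep; apply/funext => -[i'|j] /=.
  rewrite inE -[inl i' == _]/(i' == i).
  by case: eqP => [->|].
have [->|neq'] := eqVneq j (g i).
  rewrite eqxx; apply/funext => w /=.
  by rewrite (negbTE il) big_cons eqxx.
have -> : (inr j == inr (g i) :> I + J) = false.
  by apply/negbTE; apply: contra neq' => /eqP[->].
by apply/funext => w; rewrite big_cons eq_sym (negbTE neq').
Qed.

Lemma mutually_indep_block_sums (I J : finType) (g : I -> J)
    (Y : I -> Omega -> R) :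
    (forall i, measurable_fun setT (Y i)) -> mutually_indep P Y ->
  mutually_indep P (fun j w => \sum_(i | g i == j) Y i w).
Proof.
move=> mY indY.
have := mutually_indep_partial_block_sums g mY indY (index_enum_uniq I).
by move=> /(mutually_indep_inj (h := inr)); apply => x y [].
Qed.

(** By induction: with a one-point block type, the head of the list is independent of the sum over
    the tail, and exponentials are nonnegative, so the expectation factors even when infinite. *)
Lemma expectation_expR_sum (I : finType) (Y : I -> Omega -> R) :
    (forall i, measurable_fun setT (Y i)) -> mutually_indep P Y ->
  ('E_P[fun w => expR (\sum_i Y i w)]
   = \prod_i 'E_P[fun w => expR (Y i w)])%E.
Proof.
move=> mY indY; have := index_enum_uniq I; elim: (index_enum I) => [|i l IHl].
  rewrite big_nil => _; rewrite -(expectation_cst P 1); congr expectation.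
  by apply/funext => w; rewrite big_nil expR0.
move=> /= /andP[il ul]; rewrite big_cons -IHl//.
have mS : measurable_fun setT (fun w => \sum_(i <- l) Y i w) by exact: measurable_sum.
have /mutually_indep_indep2 :=
  mutually_indep_partial_block_sums (fun=> tt) mY indY ul.
move=> /(_ (inl i) (inr tt) erefl); rewrite /= (negbTE il) => ind2.
have := @integral_indep2 _ _ _ P (mfun_of (mY i)) (mfun_of mS) (EFin \o expR) (EFin \o expR) ind2.
rewrite !expectation.unlock => /= <-//.
- by apply: eq_integral => w _; rewrite big_cons expRD EFinM.
- by apply/measurable_EFinP.
- by apply/measurable_EFinP.
Qed.

End PartialBlockSums.

(** * Sub-Gaussian variables and Chernoff bounds *)

Section ExpBounds.
Context {R : realType}.

(** A Taylor bound with explicit remainder, obtained from [expR (- x) >= 1 - x]. The linear term is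
    kept because it has mean zero in the application. *)
Lemma expR_le_quad (x : R) : expR x <= 1 + x + x ^+ 2 * expR `|x|.
Proof.
have exm : expR x * (1 - x) <= 1.
  rewrite -[leRHS](expRxMexpNx_1 x) ler_pM2l ?expR_gt0//.
  exact: expR_ge1Dx.
have e1 := expR_ge1Dx x.
have [x0|x0] := lerP 0 x.
  have H := ler_wpM2l x0 exm.
  rewrite ger0_norm// -subr_ge0.
  have -> : 1 + x + x ^+ 2 * expR x - expR x
      = (1 - expR x * (1 - x)) + (x * 1 - x * (expR x * (1 - x))) by ring.
  by rewrite addr_ge0// subr_ge0.
have H : x * (expR x - 1 - x) <= 0.
  by apply: mulr_le0_ge0; [exact: ltW|lra].
have exp1 : 1 <= expR `|x| by have := expR_ge1Dx `|x|; have := normr_ge0 x; lra.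
have H2 : x ^+ 2 * 1 <= x ^+ 2 * expR `|x| by apply: ler_wpM2l => //; exact: sqr_ge0.
rewrite -subr_ge0; have -> : 1 + x + x ^+ 2 * expR `|x| - expR x
  = (x ^+ 2 * expR `|x| - x ^+ 2 * 1) + (1 - expR x * (1 - x))
    - x * (expR x - 1 - x) by ring.
rewrite subr_ge0 (le_trans H)// addr_ge0// subr_ge0//.
Qed.

Lemma sqr_le_expR (x : R) : 0 <= x -> x ^+ 2 <= 2 * expR x.
Proof. by move=> x0; have := expR_ge1Dxn 1 x0; rewrite -[_`!%:R]/(2 : R); lra. Qed.

(* Completing the square, [exp (y^2 / (4 s^2))] is the maximum over [k] of
   [exp (k y / s - k^2)], up to the factor [e] lost by rounding [k]. *)
Lemma expR_sqr_le_discrete (s y : R) : 0 < s -> exists k : nat,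
  expR (y ^+ 2 / (4 * s ^+ 2)) <= expR 1 * expR (- (k%:R ^+ 2))
    * (expR (k%:R / s * y) + expR (- (k%:R / s) * y)).
Proof.
move=> s0; pose x := `|y| / (2 * s).
have x0 : 0 <= x by rewrite divr_ge0// mulr_ge0// ltW.
exists (Num.trunc x); set k : R := (Num.trunc x)%:R.
have /andP[k1 k2] : k <= x < k + 1.
  by have := truncn_itv x0; rewrite -natr1.
have -> : y ^+ 2 / (4 * s ^+ 2) = x ^+ 2.
  by rewrite /x expr_div_n real_normK ?num_real// exprMn; congr (_ / (_ * _)); ring.
have H : x ^+ 2 <= 1 - k ^+ 2 + k / s * `|y|.
  have -> : k / s * `|y| = 2 * k * x by rewrite /x; field; rewrite gt_eqF.
  nra.
apply: (le_trans (y := expR (1 - k ^+ 2 + k / s * `|y|))).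
  by rewrite ler_expR.
rewrite !expRD; apply: ler_wpM2l; first by rewrite mulr_ge0 ?expR_ge0.
have [y0|y0] := lerP 0 y.
  by rewrite ger0_norm// ler_wpDr ?expR_ge0.
by rewrite ltr0_norm// mulNr mulrN ler_wpDl ?expR_ge0.
Qed.

(** From [(k - 1) ^+ 2 >= 0] one gets [k ^+ 2 / 2 >= k - 1], and [expR 1 >= 2]. The Gaussian weight
    is thus dominated by a geometric one, which makes the series over [k] summable. *)
Lemma expR_sqr_half_le (k : nat) :
  expR (- (k%:R ^+ 2 / 2)) <= expR 1 / 2 ^+ k :> R.
Proof.
have e2 : 2 <= expR 1 :> R by have := expR_ge1Dx (1 : R); lra.
apply: (le_trans (y := expR 1 * expR (- k%:R))).
  rewrite -expRD ler_expR; have := sqr_ge0 (k%:R - 1 : R); nra.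
apply: ler_wpM2l; first exact: expR_ge0.
rewrite expRN lef_pV2 ?posrE ?exprn_gt0 ?expR_gt0//.
by rewrite -[X in expR X]mulr1 expRM_natl lerXn2r ?nnegrE ?expR_ge0.
Qed.

End ExpBounds.

Section SubGaussian.
Context {dO : measure_display} {Omega : measurableType dO} {R : realType}.
Variable P : probability Omega R.

Definition subgaussian_rv (sigma2 : R) (Y : Omega -> R) : Prop :=
  forall lambda : R, ('E_P[fun w => expR (lambda * Y w)]
    <= (expR (lambda ^+ 2 * sigma2 / 2))%:E)%E.

Lemma integrable_ge0_lty (f : Omega -> R) : measurable_fun setT f ->
  (forall w, 0 <= f w) -> ('E_P[f] < +oo)%E -> f \in Lfun P 1.
Proof.
move=> mf f0 fy; apply/Lfun1_integrable/integrableP; split.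
  exact/measurable_EFinP.
under eq_integral => w _ do rewrite /= ger0_norm//.
by rewrite expectation.unlock in fy.
Qed.

(** One factor [expR 1] is lost by rounding in [expR_sqr_le_discrete], the other in
    [expR_sqr_half_le]; the two signs and the sum of the powers of 1/2 give 4, and a further 2 is
    slack. *)
Definition expsq_const : R := 8 * expR 1 * expR 1.

Lemma expsq_const_gt0 : 0 < expsq_const.
Proof. by rewrite !mulr_gt0 ?expR_gt0. Qed.

(** The exponential of the square is dominated pointwise by a series of exponentials of multiples of
    [Y], to each of which the hypothesis applies. The weight [expR (- k ^+ 2)] loses half its
    exponent to the sub-Gaussian bound at [k / s], and the remaining half is summable. *)
Lemma subgaussian_expR_sqr (sigma2 : R) (Y : Omega -> R) :
    0 < sigma2 -> measurable_fun setT Y -> subgaussian_rv sigma2 Y ->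
  ('E_P[fun w => expR (Y w ^+ 2 / (4 * sigma2))] <= expsq_const%:E)%E.
Proof.
move=> s20 mY subY; pose s := Num.sqrt sigma2.
have s0 : 0 < s by rewrite sqrtr_gt0.
have sE : s ^+ 2 = sigma2 by rewrite sqr_sqrtr// ltW.
pose f (k : nat) (w : Omega) := expR 1 * expR (- (k%:R ^+ 2))
    * (expR (k%:R / s * Y w) + expR (- (k%:R / s) * Y w)).
have f0 k w : 0 <= f k w by rewrite !mulr_ge0// ?addr_ge0 ?expR_ge0.
have mexp (c : R) : measurable_fun setT (fun w => expR (c * Y w)).
  by apply: measurableT_comp => //; exact: measurable_funM.
have mf k : measurable_fun setT (f k).
  by apply: measurable_funM => //; exact: measurable_funD.
rewrite expectation.unlock.
apply: (@le_trans _ _ (\int[P]_w \sum_(k <oo) (f k w)%:E)%E).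
  apply: ge0_le_integral => //.
  - apply/measurable_EFinP; apply: measurableT_comp => //.
    by apply: measurable_funM => //; exact: measurable_funX.
  - apply: ge0_emeasurable_sum; first by move=> k w _ _; rewrite lee_fin.
    by move=> k _; apply/measurable_EFinP.
  move=> w _; have [k] := expR_sqr_le_discrete (Y w) s0.
  rewrite sE -/(f k w) => fk.
  apply: (@le_trans _ _ (\sum_(0 <= i < k.+1) (f i w)%:E)%E).
    rewrite big_nat_recr//= -[leLHS]add0e leeD ?lee_fin//.
    by apply: sume_ge0 => i _; rewrite lee_fin.
  by apply: nneseries_lim_ge => i _ _; rewrite lee_fin.
rewrite integral_nneseries//; last 2 first.
  - by move=> k; apply/measurable_EFinP.
  - by move=> k w _; rewrite lee_fin.
apply: (@le_trans _ _ (\sum_(k <oo) (expsq_const / (2 ^ k.+1)%:R)%:E)%E); last first.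
  by apply: epsilon_trick0; exact/ltW/expsq_const_gt0.
apply: lee_nneseries => [k _ _|k _].
  by apply: integral_ge0 => w _; rewrite lee_fin.
have intE (c : R) : (\int[P]_w (expR (c * Y w))%:E <= (expR (c ^+ 2 * sigma2 / 2))%:E)%E.
  by have := subY c; rewrite expectation.unlock.
under eq_integral do rewrite EFinM EFinD.
rewrite ge0_integralZl_EFin//; last 2 first.
- by move=> w _; rewrite -EFinD lee_fin addr_ge0 ?expR_ge0.
- by apply: emeasurable_funD; apply/measurable_EFinP.
rewrite ge0_integralD//; [|exact/measurable_EFinP|exact/measurable_EFinP].
apply: (@le_trans _ _ ((expR 1 * expR (- k%:R ^+ 2))%:E *
   ((expR (k%:R ^+ 2 / 2))%:E + (expR (k%:R ^+ 2 / 2))%:E))%E).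
  rewrite lee_wpmul2l// ?lee_fin ?mulr_ge0 ?expR_ge0//.
  have E : (k%:R / s) ^+ 2 * sigma2 / 2 = k%:R ^+ 2 / 2.
    by rewrite expr_div_n sE mulfVK ?gt_eqF.
  apply: leeD.
    by have := intE (k%:R / s); rewrite E.
  by have := intE (- (k%:R / s)); rewrite sqrrN E.
rewrite -EFinD -EFinM lee_fin.
have -> : expR 1 * expR (- k%:R ^+ 2) * (expR (k%:R ^+ 2 / 2) + expR (k%:R ^+ 2 / 2))
   = 2 * expR 1 * expR (- (k%:R ^+ 2 / 2)) :> R.
  have -> : - (k%:R ^+ 2 / 2) = - k%:R ^+ 2 + k%:R ^+ 2 / 2 :> R by field.
  rewrite expRD; ring.
apply: (@le_trans _ _ (2 * expR 1 * (expR 1 / 2 ^+ k))).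
  by apply: ler_wpM2l; [rewrite mulr_ge0 ?expR_ge0|exact: expR_sqr_half_le].
rewrite /expsq_const natrX exprS invfM.
have : 0 <= expR 1 * expR 1 * (2 ^+ k)^-1 :> R.
  by rewrite !mulr_ge0 ?expR_ge0// invr_ge0 exprn_ge0.
by lra.
Qed.

End SubGaussian.

Section Chernoff.
Context {dO : measure_display} {Omega : measurableType dO} {R : realType}.
Variable P : probability Omega R.

(** Half of the exponent [1 / (4 * sigma2)] at which [subgaussian_expR_sqr] controls the square; the
    other half absorbs the factor [x ^+ 2] of the Taylor remainder. *)
Definition sqmgf_radius (sigma2 : R) : R := (8 * sigma2)^-1.

Definition sqmgf_const (sigma2 : R) : R :=
  2 / sqmgf_radius sigma2 ^+ 2 * expR (2 * sqmgf_radius sigma2) * expsq_const.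

Lemma sqmgf_radius_gt0 (sigma2 : R) : 0 < sigma2 -> 0 < sqmgf_radius sigma2.
Proof. by move=> s0; rewrite invr_gt0 mulr_gt0. Qed.

Lemma sqmgf_const_gt0 (sigma2 : R) : 0 < sigma2 -> 0 < sqmgf_const sigma2.
Proof.
move=> s0; have r0 := sqmgf_radius_gt0 s0.
by rewrite mulr_gt0 ?expsq_const_gt0// mulr_gt0 ?expR_gt0// divr_gt0// exprn_gt0.
Qed.

(** To second order, the linear term vanishes in expectation because the second moment is 1, and the
    remainder is [theta ^+ 2] times a multiple of [expR (Y w ^+ 2 / (4 * sigma2))], whose mean is
    bounded. *)
Lemma subgaussian_sqr_mgf (sigma2 theta : R) (Y : Omega -> R) :
    0 < sigma2 -> measurable_fun setT Y -> subgaussian_rv P sigma2 Y ->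
    ('E_P[fun w => (Y w ^+ 2)%R] = 1)%E -> `|theta| <= sqmgf_radius sigma2 ->
  ('E_P[fun w => expR (theta * (Y w ^+ 2 - 1))]
    <= (expR (sqmgf_const sigma2 * theta ^+ 2))%:E)%E.
Proof.
move=> s20 mY subY EY2 tr.
pose r := sqmgf_radius sigma2; have r0 : 0 < r by exact: sqmgf_radius_gt0.
pose G w := expR (Y w ^+ 2 / (4 * sigma2)).
pose c := 2 / r ^+ 2 * expR (2 * r) * theta ^+ 2.
have c0 : 0 <= c.
  by rewrite mulr_ge0 ?sqr_ge0// mulr_ge0 ?expR_ge0// divr_ge0// exprn_ge0// ltW.
have mY2 : measurable_fun setT (fun w => Y w ^+ 2) by exact: measurable_funX.
have mG : measurable_fun setT G.
  by apply: measurableT_comp => //; exact: measurable_funM.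
have EG := subgaussian_expR_sqr s20 mY subY.
have LG : G \in Lfun P 1.
  apply: integrable_ge0_lty => //; first by move=> w; exact: expR_ge0.
  by rewrite (le_lt_trans EG) ?ltry.
have LY2 : (fun w => Y w ^+ 2) \in Lfun P 1.
  apply: integrable_ge0_lty => //; first by move=> w; exact: sqr_ge0.
  by rewrite EY2 ltry.
pose F w := 1 - theta + (theta * Y w ^+ 2 + c * G w).
have leF w : expR (theta * (Y w ^+ 2 - 1)) <= F w.
  set x := theta * _.
  apply: (le_trans (expR_le_quad x)).
  have -> : F w = 1 + x + c * G w by rewrite /F /x; ring.
  rewrite lerD2l.
  have y2 := sqr_ge0 (Y w).
  (* [v] dominates the absolute value of [x]. Since [v ^+ 2 <= 2 * expR v], the remainder is a
     multiple of [expR v * expR v], and the radius is chosen so that this equals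
     [expR (2 * r) * G w]. *)
  set v := r * (Y w ^+ 2 + 1).
  have v0 : 0 <= v by rewrite mulr_ge0 ?addr_ge0// ltW.
  have xv : `|x| <= v.
    rewrite /x normrM ler_pM//.
    by rewrite (le_trans (ler_normD _ _))// normrN normr1 ger0_norm.
  have x2 : x ^+ 2 <= theta ^+ 2 / r ^+ 2 * v ^+ 2.
    have -> : theta ^+ 2 / r ^+ 2 * v ^+ 2 = theta ^+ 2 * (Y w ^+ 2 + 1) ^+ 2.
      by rewrite /v; field; rewrite gt_eqF.
    rewrite /x exprMn ler_wpM2l ?sqr_ge0//; nra.
  have v2 := sqr_le_expR v0.
  have GE : expR (2 * r) * G w = expR v * expR v.
    rewrite -!expRD; congr expR; rewrite /v /r /sqmgf_radius; field.
    by rewrite gt_eqF.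
  apply: (@le_trans _ _ ((theta ^+ 2 / r ^+ 2 * (2 * expR v)) * expR v)).
    apply: ler_pM; rewrite ?sqr_ge0 ?expR_ge0//; last by rewrite ler_expR.
    by apply: (le_trans x2); rewrite ler_wpM2l// divr_ge0 ?sqr_ge0.
  rewrite le_eqVlt; apply/orP; left; apply/eqP.
  rewrite /c; transitivity (2 / r ^+ 2 * theta ^+ 2 * (expR (2 * r) * G w)); last by ring.
  by rewrite GE; ring.
have LF : F = cst (1 - theta) \+ (theta \o* (fun w => Y w ^+ 2) \+ c \o* G).
  by apply/funext => w; rewrite /F /= [theta * _]mulrC [c * _]mulrC.
apply: (@le_trans _ _ 'E_P[F])%E.
  apply: expectation_le.
  - apply: measurableT_comp => //; apply: measurable_funM => //.
    exact: measurable_funB.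
  - rewrite LF; apply: measurable_funD => //.
    by apply: measurable_funD; apply: measurable_funM.
  - by move=> w; exact: expR_ge0.
  - by move=> w; apply: le_trans (leF w); exact: expR_ge0.
  - by apply/aeW => w; exact: leF.
have L1 : theta \o* (fun w => Y w ^+ 2) \in Lfun P 1 by exact: Lfun_scale.
have L2 : c \o* G \in Lfun P 1 by exact: Lfun_scale.
rewrite LF expectationD ?rpredD ?Lfun_cst//.
rewrite [X in (_ + X <= _)%E]expectationD//.
rewrite !expectationZl// expectation_cst EY2 mule1.
apply: (@le_trans _ _ ((1 - theta)%:E + (theta%:E + c%:E * expsq_const%:E))%E).
  by rewrite leeD2l// leeD2l// lee_wpmul2l.
rewrite -!EFinM -!EFinD lee_fin.
have := expR_ge1Dx (sqmgf_const sigma2 * theta ^+ 2).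
apply: le_trans; rewrite /sqmgf_const -/r le_eqVlt; apply/orP; left; apply/eqP.
by rewrite /c; ring.
Qed.

Lemma chernoff_two_sided (J : finType) (Z : J -> Omega -> R) (theta c t : R) :
    0 < theta -> (forall j, measurable_fun setT (Z j)) ->
    mutually_indep P Z ->
    (forall j, 'E_P[fun w => expR (theta * Z j w)] <= (expR c)%:E)%E ->
    (forall j, 'E_P[fun w => expR (- theta * Z j w)] <= (expR c)%:E)%E ->
  (P [set w | (t <= `|\sum_j Z j w|)%R]
    <= (2 * expR (- (theta * t) + c * #|J|%:R))%:E)%E.
Proof.
move=> th0 mZ indZ ub lb.
have mS : measurable_fun setT (fun w => \sum_j Z j w) by exact: measurable_sum.
have one (th : R) : (forall j, 'E_P[fun w => expR (th * Z j w)] <= (expR c)%:E)%E ->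
    ('E_P[fun w => expR (th * \sum_j Z j w)] <= (expR (c * #|J|%:R))%:E)%E.
  move=> H; have mthZ j : measurable_fun setT (fun w => th * Z j w).
    exact: measurable_funM.
  have indthZ : mutually_indep P (fun j w => th * Z j w).
    move=> B mB.
    have mB' j : measurable ((fun x => th * x) @^-1` B j).
      have m : measurable_fun setT (fun x : R => th * x) by exact: measurable_funM.
      by rewrite -[_ @^-1` _]setTI; exact: (m measurableT).
    exact: (indZ _ mB').
  have := expectation_expR_sum mthZ indthZ.
  rewrite (_ : (fun w => expR (\sum_i th * Z i w)) =
               (fun w => expR (th * \sum_i Z i w))); last first.
    by apply/funext => w; rewrite mulr_sumr.
  move=> ->; apply: (@le_trans _ _ (\prod_(j : J) (expR c)%:E)%E).
    suff /andP[//] : (0 <= \prod_(i : J) 'E_P[fun w => expR (th * Z i w)]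
                        <= \prod_(j : J) (expR c)%:E)%E.
    elim/big_ind2 : _ => [|x1 x2 y1 y2 /andP[x10 x12] /andP[y10 y12]|j _].
    - by rewrite lexx lee_fin ler01.
    - by rewrite mule_ge0//= lee_pmul.
    by rewrite H andbT; apply: expectation_ge0 => w; exact: expR_ge0.
  by rewrite prodEFin prodr_const lee_fin mulrC expRM_natl.
have mabs : measurable [set w | (t <= \sum_j Z j w)%R].
  by rewrite -[X in measurable X]setTI; apply: measurable_fun_le.
have mabs' : measurable [set w | (t <= - \sum_j Z j w)%R].
  by rewrite -[X in measurable X]setTI; apply: measurable_fun_le => //;
     exact: measurable_funN.
have tail (S : Omega -> R) : measurable_fun setT S ->
   ('E_P[fun w => expR (theta * S w)] <= (expR (c * #|J|%:R))%:E)%E ->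
   (P [set w | (t <= S w)%R] <= (expR (- (theta * t) + c * #|J|%:R))%:E)%E.
  move=> mS' H; have := @chernoff _ _ _ P (mfun_of mS') theta t th0; move=> /le_trans; apply.
  rewrite addrC expRD EFinM lee_wpmul2r ?lee_fin ?expR_ge0//.
  rewrite /mmt_gen_fun; apply: le_trans H; rewrite le_eqVlt; apply/orP; left.
  by apply/eqP; congr expectation; apply/funext => w /=; rewrite mulrC.
have -> : [set w | (t <= `|\sum_j Z j w|)%R] =
   [set w | (t <= \sum_j Z j w)%R] `|` [set w | (t <= - \sum_j Z j w)%R].
  apply/seteqP; split => w /=.
    by case: ger0P => _; [left|right].
  move=> [H|H]; apply: (le_trans H); first exact: ler_norm.
  by rewrite -normrN; exact: ler_norm.
have /le_trans := measureU2 P mabs mabs'; apply.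
rewrite mulrDl mul1r EFinD leeD//.
  by apply: tail => //; exact: one.
apply: tail; first exact: measurable_funN.
rewrite (_ : (fun w => expR (theta * - _)) = fun w => expR (- theta * \sum_j Z j w)).
  exact: one.
by apply/funext => w; rewrite mulrN mulNr.
Qed.

End Chernoff.

(** * Moments and concentration of block sums *)

Section BlockConcentration.
Context {dO : measure_display} {Omega : measurableType dO} {R : realType}.
Variable P : probability Omega R.

Lemma mutually_indep_map (I : finType) (phi : I -> R -> R)
    (Y : I -> Omega -> R) :
    (forall i, measurable_fun setT (phi i)) -> mutually_indep P Y ->
  mutually_indep P (fun i w => phi i (Y i w)).
Proof.
move=> mphi indY B mB; apply: (indY (fun i => phi i @^-1` B i)) => i.
by rewrite -[_ @^-1` _]setTI; exact: mphi.
Qed.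

Lemma expectation_indep2 (A B : Omega -> R) (f g : R -> R) :
    measurable_fun setT A -> measurable_fun setT B -> indep2 P A B ->
    measurable_fun setT f -> measurable_fun setT g ->
    (forall x, 0 <= f x) -> (forall x, 0 <= g x) ->
  ('E_P[fun w => (f (A w) * g (B w))%R]
   = 'E_P[fun w => f (A w)] * 'E_P[fun w => g (B w)])%E.
Proof.
move=> mA mB ind mf mg f0 g0; rewrite !expectation.unlock.
rewrite -(@integral_indep2 _ _ _ P (mfun_of mA) (mfun_of mB)
  (EFin \o f) (EFin \o g) ind)//.
- exact/measurable_EFinP.
- exact/measurable_EFinP.
Qed.

(** Splitting both factors into positive and negative parts reduces this to four nonnegative
    products, where Tonelli applies. *)
Lemma expectation_mul_indep2 (A B : Omega -> R) :
    measurable_fun setT A -> measurable_fun setT B -> indep2 P A B ->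
    A \in Lfun P 1 -> B \in Lfun P 1 ->
  (A \* B) \in Lfun P 1 /\ ('E_P[A \* B] = 'E_P[A] * 'E_P[B])%E.
Proof.
move=> mA mB ind LA LB.
pose p (x : R) := Num.max x 0; pose n (x : R) := Num.max (- x) 0.
have mp : measurable_fun setT p by exact: measurable_maxr.
have mn : measurable_fun setT n.
  by apply: measurable_maxr => //; exact: measurable_funN.
have p0 x : 0 <= p x by rewrite le_max lexx orbT.
have n0 x : 0 <= n x by rewrite le_max lexx orbT.
have pn x : x = p x - n x.
  by rewrite /p /n; case: (lerP x 0) => x0; [rewrite max_l ?oppr_ge0//; lra|
    rewrite max_r; lra].
have ple x : p x <= `|x| by rewrite ge_max normr_ge0 ler_norm.
have nle x : n x <= `|x| by rewrite ge_max normr_ge0 -normrN ler_norm.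
have Lle (C : Omega -> R) (f : R -> R) : measurable_fun setT C -> C \in Lfun P 1 ->
    measurable_fun setT f -> (forall x, 0 <= f x) -> (forall x, f x <= `|x|) ->
    (f \o C) \in Lfun P 1.
  move=> mC LC mf f0 fle; apply/Lfun1_integrable.
  have := (Lfun1_integrable P C).1 LC.
  apply: le_integrable => //; first by apply/measurable_EFinP; exact: measurableT_comp.
  by move=> w _; rewrite /= lee_fin ger0_norm ?f0 ?fle.
have finE (C : Omega -> R) : C \in Lfun P 1 -> 'E_P[C]%E = (fine 'E_P[C]%E)%:E.
  by move=> LC; rewrite fineK// expectation_fin_num.
have Lprod (f g : R -> R) : measurable_fun setT f -> measurable_fun setT g ->
   (forall x, 0 <= f x) -> (forall x, 0 <= g x) ->
   (forall x, f x <= `|x|) -> (forall x, g x <= `|x|) ->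
   (fun w => f (A w) * g (B w)) \in Lfun P 1.
  move=> mf mg f0 g0 fle gle; apply: integrable_ge0_lty.
  - by apply: measurable_funM; exact: measurableT_comp.
  - by move=> w; rewrite mulr_ge0.
  rewrite expectation_indep2// (finE _ (Lle A f mA LA mf f0 fle)).
  by rewrite (finE _ (Lle B g mB LB mg g0 gle)) -EFinM ltry.
pose pp w := p (A w) * p (B w); pose nn w := n (A w) * n (B w).
pose pn' w := p (A w) * n (B w); pose np w := n (A w) * p (B w).
have Lpp : pp \in Lfun P 1 by exact: Lprod.
have Lnn : nn \in Lfun P 1 by exact: Lprod.
have Lpn : pn' \in Lfun P 1 by exact: Lprod.
have Lnp : np \in Lfun P 1 by exact: Lprod.
have ABE : A \* B = (pp \- pn') \+ (nn \- np).
  apply/funext => w /=; rewrite {1}(pn (A w)) {1}(pn (B w)) /pp /nn /pn' /np.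
  by ring.
have LpA : (p \o A) \in Lfun P 1 by exact: Lle.
have LnA : (n \o A) \in Lfun P 1 by exact: Lle.
have LpB : (p \o B) \in Lfun P 1 by exact: Lle.
have LnB : (n \o B) \in Lfun P 1 by exact: Lle.
have AE : A = (p \o A) \- (n \o A) by apply/funext => w; exact: pn.
have BE : B = (p \o B) \- (n \o B) by apply/funext => w; exact: pn.
have L1 : pp \- pn' \in Lfun P 1 by exact: rpredB.
have L2 : nn \- np \in Lfun P 1 by exact: rpredB.
split; first by rewrite ABE; exact: rpredD.
have -> : ('E_P[A] * 'E_P[B] = ('E_P[p \o A] - 'E_P[n \o A])
    * ('E_P[p \o B] - 'E_P[n \o B]))%E.
  by rewrite -!expectationB// -AE -BE.
rewrite ABE expectationD// !expectationB//.
rewrite /pp /nn /pn' /np !expectation_indep2//.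
rewrite -[fun w => p (A w)]/(p \o A) -[fun w => p (B w)]/(p \o B).
rewrite -[fun w => n (A w)]/(n \o A) -[fun w => n (B w)]/(n \o B).
rewrite (finE _ LpA) (finE _ LnA) (finE _ LpB) (finE _ LnB).
by rewrite -!EFinM -!EFinB -EFinD; congr EFin; ring.
Qed.

(** The cross term between the head and the sum of the tail has mean zero by independence. The
    integrability claims are carried along because the induction needs them. *)
Lemma second_moment_sum (I : finType) (Z : I -> Omega -> R) (l : seq I) :
    (forall i, measurable_fun setT (Z i)) -> mutually_indep P Z ->
    (forall i, Z i \in Lfun P 1) -> (forall i, 'E_P[Z i] = 0)%E ->
    (forall i, (fun w => Z i w ^+ 2) \in Lfun P 1) ->
    (forall i, 'E_P[fun w => (Z i w ^+ 2)%R] = 1)%E -> uniq l ->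
  [/\ (fun w => \sum_(i <- l) Z i w) \in Lfun P 1,
      ('E_P[fun w => (\sum_(i <- l) Z i w)%R] = 0)%E,
      (fun w => (\sum_(i <- l) Z i w) ^+ 2) \in Lfun P 1 &
      ('E_P[fun w => ((\sum_(i <- l) Z i w) ^+ 2)%R] = (size l)%:R%:E)%E].
Proof.
move=> mZ indZ LZ EZ LZ2 EZ2; elim: l => [_|i l IHl /= /andP[il ul]].
  rewrite (_ : (fun w => \sum_(i <- [::]) Z i w) = cst 0); last first.
    by apply/funext => w; rewrite big_nil.
  rewrite (_ : (fun w => (\sum_(i <- [::]) Z i w) ^+ 2) = cst 0); last first.
    by apply/funext => w; rewrite big_nil expr0n.
  by rewrite expectation_cst Lfun_cst.
have [LS ES LS2 ES2] := IHl ul.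
pose S w := \sum_(i <- l) Z i w.
have mS : measurable_fun setT S by exact: measurable_sum.
have /mutually_indep_indep2 :=
  mutually_indep_partial_block_sums (fun=> tt) mZ indZ ul.
move=> /(_ (inl i) (inr tt) erefl); rewrite /= (negbTE il) => ind2.
have [LM EM] := expectation_mul_indep2 (mZ i) mS ind2 (LZ i) LS.
have E1 : (fun w => \sum_(i0 <- i :: l) Z i0 w) = Z i \+ S.
  by apply/funext => w; rewrite big_cons.
have E2 : (fun w => (\sum_(i0 <- i :: l) Z i0 w) ^+ 2) =
   ((fun w => Z i w ^+ 2) \+ 2 \o* (Z i \* S)) \+ (fun w => S w ^+ 2).
  by apply/funext => w /=; rewrite big_cons -/(S w); ring.
have L2 : (2 \o* (Z i \* S)) \in Lfun P 1 by exact: Lfun_scale.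
have L3 : (fun w => Z i w ^+ 2) \+ 2 \o* (Z i \* S) \in Lfun P 1.
  exact: rpredD.
split.
- by rewrite E1; exact: rpredD.
- by rewrite E1 expectationD// EZ ES adde0.
- by rewrite E2; exact: rpredD.
rewrite E2 expectationD// expectationD// EZ2 expectationZl// EM.
by rewrite EZ mul0e mule0 adde0 ES2 -EFinD -natr1 addrC.
Qed.

Lemma subgaussian_sum (I : finType) (Z : I -> Omega -> R) (A : pred I)
    (sigma2 c : R) :
    (forall i, measurable_fun setT (Z i)) -> mutually_indep P Z ->
    (forall i, subgaussian_rv P sigma2 (Z i)) ->
  subgaussian_rv P (c ^+ 2 * #|A|%:R * sigma2)
    (fun w => c * \sum_(i | A i) Z i w).
Proof.
move=> mZ indZ subZ lambda.
(* Summands outside [A] become the constant 0, whose exponential has mean 1, so independence of the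
   whole family can be used as it stands. *)
pose phi (i : I) (x : R) := if A i then lambda * c * x else 0.
have mphi i : measurable_fun setT (phi i).
  by rewrite /phi; case: (A i) => //; exact: measurable_funM.
have indphi := mutually_indep_map mphi indZ.
have mphiZ i : measurable_fun setT (fun w => phi i (Z i w)).
  exact: measurableT_comp (mphi i) (mZ i).
have := expectation_expR_sum mphiZ indphi.
rewrite (_ : (fun w => expR (\sum_i phi i (Z i w))) =
  (fun w => expR (lambda * (c * \sum_(i | A i) Z i w)))); last first.
  apply/funext => w; congr expR; rewrite mulrA mulr_sumr [RHS]big_mkcond.
  by [].
move=> ->.
suff /andP[_] : (0 <= \prod_i 'E_P[fun w => expR (phi i (Z i w))] <=
   \prod_(i : I) (expR (if A i then (lambda * c) ^+ 2 * sigma2 / 2 else 0))%:E)%E.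
  move=> /le_trans; apply; rewrite prodEFin lee_fin.
  rewrite -expR_sum -big_mkcond/= sumr_const ler_expR -mulr_natr.
  by rewrite le_eqVlt; apply/orP; left; apply/eqP; field.
elim/big_ind2 : _ => [|x1 x2 y1 y2 /andP[x10 x12] /andP[y10 y12]|i _].
- by rewrite lexx lee_fin ler01.
- by rewrite mule_ge0//= lee_pmul.
rewrite expectation_ge0 => [/=|w]; last exact: expR_ge0.
rewrite /phi; case: (A i); first exact: subZ.
by rewrite (expectation_cst P (expR 0)).
Qed.

End BlockConcentration.

Section BlockVariance.
Context {dO : measure_display} {Omega : measurableType dO} {R : realType}.
Variable P : probability Omega R.

Lemma Lfun1_of_sqr (Z : Omega -> R) : measurable_fun setT Z ->
  (fun w => Z w ^+ 2) \in Lfun P 1 -> Z \in Lfun P 1.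
Proof.
move=> mZ LZ2; apply/Lfun1_integrable.
have L1 : (cst 1 \+ (fun w => Z w ^+ 2)) \in Lfun P 1.
  by apply: rpredD => //; exact: Lfun_cst.
have := (Lfun1_integrable P _).1 L1.
apply: le_integrable => //; first exact/measurable_EFinP.
move=> w _; rewrite /= lee_fin [leRHS]ger0_norm ?addr_ge0 ?sqr_ge0//.
rewrite -(real_normK (num_real (Z w))); have := sqr_ge0 (`|Z w| - 1); nra.
Qed.

(** The scale [n] may exceed the size of the family, so that families of different sizes get the
    same threshold and exponent. *)
Lemma sum_sqr_concentration (J : finType) (Y : J -> Omega -> R)
    (sigma2 tau n : R) :
    0 < sigma2 -> (forall j, measurable_fun setT (Y j)) -> mutually_indep P Y ->
    (forall j, subgaussian_rv P sigma2 (Y j)) ->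
    (forall j, 'E_P[fun w => (Y j w ^+ 2)%R] = 1)%E ->
    0 < tau <= 2 * sqmgf_const sigma2 * sqmgf_radius sigma2 ->
    #|J|%:R <= n ->
  (P [set w | (tau * n <= `|\sum_j (Y j w ^+ 2 - 1)|)%R]
    <= (2 * expR (- (n * tau ^+ 2 / (4 * sqmgf_const sigma2))))%:E)%E.
Proof.
move=> s20 mY indY subY EY2 /andP[tau0 tau1] Jn.
set C := sqmgf_const sigma2 in tau1 *.
have C0 : 0 < C by exact: sqmgf_const_gt0.
(* The minimizer of [- theta * tau * n + C * theta ^+ 2 * n]; the upper bound on [tau] says exactly
   that it lies within [sqmgf_radius]. *)
pose theta := tau / (2 * C).
have th0 : 0 < theta by rewrite divr_gt0// mulr_gt0.
have th1 : theta <= sqmgf_radius sigma2.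
  rewrite /theta ler_pdivrMr; first by rewrite mulrC.
  by rewrite mulr_gt0.
have mphi (j : J) : measurable_fun setT (fun x : R => x ^+ 2 - 1).
  by apply: measurable_funB => //; exact: measurable_funX.
have ind' := mutually_indep_map mphi indY.
have mY' j : measurable_fun setT (fun w => Y j w ^+ 2 - 1).
  by apply: measurable_funB => //; exact: measurable_funX.
have := chernoff_two_sided (tau * n) (c := C * theta ^+ 2) th0 mY' ind'.
move=> /(_ _ _)/le_trans; apply.
- move=> j; apply: subgaussian_sqr_mgf => //.
  by rewrite ger0_norm// ltW.
- move=> j; have := @subgaussian_sqr_mgf _ _ _ P sigma2 (- theta) (Y j) s20 (mY j) (subY j) (EY2 j).
  by rewrite normrN ger0_norm ?(ltW th0)// sqrrN; apply.
rewrite lee_fin ler_wpM2l// ler_expR.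
have -> : - (n * tau ^+ 2 / (4 * C)) = - (theta * (tau * n)) + C * theta ^+ 2 * n.
  by rewrite /theta; field; rewrite gt_eqF.
by rewrite lerD2l ler_wpM2l// mulr_ge0 ?sqr_ge0// ltW.
Qed.

(** The two sums of squares have expectations [#|I|] and [#|J|]. Each is allowed the deviation
    [tau * #|I|], whence the factor 2 in the threshold and twice the two-sided factor 2 in the
    probability. *)
Lemma block_variance_concentration (I J : finType) (g : I -> J)
    (Z : I -> Omega -> R) (b : nat) (sigma2 tau : R) :
    0 < sigma2 -> (forall i, measurable_fun setT (Z i)) -> mutually_indep P Z ->
    (forall i, 'E_P[Z i] = 0)%E ->
    (forall i, 'E_P[fun w => (Z i w ^+ 2)%R] = 1)%E ->
    (forall i, subgaussian_rv P sigma2 (Z i)) ->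
    (0 < b)%N -> (forall j, #|[pred i | g i == j]| = b) -> (#|J| <= #|I|)%N ->
    0 < tau <= 2 * sqmgf_const sigma2 * sqmgf_radius sigma2 ->
  (P [set w | (2 * tau * #|I|%:R < `|\sum_i Z i w ^+ 2
      - \sum_j b%:R^-1 * (\sum_(i | g i == j) Z i w) ^+ 2
      - (#|I|%:R - #|J|%:R)|)%R]
    <= (4 * expR (- (#|I|%:R * tau ^+ 2 / (4 * sqmgf_const sigma2))))%:E)%E.
Proof.
move=> s20 mZ indZ EZ EZ2 subZ b0 gb JI tauP.
have LZ2 i : (fun w => Z i w ^+ 2) \in Lfun P 1.
  apply: integrable_ge0_lty; first exact: measurable_funX.
    by move=> w; exact: sqr_ge0.
  by rewrite EZ2 ltry.
have LZ i : Z i \in Lfun P 1 by exact: Lfun1_of_sqr.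
pose c : R := (Num.sqrt b%:R)^-1.
have c2 : c ^+ 2 = b%:R^-1 by rewrite exprVn sqr_sqrtr.
have bN0 : b%:R != 0 :> R by rewrite pnatr_eq0 -lt0n.
pose Y j w := c * \sum_(i | g i == j) Z i w.
have mS j : measurable_fun setT (fun w => \sum_(i | g i == j) Z i w).
  rewrite (_ : (fun w => _) = fun w => \sum_(i <- [seq i <- index_enum I | g i == j]) Z i w).
    exact: measurable_sum.
  by apply/funext => w; rewrite big_filter.
have mY j : measurable_fun setT (Y j) by exact: measurable_funM.
have indY : mutually_indep P Y.
  have mc (j : J) : measurable_fun setT (fun x : R => c * x).
    exact: measurable_funM.
  exact: mutually_indep_map mc (mutually_indep_block_sums g mZ indZ).
have subY j : subgaussian_rv P sigma2 (Y j).
  have := subgaussian_sum (fun i => g i == j) c mZ indZ subZ.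
  by rewrite -[#|_|]/(#|[pred i | g i == j]|) gb c2 mulVf// mul1r.
have EY2 j : ('E_P[fun w => (Y j w ^+ 2)%R] = 1)%E.
  have := second_moment_sum mZ indZ LZ EZ LZ2 EZ2
    (filter_uniq (fun i => g i == j) (index_enum_uniq I)).
  move=> [_ _ L E].
  rewrite (_ : (fun w => Y j w ^+ 2) = (c ^+ 2) \o*
    (fun w => (\sum_(i <- [seq i <- index_enum I | g i == j]) Z i w) ^+ 2)).
    rewrite expectationZl// E c2 -EFinM.
    have -> : size [seq i <- index_enum I | g i == j] = b.
      by rewrite -(gb j) size_filter -sum1_count -sum1_card.
    by rewrite mulVf.
  by apply/funext => w /=; rewrite big_filter /Y exprMn mulrC.
have := sum_sqr_concentration s20 mZ indZ subZ EZ2 tauP (lexx _).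
have := sum_sqr_concentration s20 mY indY subY EY2 tauP (n := #|I|%:R).
rewrite ler_nat => /(_ JI); set B2 := [set w | _]; set B1 := [set w | _].
move=> PB2 PB1.
have mB (K : finType) (F : K -> Omega -> R) : (forall k, measurable_fun setT (F k)) ->
   measurable [set w | (tau * #|I|%:R <= `|\sum_j (F j w ^+ 2 - 1)|)%R].
  move=> mF; rewrite -[X in measurable X]setTI; apply: measurable_fun_le => //.
  apply: measurableT_comp => //; apply: measurable_sum => k.
  by apply: measurable_funB => //; exact: measurable_funX.
have mB1 : measurable B1 by exact: mB.
have mB2 : measurable B2 by exact: mB.
set B := [set w | _].
have BS : B `<=` B1 `|` B2.
  move=> w; rewrite /B /B1 /B2 /=.
  have -> : \sum_i (Z i w ^+ 2 - 1) = \sum_i Z i w ^+ 2 - #|I|%:R.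
    by rewrite big_split/= sumrN sumr_const.
  have -> : \sum_j (Y j w ^+ 2 - 1) =
    \sum_j b%:R^-1 * (\sum_(i | g i == j) Z i w) ^+ 2 - #|J|%:R.
    rewrite big_split/= sumrN sumr_const; congr (_ - _).
    by apply: eq_bigr => j _; rewrite exprMn c2.
  set x := \sum_i _; set y := \sum_j _ => H.
  have [|H1] := lerP (tau * #|I|%:R) `|x - #|I|%:R|; first by left.
  right; rewrite leNgt; apply/negP => H2; move: H; rewrite ltNge => /negP; apply.
  have -> : x - y - (#|I|%:R - #|J|%:R) = (x - #|I|%:R) - (y - #|J|%:R) by ring.
  by rewrite (le_trans (ler_normB _ _))//; lra.
have mBB : measurable B.
  rewrite (_ : B = ~` [set w | (`|\sum_i Z i w ^+ 2
      - \sum_j b%:R^-1 * (\sum_(i | g i == j) Z i w) ^+ 2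
      - (#|I|%:R - #|J|%:R)| <= 2 * tau * #|I|%:R)%R]); last first.
    by apply/seteqP; split=> w; rewrite /B/= ltNge => /negP.
  apply: measurableC.
  rewrite -[X in measurable X]setTI; apply: measurable_fun_le => //.
  apply: measurableT_comp => //; apply: measurable_funB => //.
  apply: measurable_funB.
    by apply: measurable_sum => i; exact: measurable_funX.
  apply: measurable_sum => j; apply: measurable_funM => //.
  exact: measurable_funX.
apply: (@le_trans _ _ (P (B1 `|` B2))).
  by apply: le_measure; rewrite ?inE//; exact: measurableU.
have /le_trans := measureU2 P mB1 mB2; apply.
apply: (le_trans (leeD PB1 PB2)); rewrite -EFinD lee_fin.
by rewrite le_eqVlt; apply/orP; left; apply/eqP; ring.
Qed.
End BlockVariance.

(** * Quadratic forms, Maurey's method and restricted eigenvalues *)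

Section QuadraticForms.
Context {R : realType} {d : nat}.
Implicit Types (A B S : 'M[R]_d) (u v w z : 'cV[R]_d).

Definition bil A u v : R := (u^T *m A *m v) 0 0.

Lemma bilDl A u v w : bil A (u + v) w = bil A u w + bil A v w.
Proof. by rewrite /bil raddfD/= !mulmxDl mxE. Qed.

Lemma bilDr A u v w : bil A u (v + w) = bil A u v + bil A u w.
Proof. by rewrite /bil mulmxDr mxE. Qed.

Lemma bilZl A c u v : bil A (c *: u) v = c * bil A u v.
Proof. by rewrite /bil linearZ/= -!scalemxAl mxE. Qed.

Lemma bilZr A c u v : bil A u (c *: v) = c * bil A u v.
Proof. by rewrite /bil -scalemxAr mxE. Qed.

Lemma bil0l A v : bil A 0 v = 0.
Proof. by rewrite -(scale0r 0) bilZl mul0r. Qed.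

Lemma bil0r A u : bil A u 0 = 0.
Proof. by rewrite -(scale0r 0) bilZr mul0r. Qed.

Lemma bil_sumr A u (I : Type) (r : seq I) (P : pred I) (F : I -> 'cV[R]_d) :
  bil A u (\sum_(i <- r | P i) F i) = \sum_(i <- r | P i) bil A u (F i).
Proof. by rewrite (big_morph (bil A u) (bilDr A u) (bil0r A u)). Qed.

Lemma bilDm A B u v : bil (A + B) u v = bil A u v + bil B u v.
Proof. by rewrite /bil mulmxDr mulmxDl mxE. Qed.

Lemma bilZm c A u v : bil (c *: A) u v = c * bil A u v.
Proof. by rewrite /bil -scalemxAr -scalemxAl mxE. Qed.

Lemma bil0m u v : bil 0 u v = 0.
Proof. by rewrite -(scale0r 0) bilZm mul0r. Qed.

Lemma bil_summ (I : Type) (r : seq I) (P : pred I) (F : I -> 'M[R]_d) u v :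
  bil (\sum_(i <- r | P i) F i) u v = \sum_(i <- r | P i) bil (F i) u v.
Proof.
by rewrite (big_morph (fun A => bil A u v) (fun A B => bilDm A B u v) (bil0m u v)).
Qed.

Lemma bilC A u v : A^T = A -> bil A u v = bil A v u.
Proof.
move=> sA; rewrite /bil -[in RHS](trmxK (v^T *m A *m u)) [in RHS]mxE.
by rewrite !trmx_mul trmxK sA mulmxA.
Qed.

Lemma bilDZ_sqr A u v c : A^T = A ->
  bil A (u + c *: v) (u + c *: v)
  = bil A u u + 2 * c * bil A u v + c ^+ 2 * bil A v v.
Proof.
by move=> sA; rewrite !(bilDl, bilDr, bilZl, bilZr) (bilC v u sA); ring.
Qed.

Lemma bil_outer u v : bil (v *m v^T) u u = (u^T *m v) 0 0 ^+ 2.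
Proof.
rewrite /bil mulmxA -[_ *m v^T *m u]mulmxA mxE big_ord1 expr2; congr (_ * _).
by rewrite -[v^T *m u]trmxK [in LHS]mxE trmx_mul trmxK.
Qed.

Definition unitv (j : 'I_d) : 'cV[R]_d := delta_mx j 0.

Lemma bil_unitv A j l : bil A (unitv j) (unitv l) = A j l.
Proof.
by rewrite /bil /unitv trmx_delta -rowE -colE !mxE.
Qed.

Lemma col_unitv_sum v : v = \sum_j v j 0 *: unitv j.
Proof.
by rewrite [LHS]matrix_sum_delta; apply: eq_bigr => j _; rewrite big_ord1.
Qed.

(** The deterministic form of keeping a good realization: Maurey's sampling becomes a finite
    weighted average and needs no probability space. *)
Lemma exists_le_wavg (p a : 'I_d -> R) : (forall j, 0 <= p j) ->
  \sum_j p j = 1 -> exists j, a j <= \sum_i p i * a i.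
Proof.
move=> p0 p1; set S := \sum_i _; apply: contrapT => /forallNP H.
have H' j : S < a j by rewrite ltNge; apply/negP; exact: H.
have E : \sum_j p j * (a j - S) = 0.
  under eq_bigr do rewrite mulrBr.
  by rewrite sumrB -mulr_suml p1 mul1r subrr.
have : \sum_j p j = 0.
  apply: big1 => j _; have : p j * (a j - S) = 0.
    apply: (psumr_eq0P _ E) => // i _.
    by apply: mulr_ge0 => //; rewrite subr_ge0 ltW.
  by move=> /eqP; rewrite mulf_eq0 subr_eq0 [a j == _]gt_eqF// orbF => /eqP.
by rewrite p1 => /eqP; rewrite oner_eq0.
Qed.

Definition signed_unitv (p : 'I_d * bool) : 'cV[R]_d := (-1) ^+ p.2 *: unitv p.1.

Definition unitv_sum (s : seq ('I_d * bool)) : 'cV[R]_d :=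
  \sum_(p <- s) signed_unitv p.

(* Maurey's empirical method: sample [k] signed unit vectors with mean [v]
   independently, and keep a realization at which the form is at most its
   expectation. *)
Lemma maurey B v (k : nat) w : B^T = B -> v != 0 ->
  let L := \sum_j `|v j 0| in
  exists s : k.-tuple ('I_d * bool),
    bil B (w + L *: unitv_sum s) (w + L *: unitv_sum s)
    <= bil B w w + 2 * k%:R * bil B w v + k%:R * (k%:R - 1) * bil B v v
       + k%:R * (L * \sum_j `|v j 0| * B j j).
Proof.
move=> sB vN0 L.
have L0 : 0 < L.
  rewrite lt0r sumr_ge0 ?andbT//; apply: contra vN0 => /eqP H.
  apply/eqP/matrixP => i j; rewrite ord1 [RHS]mxE.
  by apply/eqP; rewrite -normr_eq0; apply/eqP; apply: (psumr_eq0P _ H).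
set D := L * _.
pose sg j : bool := v j 0 < 0.
have vE j : v j 0 = (-1) ^+ sg j * `|v j 0|.
  by rewrite /sg; case: (ltrP (v j 0) 0) => h; rewrite ?expr1 ?expr0;
    [rewrite ltr0_norm// mulN1r opprK|rewrite ger0_norm// mul1r].
pose p j := `|v j 0| / L.
have p0 j : 0 <= p j by rewrite divr_ge0// ltW.
have p1 : \sum_j p j = 1 by rewrite -mulr_suml divff// gt_eqF.
have avgv x : \sum_j p j * (L * bil B x (signed_unitv (j, sg j))) = bil B x v.
  rewrite [in RHS](col_unitv_sum v) bil_sumr; apply: eq_bigr => j _.
  rewrite !bilZr/= [in RHS]vE /p; field; exact: lt0r_neq0.
have avgd : \sum_j p j * (L ^+ 2 * bil B (signed_unitv (j, sg j)) (signed_unitv (j, sg j))) = D.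
  rewrite /D mulr_sumr; apply: eq_bigr => j _.
  rewrite bilZr bilZl bil_unitv/= mulrA mulrA -expr2 sqrr_sign mul1r /p.
  by field; exact: lt0r_neq0.
(* The vectors are fixed one at a time, each chosen so that the conditional expectation [a j] does
   not exceed its average. The starting point [w] is general so that it can absorb the vectors
   already fixed. *)
elim: k w => [|k IHk] w.
  exists [tuple]; rewrite /unitv_sum big_nil scaler0 addr0.
  by rewrite !(mulr0, mul0r) !addr0.
pose T j := w + L *: signed_unitv (j, sg j).
pose a j := bil B (T j) (T j) + 2 * k%:R * bil B (T j) v
  + k%:R * (k%:R - 1) * bil B v v + k%:R * D.
have aE j : a j = (bil B w w + 2 * k%:R * bil B w v
     + k%:R * (k%:R - 1) * bil B v v + k%:R * D)
   + 2 * (L * bil B w (signed_unitv (j, sg j)))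
   + L ^+ 2 * bil B (signed_unitv (j, sg j)) (signed_unitv (j, sg j))
   + 2 * k%:R * (L * bil B v (signed_unitv (j, sg j))).
  rewrite /a /T bilDZ_sqr// bilDl [bil B (L *: _) v]bilZl (bilC (signed_unitv _) v sB); ring.
have [j Hj] := exists_le_wavg a p0 p1.
have [s Hs] := IHk (T j).
exists [tuple of (j, sg j) :: s].
have -> : w + L *: unitv_sum [tuple of (j, sg j) :: s] = T j + L *: unitv_sum s.
  by rewrite /unitv_sum big_cons scalerDr addrA.
apply: (le_trans Hs); apply: (le_trans Hj).
set c0 := bil B w w + _ + _ + _ in aE.
pose e j := signed_unitv (j, sg j).
have -> : \sum_i p i * a i = \sum_i (p i * c0 + 2 * (p i * (L * bil B w (e i)))
    + p i * (L ^+ 2 * bil B (e i) (e i))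
    + 2 * k%:R * (p i * (L * bil B v (e i)))).
  by apply: eq_bigr => i _; rewrite aE; ring.
rewrite !big_split/= -mulr_suml p1 -!mulr_sumr avgd !avgv /c0 -natr1.
by rewrite le_eqVlt; apply/orP; left; apply/eqP; ring.
Qed.

(** Maurey's method from [w = 0] gives [k.+2 * (k.+1 * bil B v v + D) >= 0], [D] being the diagonal
    term. Counting from [k.+2] keeps the factor in front of [bil B v v] positive. *)
Lemma bil_ge_of_unitv_sums B v (k : nat) : B^T = B ->
    (forall s : k.+2.-tuple ('I_d * bool),
       0 <= bil B (unitv_sum s) (unitv_sum s)) ->
  - ((\sum_j `|v j 0|) * \sum_j `|v j 0| * B j j) <= k.+1%:R * bil B v v.
Proof.
move=> sB Bs; have [->|vN0] := eqVneq v 0.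
  rewrite bil0l mulr0 oppr_le0 [X in X * _]big1 ?mul0r// => i _.
  by rewrite mxE normr0.
have [s] := maurey k.+2 0 sB vN0.
set L := \sum_j `|v j 0|; set D := L * _.
rewrite add0r bilZl bilZr !bil0l mulr0 !add0r => H.
have : 0 <= k.+2%:R * (k.+1%:R * bil B v v + D).
  rewrite mulrDr mulrA.
  have -> : k.+1%:R = k.+2%:R - 1 :> R by rewrite -[in RHS]natr1 addrK.
  apply: le_trans H; rewrite mulrA -expr2 mulr_ge0 ?sqr_ge0//.
by rewrite pmulr_rge0 ?ltr0n// -lerBlDr sub0r.
Qed.

End QuadraticForms.

(** * Norms, cones and the transfer of restricted eigenvalues *)

Section Norms.
Context {R : realType}.

Lemma lpnorm1E (d : nat) (u : 'cV[R]_d) : lpnorm 1 u = \sum_i `|u i 0|.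
Proof.
rewrite /lpnorm invr1 powRr1.
  by apply: eq_bigr => i _; rewrite powRr1.
by apply: sumr_ge0 => i _; exact: powR_ge0.
Qed.

Lemma lpnorm2E (d : nat) (u : 'cV[R]_d) :
  lpnorm 2 u = Num.sqrt (\sum_i u i 0 ^+ 2).
Proof.
rewrite /lpnorm powR12_sqrt; last by apply: sumr_ge0 => i _; exact: powR_ge0.
congr Num.sqrt; apply: eq_bigr => i _.
by rewrite powR_mulrn// real_normK// num_real.
Qed.

Lemma sqr_lpnorm2E (d : nat) (u : 'cV[R]_d) :
  lpnorm 2 u ^+ 2 = \sum_i u i 0 ^+ 2.
Proof.
by rewrite lpnorm2E sqr_sqrtr// sumr_ge0// => i _; exact: sqr_ge0.
Qed.

Lemma mxnorm11E (d r : nat) (A : 'M[R]_(d, r)) :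
  mxnorm 1 1 A = \sum_i \sum_j `|A i j|.
Proof.
rewrite /mxnorm lpnorm1E; apply: eq_bigr => i _.
rewrite mxE lpnorm1E ger0_norm ?sumr_ge0//.
by apply: eq_bigr => j _; rewrite !mxE.
Qed.

Lemma mxnorm22E (d r : nat) (A : 'M[R]_(d, r)) :
  mxnorm 2 2 A = Num.sqrt (\sum_i \sum_j A i j ^+ 2).
Proof.
rewrite /mxnorm lpnorm2E; congr Num.sqrt; apply: eq_bigr => i _.
by rewrite mxE sqr_lpnorm2E; apply: eq_bigr => j _; rewrite !mxE.
Qed.

(** Cauchy-Schwarz, read off from the nonnegative sum of the squares of [m * x i - S]. *)
Lemma sqr_sum_le_card (I : finType) (A : {set I}) (x : I -> R) :
  (\sum_(i in A) x i) ^+ 2 <= #|A|%:R * \sum_(i in A) x i ^+ 2.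
Proof.
set S := \sum_(i in A) x i; set m : R := #|A|%:R.
have [m0|mN0] := eqVneq m 0.
  have /card0_eq A0 : #|A| = 0%N.
    by apply/eqP; rewrite -(eqr_nat R); apply/eqP.
  by rewrite m0 mul0r /S big_pred0 ?expr0n.
have m0 : 0 < m by rewrite lt0r mN0 ler0n.
have H : 0 <= \sum_(i in A) (m * x i - S) ^+ 2.
  by apply: sumr_ge0 => i _; exact: sqr_ge0.
have E : \sum_(i in A) (m * x i - S) ^+ 2 =
   m * (m * (\sum_(i in A) x i ^+ 2) - S ^+ 2).
  rewrite (eq_bigr (fun i => m ^+ 2 * x i ^+ 2 + (- (2 * m * S) * x i + S ^+ 2))).
    rewrite !big_split/= -!mulr_sumr sumr_const -/S -mulr_natr -/m; ring.
  by move=> i _; ring.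
by move: H; rewrite E pmulr_rge0// subr_ge0.
Qed.

Lemma re_coneE (d : nat) (A : {set 'I_d}) (c : R) (z : 'cV[R]_d) :
  re_cone A c z <->
  \sum_(j | j \notin A) `|z j 0| <= c * \sum_(j in A) `|z j 0|.
Proof.
rewrite /re_cone/= !lpnorm1E.
have -> : \sum_i `|restrict_coords (~: A)%SET z i 0| = \sum_(j | j \notin A) `|z j 0|.
  rewrite [RHS]big_mkcond; apply: eq_bigr => i _; rewrite mxE inE.
  by case: (i \in A); rewrite //= normr0.
have -> : \sum_i `|restrict_coords A z i 0| = \sum_(j in A) `|z j 0|.
  rewrite [RHS]big_mkcond; apply: eq_bigr => i _; rewrite mxE.
  by case: (i \in A); rewrite //= normr0.
by [].
Qed.

Lemma l1_split (d : nat) (A : {set 'I_d}) (z : 'cV[R]_d) :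
  \sum_j `|z j 0| = \sum_(j in A) `|z j 0| + \sum_(j | j \notin A) `|z j 0|.
Proof. by rewrite (bigID (fun j => j \in A)). Qed.

Lemma sqr_l1_in_le (d : nat) (A : {set 'I_d}) (z : 'cV[R]_d) :
  (\sum_(j in A) `|z j 0|) ^+ 2 <= #|A|%:R * \sum_j z j 0 ^+ 2.
Proof.
apply: (le_trans (sqr_sum_le_card A (fun j => `|z j 0|))).
rewrite ler_wpM2l// [leRHS](bigID (fun j => j \in A))/= ler_wpDr//.
  by apply: sumr_ge0 => i _; exact: sqr_ge0.
by apply: ler_sum => i _; rewrite real_normK// num_real.
Qed.

Lemma sqr_l1_cone_le (d : nat) (A : {set 'I_d}) (z : 'cV[R]_d) :
  re_cone A 3 z -> (\sum_j `|z j 0|) ^+ 2 <= 16 * (#|A|%:R * \sum_j z j 0 ^+ 2).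
Proof.
move=> /re_coneE zA; apply: (@le_trans _ _ (16 * (\sum_(j in A) `|z j 0|) ^+ 2)).
  have -> : 16 * (\sum_(j in A) `|z j 0|) ^+ 2 = (4 * \sum_(j in A) `|z j 0|) ^+ 2.
    by ring.
  rewrite lerXn2r ?nnegrE ?sumr_ge0// ?mulr_ge0 ?sumr_ge0// (l1_split A); lra.
by rewrite ler_wpM2l// sqr_l1_in_le.
Qed.

(** On the net [S] dominates [3 / 4] of [Sigma]. Off the net, Maurey loses
    [(5 / 4) * C0 * L ^+ 2 / k.+1], which on the cone is at most [20 * C0 * s / k.+1] times the
    squared norm. The constant 80 makes this loss at most [kappa0 / 4], leaving
    [3 / 4 - 1 / 4 = 1 / 2] of [kappa0]. *)
Lemma RE_transfer (d s k : nat) (kappa0 C0 : R) (Sigma S : 'M[R]_d) :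
    Sigma^T = Sigma -> S^T = S -> RE_condition kappa0 s Sigma ->
    0 < C0 -> (forall j, Sigma j j <= C0) ->
    (forall t : k.+2.-tuple ('I_d * bool),
       `|bil S (unitv_sum t) (unitv_sum t) - bil Sigma (unitv_sum t) (unitv_sum t)|
       <= 4^-1 * bil Sigma (unitv_sum t) (unitv_sum t)) ->
    80 * C0 * s%:R <= kappa0 * k.+1%:R ->
  RE_condition (kappa0 / 2) s S.
Proof.
move=> sSig sS RE C00 SigC net ks A z As zA.
rewrite -/(bil S z z) sqr_lpnorm2E.
have := RE A z As zA; rewrite -/(bil Sigma z z) sqr_lpnorm2E => REz.
set X := \sum_j _ in REz *.
have X0 : 0 <= X by apply: sumr_ge0 => i _; exact: sqr_ge0.
pose B := S + (- (3 / 4)) *: Sigma.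
have bilB u v : bil B u v = bil S u v - 3 / 4 * bil Sigma u v.
  by rewrite /B bilDm bilZm mulNr.
have sB : B^T = B by rewrite /B linearD linearZ/= sS sSig.
have Bnet (t : k.+2.-tuple ('I_d * bool)) : 0 <= bil B (unitv_sum t) (unitv_sum t).
  by rewrite bilB; have := net t; rewrite ler_norml => /andP[? ?]; lra.
(* The net contains the sum of [k.+2] copies of one unit vector, so its bounds control the diagonals
   as well. *)
have SC j : S j j <= 5 / 4 * C0 /\ 0 <= Sigma j j.
  have := net [tuple of nseq k.+2 (j, false)].
  have -> : unitv_sum [tuple of nseq k.+2 (j, false)] = (k.+2%:R : R) *: unitv j.
    by rewrite /unitv_sum big_nseq iter_addr addr0 /signed_unitv/= scale1r scaler_nat.
  rewrite !bilZl !bilZr !bil_unitv; set K : R := k.+2%:R.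
  have K0 : 0 < K * K by rewrite mulr_gt0.
  have -> : K * (K * S j j) - K * (K * Sigma j j) = K * K * (S j j - Sigma j j).
    by ring.
  have -> : 4^-1 * (K * (K * Sigma j j)) = K * K * (4^-1 * Sigma j j) by ring.
  rewrite normrM (gtr0_norm K0) ler_pM2l// => H.
  have H0 := normr_ge0 (S j j - Sigma j j).
  have Sj := SigC j; move: H; rewrite ler_norml => /andP[? ?].
  by split; lra.
have := bil_ge_of_unitv_sums z sB Bnet.
set L := \sum_j _ => H1.
have L2 : L ^+ 2 <= 16 * (s%:R * X).
  apply: (le_trans (sqr_l1_cone_le zA)); rewrite ler_wpM2l// ler_wpM2r//.
  by rewrite ler_nat.
have L0 : 0 <= L by exact: sumr_ge0.
have H2 : L * (\sum_j `|z j 0| * B j j) <= 5 / 4 * C0 * L ^+ 2.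
  have -> : 5 / 4 * C0 * L ^+ 2 = L * (L * (5 / 4 * C0)) by ring.
  rewrite ler_wpM2l// /L mulr_suml; apply: ler_sum => j _.
  rewrite ler_wpM2l// /B !mxE; have [] := SC j; lra.
have k0 : 0 < k.+1%:R :> R by [].
have H3 : 5 / 4 * C0 * L ^+ 2 <= 4^-1 * (kappa0 * k.+1%:R) * X.
  apply: (@le_trans _ _ (4^-1 * (80 * C0 * s%:R) * X)).
    have -> : 4^-1 * (80 * C0 * s%:R) * X = 5 / 4 * C0 * (16 * (s%:R * X)) by field.
    by rewrite ler_wpM2l// mulr_ge0 ?ltW.
  by rewrite ler_wpM2r// ler_wpM2l// invr_ge0.
have H4 : - (4^-1 * kappa0 * X) <= bil B z z.
  rewrite -(ler_pM2l k0); lra.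
move: H4; rewrite bilB; lra.
Qed.

End Norms.

(** * The penalized quadratic problem *)

Section PenalizedQuadratic.
Context {R : realType}.

Lemma bilE (d : nat) (S : 'M[R]_d) (u v : 'cV[R]_d) :
  bil S u v = \sum_j u j 0 * (S *m v) j 0.
Proof.
rewrite /bil -mulmxA mxE; apply: eq_bigr => j _; by rewrite mxE.
Qed.

Definition lasso_obj (d : nat) (S : 'M[R]_d) (gamma : 'cV[R]_d) (lambda : R)
    (v : 'cV[R]_d) : R :=
  2^-1 * bil S v v - \sum_j gamma j 0 * v j 0 + lambda * \sum_j `|v j 0|.

(** Only the comparison of [w] with [ws] is used. The restricted eigenvalue bounds the squared error
    [X] by [T], the l1-norm on [A], and Cauchy-Schwarz bounds [T ^+ 2] by [X]; together they bound
    both. *)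
Lemma lasso_column (d : nat) (S : 'M[R]_d) (A : {set 'I_d}) (kappa lambda : R)
    (gamma w ws : 'cV[R]_d) :
    S^T = S -> (forall z, 0 <= bil S z z) -> 0 < kappa -> 0 < lambda ->
    (forall z, re_cone A 3 z -> kappa * lpnorm 2 z ^+ 2 <= bil S z z) ->
    (forall j, j \notin A -> ws j 0 = 0) ->
    (forall j, `|gamma j 0 - (S *m ws) j 0| <= lambda / 2) ->
    lasso_obj S gamma lambda w <= lasso_obj S gamma lambda ws ->
  \sum_j `|(w - ws) j 0| <= 12 * lambda * #|A|%:R / kappa /\
  \sum_j (w - ws) j 0 ^+ 2 <= 9 * lambda ^+ 2 * #|A|%:R / kappa ^+ 2.
Proof.
move=> sS psdS k0 l0 RE supp noise opt.
pose D := w - ws; have wE : w = ws + 1 *: D by rewrite scale1r /D addrC subrK.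
set T := \sum_(j in A) `|D j 0|; set T' := \sum_(j | j \notin A) `|D j 0|.
have T0 : 0 <= T by exact: sumr_ge0.
have T'0 : 0 <= T' by exact: sumr_ge0.
have l1D : \sum_j `|D j 0| = T + T' by exact: l1_split.
have Hn : \sum_j (gamma j 0 - (S *m ws) j 0) * D j 0 <= lambda / 2 * (T + T').
  rewrite -l1D mulr_sumr; apply: ler_sum => j _.
  apply: (le_trans (ler_norm _)); rewrite normrM ler_wpM2r//.
have Hp : \sum_j `|ws j 0| - \sum_j `|w j 0| <= T - T'.
  rewrite -sumrB (bigID (fun j => j \in A))/= lerD//.
    apply: ler_sum => j _; rewrite /D !mxE.
    by rewrite -[leRHS]normrN opprB lerBlDr addrC; apply: (le_trans _ (ler_normD _ _)); rewrite subrKC.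
  rewrite -sumrN; apply: ler_sum => j jA; rewrite /D !mxE supp//.
  by rewrite normr0 sub0r oppr0 addr0.
(* The expansion at [ws] leaves half of [bil S D D], against [lambda / 2 * (T + T')] from the noise
   and [lambda * (T - T')] from the penalty. Positivity of the form then gives the cone condition
   with its constant 3. *)
have quad : bil S D D <= 3 * lambda * T - lambda * T'.
  move: opt; rewrite /lasso_obj {1 2}wE bilDZ_sqr// => opt.
  have gw : \sum_j gamma j 0 * w j 0 = \sum_j gamma j 0 * ws j 0 + \sum_j gamma j 0 * D j 0.
    rewrite -big_split/=; apply: eq_bigr => j _; rewrite {1}wE scale1r mxE; ring.
  have bE : bil S ws D = \sum_j (S *m ws) j 0 * D j 0.
    by rewrite bilC// bilE; apply: eq_bigr => j _; rewrite mulrC.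
  have Hn' : \sum_j gamma j 0 * D j 0 - \sum_j (S *m ws) j 0 * D j 0 <= lambda / 2 * (T + T').
    apply: le_trans Hn; rewrite -sumrB le_eqVlt; apply/orP; left; apply/eqP.
    by apply: eq_bigr => j _; ring.
  have Hp' := ler_wpM2l (ltW l0) Hp.
  move: opt Hp' Hn'; rewrite gw bE; lra.
have cone : re_cone A 3 D.
  apply/re_coneE; rewrite -/T -/T'; rewrite -(ler_pM2l l0).
  by have := psdS D; lra.
have := RE D cone; rewrite sqr_lpnorm2E; set X := \sum_j _ => REX.
have X0 : 0 <= X by apply: sumr_ge0 => i _; exact: sqr_ge0.
have kX : kappa * X <= 3 * lambda * T.
  apply: (le_trans REX); apply: (le_trans quad).
  by have := mulr_ge0 (ltW l0) T'0; lra.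
have T2 : T ^+ 2 <= #|A|%:R * X by exact: sqr_l1_in_le.
set m : R := #|A|%:R in T2 *; have m0 : 0 <= m by [].
have kT : kappa * T <= 3 * lambda * m.
  have [Tz|Tp] := lerP T 0.
    have -> : T = 0 by apply/eqP; rewrite eq_le Tz T0.
    by rewrite mulr0 !mulr_ge0// ltW.
  rewrite -(ler_pM2r Tp).
  have -> : kappa * T * T = kappa * T ^+ 2 by ring.
  apply: (@le_trans _ _ (m * (kappa * X))).
    by have := ler_wpM2l (ltW k0) T2; lra.
  by have := ler_wpM2l m0 kX; lra.
have TT' : T' <= 3 * T by move/re_coneE : cone.
split.
  rewrite -/D l1D ler_pdivlMr//; nra.
rewrite -/D -/X ler_pdivlMr ?exprn_gt0//.
have H1 := ler_wpM2l (ltW k0) kX.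
have H2 := ler_wpM2l (ltW l0) kT.
have -> : X * kappa ^+ 2 = kappa * (kappa * X) by ring.
have -> : 9 * lambda ^+ 2 * m = 3 * (lambda * (3 * lambda * m)) by ring.
lra.
Qed.

Lemma mxdotE (d r : nat) (A B : 'M[R]_(d, r)) :
  mxdot A B = \sum_k \sum_j A j k * B j k.
Proof.
rewrite /mxdot /mxtrace; apply: eq_bigr => k _; rewrite mxE.
by apply: eq_bigr => j _; rewrite mxE.
Qed.

Lemma mulmx_colE (d r : nat) (S : 'M[R]_d) (V : 'M[R]_(d, r)) k j :
  (S *m col k V) j 0 = (S *m V) j k.
Proof. by rewrite !mxE; apply: eq_bigr => i _; rewrite mxE. Qed.

Lemma penalized_obj_columns (d r : nat) (S : 'M[R]_d) (U G V : 'M[R]_(d, r))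
    (lambda : R) :
  quad_loss S U V + mxdot G V + lambda * mxnorm 1 1 V
  = \sum_k lasso_obj S (col k (U - G)) lambda (col k V).
Proof.
rewrite /quad_loss mxnorm11E exchange_big/= !mxdotE !mulr_sumr -sumrB -!big_split/=.
apply: eq_bigr => k _; rewrite /lasso_obj bilE.
have -> : \sum_j col k V j 0 * (S *m col k V) j 0 = \sum_j V j k * (S *m V) j k.
  by apply: eq_bigr => j _; rewrite mulmx_colE mxE.
have -> : \sum_j col k (U - G) j 0 * col k V j 0
    = \sum_j V j k * U j k - \sum_j G j k * V j k.
  by rewrite -sumrB; apply: eq_bigr => j _; rewrite !mxE; ring.
have -> : \sum_j `|col k V j 0| = \sum_i `|V i k|.
  by apply: eq_bigr => j _; rewrite !mxE.
by ring.
Qed.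

Lemma card_msupport (d r : nat) (W : 'M[R]_(d, r)) :
  #|msupport W| = (\sum_k #|[set j | W j k != 0%R]%SET|)%N.
Proof.
rewrite -sum1_card (eq_bigl (fun p => W p.1 p.2 != 0)) => [|p]; last by rewrite inE.
rewrite -(pair_big_dep xpredT (fun i k => W i k != 0) (fun _ _ => 1%N))/=.
rewrite (exchange_big_dep xpredT)//=; apply: eq_bigr => k _.
by rewrite -sum1_card; apply: eq_bigl => j; rewrite inE.
Qed.

Lemma penalized_argmin_bound (d r s : nat) (S : 'M[R]_d)
    (U G W Ws : 'M[R]_(d, r)) (kappa lambda : R) :
    S^T = S -> (forall z, 0 <= bil S z z) -> 0 < kappa -> 0 < lambda ->
    RE_condition kappa s S -> s = #|msupport Ws| ->
    (forall j k, `|(U - G - S *m Ws) j k| <= lambda / 2) ->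
    is_argmin (fun V => quad_loss S U V + mxdot G V + lambda * mxnorm 1 1 V) W ->
  mxnorm 1 1 (W - Ws) <= 12 * lambda * s%:R / kappa /\
  mxnorm 2 2 (W - Ws) <= 3 * lambda * Num.sqrt s%:R / kappa.
Proof.
move=> sS psdS k0 l0 RE sE noise opt.
pose A k : {set 'I_d} := [set j | Ws j k != 0]%SET.
have sA : s%:R = \sum_k #|A k|%:R :> R by rewrite sE card_msupport natr_sum.
have As k : (#|A k| <= s)%N.
  by rewrite sE card_msupport (bigD1 k)//= leq_addr.
have colopt k : lasso_obj S (col k (U - G)) lambda (col k W)
    <= lasso_obj S (col k (U - G)) lambda (col k Ws).
  (* Replacing only column [k] by that of [Ws] changes one summand of the objective, so joint
     optimality passes to each column. *)
  pose V := \matrix_(j, l) if l == k then Ws j k else W j l.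
  have := opt V; rewrite !penalized_obj_columns (bigD1 k)//= [leRHS](bigD1 k)//=.
  have -> : col k V = col k Ws by apply/colP => j; rewrite !mxE eqxx.
  rewrite [X in _ <= _ + X](eq_bigr (fun l =>
    lasso_obj S (col l (U - G)) lambda (col l W))) ?lerD2r// => l lk.
  by congr lasso_obj; apply/colP => j; rewrite !mxE (negbTE lk).
have colb k := @lasso_column d S (A k) kappa lambda (col k (U - G)) (col k W)
  (col k Ws) sS psdS k0 l0 (fun z => RE (A k) z (As k)).
have {}colb k : \sum_j `|(W - Ws) j k| <= 12 * lambda * #|A k|%:R / kappa /\
    \sum_j (W - Ws) j k ^+ 2 <= 9 * lambda ^+ 2 * #|A k|%:R / kappa ^+ 2.
  have [] := colb k _ _ (colopt k).
  - by move=> j; rewrite inE negbK mxE => /eqP.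
  - by move=> j; rewrite mulmx_colE mxE; have := noise j k; rewrite [(_ - S *m Ws) j k]mxE [(- (S *m _)) j k]mxE.
  move=> H1 H2; split.
    by apply: le_trans H1; apply: ler_sum => j _; rewrite !mxE.
  by apply: le_trans H2; apply: ler_sum => j _; rewrite !mxE.
split.
  rewrite mxnorm11E exchange_big/= sA mulr_sumr mulr_suml.
  by apply: ler_sum => k _; have [] := colb k.
rewrite mxnorm22E exchange_big/=.
have c0 : 0 <= 3 * lambda / kappa by rewrite divr_ge0 ?mulr_ge0// ltW.
have -> : 3 * lambda * Num.sqrt s%:R / kappa = Num.sqrt ((3 * lambda / kappa) ^+ 2 * s%:R).
  by rewrite sqrtrM ?sqr_ge0// sqrtr_sqr ger0_norm//; ring.
rewrite ler_sqrt; last by rewrite mulr_ge0 ?sqr_ge0.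
rewrite sA mulr_sumr; apply: ler_sum => k _; have [_] := colb k.
move=> /le_trans; apply; rewrite le_eqVlt; apply/orP; left; apply/eqP.
by rewrite exprMn exprVn exprMn; ring.
Qed.

(** The increment along a coordinate is an exact polynomial in [h]; it yields both the gradient and
    the stationarity of a minimizer. *)
Lemma quad_loss_delta (d r : nat) (S : 'M[R]_d) (U W : 'M[R]_(d, r)) j k h :
    S^T = S -> let V := delta_mx j k in
  quad_loss S U (h *: V + W) - quad_loss S U W
  = h * ((S *m W - U) j k + h * (2^-1 * mxdot V (S *m V))).
Proof.
move=> sS V.
have dotD (A B C : 'M[R]_(d, r)) : mxdot (A + B) C = mxdot A C + mxdot B C.
  by rewrite /mxdot raddfD/= mulmxDl raddfD.
have dotZ c (A C : 'M[R]_(d, r)) : mxdot (c *: A) C = c * mxdot A C.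
  by rewrite /mxdot linearZ/= -scalemxAl linearZ.
have dotC (A B : 'M[R]_(d, r)) : mxdot A B = mxdot B A.
  by rewrite !mxdotE; apply: eq_bigr => i _; apply: eq_bigr => l _; rewrite mulrC.
have dotS (A B : 'M[R]_(d, r)) : mxdot A (S *m B) = mxdot B (S *m A).
  by rewrite dotC /mxdot trmx_mul sS mulmxA.
have dotV (B : 'M[R]_(d, r)) : mxdot V B = B j k.
  rewrite mxdotE (bigD1 k)//= (bigD1 j)//= big1 => [|i ij].
    rewrite big1 => [|l lk]; first by rewrite !addr0 mxE !eqxx mul1r.
    by rewrite big1// => i _; rewrite mxE (negbTE lk) andbF mul0r.
  by rewrite mxE (negbTE ij) mul0r.
have -> : (S *m W - U) j k = mxdot V (S *m W) - mxdot V U.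
  by rewrite !dotV [LHS]mxE [X in _ + X]mxE.
rewrite /quad_loss mulmxDr -scalemxAr !(dotD, dotZ).
rewrite [mxdot V (_ + _)]dotC [mxdot W (_ + _)]dotC !(dotD, dotZ).
rewrite [mxdot (S *m V) V]dotC [mxdot (S *m W) V]dotC [mxdot (S *m V) W]dotC.
rewrite [mxdot W (S *m V)]dotS [mxdot (S *m W) W]dotC.
by field.
Qed.

Lemma gradient_quad_loss (d r : nat) (S : 'M[R]_d) (U W : 'M[R]_(d, r)) :
  S^T = S -> gradient (quad_loss S U) W = S *m W - U.
Proof.
move=> sS; apply/matrixP => j k; rewrite /gradient mxE.
have E h := quad_loss_delta U W j k h sS.
rewrite /derive; apply: cvg_lim => //.
rewrite /= in E; set c := (S *m W - U) j k in E *; set e := 2^-1 * _ in E.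
apply: (@cvg_trans _ ((fun h : R => c + h * e) @ 0^')).
  apply: near_eq_cvg; near=> h.
  rewrite /= E [_ *: _]mulrA mulVf ?mul1r//.
  by near: h; exact: nbhs_dnbhs_neq.
apply: cvg_within_filter.
have : (fun h : R => c + h * e) @ (0 : R) --> c + 0 * e.
  by apply: cvgD; [exact: cvg_cst|apply: cvgMl; exact: cvg_id].
by rewrite mul0r addr0.
Unshelve. all: by end_near.
Qed.

Lemma argmin_quad_loss (d r : nat) (S : 'M[R]_d) (U W : 'M[R]_(d, r)) :
  S^T = S -> is_argmin (quad_loss S U) W -> S *m W = U.
Proof.
move=> sS opt; apply/eqP; rewrite -subr_eq0; apply/eqP/matrixP => j k.
rewrite [RHS]mxE; have E h := quad_loss_delta U W j k h sS.
rewrite /= in E; set c := (S *m W - U) j k in E *; set e := 2^-1 * _ in E.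
have H h : 0 <= h * (c + h * e) by rewrite -E subr_ge0; exact: opt.
have e1 : 0 < 2 * (`|e| + 1) by rewrite mulr_gt0// ltr_wpDl.
(* A gradient step short enough that [1 - t * e >= 1 / 2] whatever the sign of [e]: the loss would
   strictly decrease unless [c = 0]. *)
pose t := (2 * (`|e| + 1))^-1; have t0 : 0 < t by rewrite invr_gt0.
have te : t * e <= 2^-1.
  rewrite /t mulrC ler_pdivrMr//.
  by rewrite mulrA mulVf// mul1r (le_trans (ler_norm _))// lerDl.
have := H (- t * c).
have -> : - t * c * (c + - t * c * e) = - (t * (1 - t * e) * c ^+ 2) by ring.
rewrite oppr_ge0 pmulr_rle0; last by rewrite mulr_gt0//; lra.
by move=> c2; apply/eqP; rewrite -sqrf_eq0 eq_le c2 sqr_ge0.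
Qed.

End PenalizedQuadratic.

(** * Concentration of the pooled within-class covariance *)

Section Directions.
Context {dO : measure_display} {Omega : measurableType dO} {R : realType}.
Variable P : probability Omega R.

(** A finite difference of the integrals of the two parts forces both to be finite. This is how
    integrability is read off the moment hypotheses. *)
Lemma Lfun1_of_fin_num (f : Omega -> R) : measurable_fun setT f ->
  'E_P[f]%E \is a fin_num -> f \in Lfun P 1.
Proof.
move=> mf; rewrite expectation.unlock integralE => fE.
have mEf : measurable_fun setT (EFin \o f) by exact/measurable_EFinP.
have mp := measurable_funepos mEf; have mn := measurable_funeneg mEf.
have p0 : (0 <= \int[P]_x (EFin \o f)^\+ x)%E by apply: integral_ge0.
have n0 : (0 <= \int[P]_x (EFin \o f)^\- x)%E by apply: integral_ge0.
have [pf nf] : (\int[P]_x (EFin \o f)^\+ x)%E \is a fin_num /\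
               (\int[P]_x (EFin \o f)^\- x)%E \is a fin_num.
  move: fE p0 n0; case: (\int[P]_x _)%E => [a| |] //; case: (\int[P]_x _)%E => [c| |] //.
apply/Lfun1_integrable/integrableP; split => //.
rewrite -[X in (\int[P]_x X x)%E]/(abse \o (EFin \o f)) fune_abse.
by rewrite ge0_integralD// lte_add_pinfty// ltey_eq ?pf ?nf.
Qed.

Lemma expectation_sumr (I : Type) (r : seq I) (f : I -> Omega -> R) :
    (forall i, f i \in Lfun P 1) ->
  (fun w => \sum_(i <- r) f i w) \in Lfun P 1 /\
  ('E_P[fun w => (\sum_(i <- r) f i w)%R] = \sum_(i <- r) 'E_P[f i])%E.
Proof.
move=> Lf; elim: r => [|i r [IH1 IH2]].
  rewrite (_ : (fun w => _) = cst 0); last by apply/funext => w; rewrite big_nil.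
  by rewrite big_nil expectation_cst Lfun_cst.
rewrite (_ : (fun w => _) = f i \+ (fun w => \sum_(i <- r) f i w)).
  by split; [exact: rpredD|rewrite expectationD// big_cons IH2].
by apply/funext => w; rewrite big_cons.
Qed.

Definition centered_proj (d : nat) (m u : 'cV[R]_d) (x : d.-tuple R) : R :=
  (u^T *m (tuple_col x - m)) 0 0.

Lemma centered_projE (d : nat) (m u : 'cV[R]_d) (x : d.-tuple R) :
  centered_proj m u x = \sum_j u j 0 * (tnth x j - m j 0).
Proof.
by rewrite /centered_proj mxE; apply: eq_bigr => j _; rewrite !mxE.
Qed.

Lemma measurable_centered_proj (d : nat) (m u : 'cV[R]_d) :
  measurable_fun setT (centered_proj m u).
Proof.
rewrite (_ : centered_proj m u = fun x => \sum_j u j 0 * (tnth x j - m j 0)).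
  apply: measurable_sum => j; apply: measurable_funM => //.
  by apply: measurable_funB => //; exact: measurable_tnth.
by apply/funext => x; exact: centered_projE.
Qed.

Section OneSample.
Variables (d : nat) (x : {mfun Omega >-> d.-tuple R}) (m : 'cV[R]_d).
Variable Sigma : 'M[R]_d.
Hypothesis hmom : has_mean_cov P (fun w => tuple_col (x w)) m Sigma.

Let c j w : R := tnth (x w) j - m j 0.

Let mx j : measurable_fun setT (fun w => tnth (x w) j).
Proof. exact: (measurableT_comp (measurable_tnth j)). Qed.

Let Lx j : (fun w => tnth (x w) j) \in Lfun P 1.
Proof.
apply: Lfun1_of_fin_num => //; have [/(_ j) + _] := hmom.
rewrite (_ : (fun w => tuple_col (x w) j 0) = fun w => tnth (x w) j).
  by move=> ->.
by apply/funext => w; rewrite mxE.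
Qed.

Let Ex j : 'E_P[fun w => tnth (x w) j]%E = (m j 0)%:E.
Proof.
have [/(_ j) <- _] := hmom; congr expectation.
by apply/funext => w; rewrite mxE.
Qed.

Let cE j : c j = (fun w => tnth (x w) j) \- cst (m j 0).
Proof. by []. Qed.

Let Lc j : c j \in Lfun P 1.
Proof. by rewrite cE; apply: rpredB => //; exact: Lfun_cst. Qed.

Let Ec j : 'E_P[c j]%E = 0%E.
Proof.
by rewrite cE expectationB ?Lfun_cst// Ex expectation_cst -EFinB subrr.
Qed.

Let Ecc j l : 'E_P[fun w => (c j w * c l w)%R]%E = (Sigma j l)%:E.
Proof.
have [_ /(_ j l) <-] := hmom; rewrite covariance.unlock.
have E k : (fun w => tuple_col (x w) k 0) = (fun w => tnth (x w) k).
  by apply/funext => w; rewrite mxE.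
by rewrite !E !Ex.
Qed.

Let Lcc j l : (fun w => c j w * c l w) \in Lfun P 1.
Proof.
apply: Lfun1_of_fin_num; last by rewrite Ecc.
by apply: measurable_funM; apply: measurable_funB.
Qed.

Lemma expectation_centered_proj u :
  ('E_P[fun w => centered_proj m u (x w)] = 0)%E.
Proof.
rewrite (_ : (fun w => _) = fun w => \sum_j (u j 0 \o* c j) w).
  have [|_ ->] := @expectation_sumr _ (index_enum _) (fun j => u j 0 \o* c j).
    by move=> j; exact: Lfun_scale.
  by rewrite big1// => j _; rewrite expectationZl// Ec mule0.
apply/funext => w; rewrite centered_projE; apply: eq_bigr => j _ /=.
by rewrite mulrC.
Qed.

Lemma expectation_sqr_centered_proj u :
  ('E_P[fun w => (centered_proj m u (x w) ^+ 2)%R] = (bil Sigma u u)%:E)%E.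
Proof.
pose f j l := (u j 0 * u l 0) \o* (fun w => c j w * c l w).
have Lf j l : f j l \in Lfun P 1 by exact: Lfun_scale.
pose F j w := \sum_l f j l w.
have FE j := @expectation_sumr _ (index_enum _) (f j) (Lf j).
have [|_] := @expectation_sumr _ (index_enum _) F.
  by move=> j; have [] := FE j.
rewrite (_ : (fun w => \sum_j F j w) = (fun w => centered_proj m u (x w) ^+ 2)).
  move=> ->; rewrite bilE -sumEFin; apply: eq_bigr => j _.
  have [_ ->] := FE j; rewrite mxE mulr_sumr -sumEFin; apply: eq_bigr => l _.
  by rewrite expectationZl// Ecc -EFinM; congr EFin; ring.
apply/funext => w; rewrite centered_projE expr2 mulr_suml; apply: eq_bigr => j _.
by rewrite mulr_sumr; apply: eq_bigr => l _; rewrite /f/= /c; ring.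
Qed.

End OneSample.

Section Root.
Variables (d : nat) (Sigma Q : 'M[R]_d).
Hypotheses (hS : Sigma \in unitmx) (hQ : is_psd_sqrt Sigma Q).

Lemma psd_sqrt_sym : Sigma^T = Sigma.
Proof. by have [QT _ <-] := hQ; rewrite trmx_mul QT. Qed.

Lemma psd_sqrt_unit : Q \in unitmx.
Proof. by have [_ _ QQ] := hQ; move: hS; rewrite -QQ unitmx_mul => /andP[]. Qed.

Lemma bil_psd_sqrt u : bil Sigma u u = \sum_j (Q *m u) j 0 ^+ 2.
Proof.
have [QT _ QQ] := hQ; rewrite /bil -QQ mulmxA -[u^T *m Q *m Q *m u]mulmxA.
have -> : u^T *m Q = (Q *m u)^T by rewrite trmx_mul QT.
by rewrite mxE; apply: eq_bigr => j _; rewrite mxE expr2.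
Qed.

Lemma bil_psd_sqrt_ge0 u : 0 <= bil Sigma u u.
Proof. by rewrite bil_psd_sqrt sumr_ge0// => j _; exact: sqr_ge0. Qed.

Lemma bil_psd_sqrt_eq0 u : bil Sigma u u = 0 -> u = 0.
Proof.
rewrite bil_psd_sqrt => /psumr_eq0P H.
have Qu : Q *m u = 0.
  apply/colP => j; rewrite [RHS]mxE; apply/eqP; rewrite -sqrf_eq0; apply/eqP.
  by apply: H => // i _; exact: sqr_ge0.
by rewrite -(mulKmx psd_sqrt_unit u) Qu mulmx0.
Qed.

(** With [r] the square root of [bil Sigma u u], the vector [r^-1 *: (Q *m u)] has norm 1, and its
    product with the whitened sample is the centered projection divided by [r]. *)
Lemma subgaussian_centered_proj (x : {mfun Omega >-> d.-tuple R})
    (m u : 'cV[R]_d) (sigma2 : R) :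
    subgaussian P sigma2 (fun w => invmx Q *m (tuple_col (x w) - m)) ->
  subgaussian_rv P (sigma2 * bil Sigma u u)
    (fun w => centered_proj m u (x w)).
Proof.
move=> sub lambda; set q := bil Sigma u u.
have [q0|qN0] := eqVneq q 0.
  have u0 := bil_psd_sqrt_eq0 q0.
  rewrite q0 !mulr0 mul0r (_ : (fun w => _) = cst 1) ?expectation_cst ?expR0//.
  by apply/funext => w; rewrite /centered_proj u0 trmx0 mul0mx mxE mulr0 expR0.
have qgt0 : 0 < q by rewrite lt0r qN0 bil_psd_sqrt_ge0.
have [QT _ QQ] := hQ.
pose r := Num.sqrt q; have r0 : 0 < r by rewrite sqrtr_gt0.
have r2 : r ^+ 2 = q by rewrite sqr_sqrtr// ltW.
pose v := r^-1 *: (Q *m u).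
have v1 : lpnorm 2 v = 1.
  rewrite lpnorm2E (eq_bigr (fun j => (r ^+ 2)^-1 * (Q *m u) j 0 ^+ 2)).
    by rewrite -mulr_sumr -bil_psd_sqrt r2 mulVf ?sqrtr1.
  by move=> j _; rewrite mxE exprMn exprVn.
have := sub (lambda * r) v v1.
rewrite (_ : (fun w => expR (lambda * r * _)) =
   (fun w => expR (lambda * centered_proj m u (x w)))).
  suff -> : (lambda * r) ^+ 2 * sigma2 / 2 = lambda ^+ 2 * (sigma2 * q) / 2 by [].
  by rewrite exprMn r2; ring.
apply/funext => w; congr expR; rewrite /v linearZ/= -scalemxAl mxE.
rewrite trmx_mul QT -mulmxA mulKVmx ?psd_sqrt_unit// /centered_proj.
by field; rewrite gt_eqF.
Qed.

End Root.

End Directions.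

(** * Scatter matrices over an arbitrary block map *)

Section PooledCovariance.
Context {dO : measure_display} {Omega : measurableType dO} {R : realType}.
Variable P : probability Omega R.

Lemma subgaussian_tail (Y : Omega -> R) (v t : R) :
    0 < v -> 0 < t -> measurable_fun setT Y -> subgaussian_rv P v Y ->
  (P [set w | (t <= `|Y w|)%R] <= (2 * expR (- (t ^+ 2 / (2 * v))))%:E)%E.
Proof.
move=> v0 t0 mY subY; pose theta := t / v.
have th0 : 0 < theta by rewrite divr_gt0.
have ind1 : mutually_indep P (fun _ : unit => Y).
  move=> B mB; rewrite (bigD1 tt)//= big1 ?mule1; last by case.
  congr (P _); apply/seteqP; split=> w; first by move=> /(_ tt Logic.I).
  by move=> ? [].
have := @chernoff_two_sided _ _ _ P unit (fun _ => Y) theta (theta ^+ 2 * v / 2) t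
  th0 (fun _ => mY) ind1 (fun _ => subY theta).
rewrite -[in X in X -> _](sqrrN theta) => /(_ (fun _ => subY (- theta))).
rewrite card_unit mulr1 (_ : [set w | _] = [set w | t <= `|Y w|]); last first.
  by apply/seteqP; split=> w; rewrite /= (bigD1 tt)//= big1 ?addr0//; case.
move=> /le_trans; apply; rewrite lee_fin ler_wpM2l// ler_expR /theta.
by rewrite le_eqVlt; apply/orP; left; apply/eqP; field; rewrite gt_eqF.
Qed.

Lemma subgaussian_rv_le (Y : Omega -> R) (v v' : R) :
  v <= v' -> subgaussian_rv P v Y -> subgaussian_rv P v' Y.
Proof.
move=> vv' subY lambda; apply: (le_trans (subY lambda)).
by rewrite lee_fin ler_expR ler_wpM2r// ler_wpM2l// sqr_ge0.
Qed.

Lemma measurable_norm_gt (f : Omega -> R) (a : R) : measurable_fun setT f ->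
  measurable [set w | a < `|f w|].
Proof.
move=> mf; rewrite (_ : [set w | _] = ~` [set w | `|f w| <= a]); last first.
  by apply/seteqP; split=> w; rewrite /= ltNge => /negP.
apply: measurableC; rewrite -[X in measurable X]setTI.
by apply: measurable_fun_le => //; exact: measurableT_comp.
Qed.

Lemma union_bound (T : finType) (B : T -> set Omega) (p : R) :
    (forall t, measurable (B t)) -> (forall t, (P (B t) <= p%:E)%E) ->
  exists F : set Omega, [/\ measurable F, (P F <= (#|T|%:R * p)%:E)%E &
    forall w, ~ F w -> forall t, ~ B t w].
Proof.
move=> mB PB; suff [F [mF PF FB]] : exists F : set Omega,
    [/\ measurable F, (P F <= ((size (enum T))%:R * p)%:E)%E &
      forall w, ~ F w -> forall t, t \in enum T -> ~ B t w].
  by exists F; split; rewrite ?cardE// => w Fw t; apply: FB; rewrite ?mem_enum.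
elim: (enum T) => [|t l [F [mF PF FB]]].
  by exists set0; split; rewrite ?measure0 ?mul0r.
exists (B t `|` F); split; first exact: measurableU.
  have /le_trans := measureU2 P (mB t) mF; apply.
  by rewrite /= -natr1 mulrDl mul1r addrC EFinD leeD.
move=> w /not_orP[Btw Fw] t'; rewrite inE => /predU1P[->//|].
exact: FB.
Qed.

Definition block_mean (I J : finType) (d b : nat) (g : I -> J)
    (x : I -> 'cV[R]_d) (j : J) : 'cV[R]_d :=
  b%:R^-1 *: \sum_(i | g i == j) x i.

(** The block map [g] is left general: labels of one machine give [within_cov], pairs of machine and
    label give the average over all machines. *)
Definition pooled_cov (I J : finType) (d b : nat) (g : I -> J)
    (x : I -> 'cV[R]_d) : 'M[R]_d :=
  (#|I|%:R - #|J|%:R)^-1 *: \sum_j \sum_(i | g i == j)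
    (x i - block_mean b g x j) *m (x i - block_mean b g x j)^T.

Lemma pooled_cov_sym (I J : finType) (d b : nat) (g : I -> J)
  (x : I -> 'cV[R]_d) : (pooled_cov b g x)^T = pooled_cov b g x.
Proof.
rewrite /pooled_cov linearZ/= linear_sum/=; congr (_ *: _); apply: eq_bigr => j _.
by rewrite linear_sum/=; apply: eq_bigr => i _; rewrite trmx_mul trmxK.
Qed.

Lemma pooled_cov_psd (I J : finType) (d b : nat) (g : I -> J)
    (x : I -> 'cV[R]_d) u : (#|J| <= #|I|)%N -> 0 <= bil (pooled_cov b g x) u u.
Proof.
move=> JI; rewrite /pooled_cov bilZm bil_summ mulr_ge0//.
  by rewrite invr_ge0 subr_ge0 ler_nat.
apply: sumr_ge0 => j _; rewrite bil_summ; apply: sumr_ge0 => i _.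
by rewrite bil_outer sqr_ge0.
Qed.

(** In a block of size [b] with total [T], the squares of [z i - T / b] sum to those of [z i] minus
    [T ^+ 2 / b]. Centering at the population means first is harmless, since they are constant on
    blocks, and makes the [z i] independent and centered. *)
Lemma bil_pooled_cov (I J : finType) (d b : nat) (g : I -> J)
    (x m : I -> 'cV[R]_d) (mu : J -> 'cV[R]_d) (u : 'cV[R]_d) :
    (0 < b)%N -> (forall j, #|[pred i | g i == j]| = b) ->
    (forall i, m i = mu (g i)) ->
  bil (pooled_cov b g x) u u = (#|I|%:R - #|J|%:R)^-1 *
    (\sum_i (u^T *m (x i - m i)) 0 0 ^+ 2
     - \sum_j b%:R^-1 * (\sum_(i | g i == j) (u^T *m (x i - m i)) 0 0) ^+ 2).
Proof.
move=> b0 gb mE; rewrite /pooled_cov bilZm; congr (_ * _).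
have bN0 : b%:R != 0 :> R by rewrite pnatr_eq0 -lt0n.
rewrite bil_summ (partition_big g xpredT)//= -sumrB; apply: eq_bigr => j _.
set z := fun i => (u^T *m (x i - m i)) 0 0.
pose T := \sum_(i | g i == j) z i.
have cardj : \sum_(i | g i == j) (1 : R) = b%:R.
  by rewrite sumr_const -[#|_|]/(#|[pred i | g i == j]|) gb.
have dev i : g i == j -> (u^T *m (x i - block_mean b g x j)) 0 0 = z i - b%:R^-1 * T.
  move=> /eqP gij.
  have Em : b%:R^-1 *: \sum_(i | g i == j) m i = mu j.
    rewrite (eq_bigr (fun=> mu j)) => [|k /eqP kj]; last by rewrite mE kj.
    have gbj : #|(fun i => g i == j)| = b by exact: gb j.
    rewrite sumr_const gbj.
    by rewrite -[mu j *+ b]scaler_nat scalerA mulVf// scale1r.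
  have -> : block_mean b g x j = mu j + b%:R^-1 *: \sum_(i | g i == j) (x i - m i).
    by rewrite /block_mean sumrB scalerBr Em addrC subrK.
  rewrite opprD addrA -gij -mE gij mulmxBr mxE [X in _ + X]mxE; congr (_ - _).
  rewrite -scalemxAr mxE mulmx_sumr summxE; congr (_ * _).
rewrite bil_summ (eq_bigr (fun i => (z i ^+ 2 + (- (2 * (b%:R^-1 * T)) * z i
    + (b%:R^-1 * T) ^+ 2 * 1)))) => [|i gij]; last first.
  by rewrite bil_outer dev//; ring.
rewrite !big_split/= -!mulr_sumr cardj -/T.
by field.
Qed.

Section Concentration.
Variables (d b : nat) (I J : finType) (g : I -> J).
Variables (X : I -> {mfun Omega >-> d.-tuple R}) (mu : J -> 'cV[R]_d).
Variables (Sigma Q : 'M[R]_d) (sigma2 : R).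
Hypotheses (s20 : 0 < sigma2) (b0 : (0 < b)%N).
Hypothesis gb : forall j, #|[pred i | g i == j]| = b.
Hypothesis JI : (2 * #|J| <= #|I|)%N.
Hypothesis indX : mutually_independent P X.
Hypotheses (hS : Sigma \in unitmx) (hQ : is_psd_sqrt Sigma Q).
Hypothesis hmom :
  forall i, has_mean_cov P (fun w => tuple_col (X i w)) (mu (g i)) Sigma.
Hypothesis hsub : forall i,
  subgaussian P sigma2 (fun w => invmx Q *m (tuple_col (X i w) - mu (g i))).

Let z u i w := centered_proj (mu (g i)) u (X i w).

Let mz u i : measurable_fun setT (z u i).
Proof. exact: (measurableT_comp (measurable_centered_proj _ _)). Qed.

Let indz u : mutually_indep P (z u).
Proof.
exact: (mutually_indep_comp indX (fun i => measurable_centered_proj (mu (g i)) u)).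
Qed.

Lemma bil_pooled_cov_sample u w :
  bil (pooled_cov b g (fun i => tuple_col (X i w))) u u =
  (#|I|%:R - #|J|%:R)^-1 * (\sum_i z u i w ^+ 2
     - \sum_j b%:R^-1 * (\sum_(i | g i == j) z u i w) ^+ 2).
Proof. exact: bil_pooled_cov. Qed.

Lemma measurable_bil_pooled_cov u :
  measurable_fun setT
    (fun w => bil (pooled_cov b g (fun i => tuple_col (X i w))) u u).
Proof.
under eq_fun do rewrite bil_pooled_cov_sample.
apply: measurable_funM => //; apply: measurable_funB.
  by apply: measurable_sum => i; exact: measurable_funX.
apply: measurable_sum => j; apply: measurable_funM => //; apply: measurable_funX.
rewrite (_ : (fun w => _) =
    fun w => \sum_(i <- [seq i <- index_enum I | g i == j]) z u i w).
  exact: measurable_sum.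
by apply/funext => w; rewrite big_filter.
Qed.

Lemma pooled_cov_concentration u tau :
    0 < tau <= 2 * sqmgf_const sigma2 * sqmgf_radius sigma2 ->
  (P [set w | (4 * tau * bil Sigma u u
        < `|bil (pooled_cov b g (fun i => tuple_col (X i w))) u u
            - bil Sigma u u|)%R]
    <= (4 * expR (- (#|I|%:R * tau ^+ 2 / (4 * sqmgf_const sigma2))))%:E)%E.
Proof.
move=> tauP; set q := bil Sigma u u.
have [q0|qN0] := eqVneq q 0.
  rewrite (_ : [set w | _] = set0) ?measure0 ?lee_fin ?mulr_ge0 ?expR_ge0//.
  apply/seteqP; split=> // w; rewrite /= q0 (bil_psd_sqrt_eq0 hS hQ q0).
  by rewrite bil0l subr0 normr0 mulr0 ltxx.
have q0 : 0 < q by rewrite lt0r qN0 (bil_psd_sqrt_ge0 hQ).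
pose r := Num.sqrt q; have r0 : 0 < r by rewrite sqrtr_gt0.
have r2 : r ^+ 2 = q by rewrite sqr_sqrtr// ltW.
have mdev : measurable [set w | 4 * tau * q
    < `|bil (pooled_cov b g (fun i => tuple_col (X i w))) u u - q|].
  by apply: measurable_norm_gt; apply: measurable_funB => //;
    exact: measurable_bil_pooled_cov.
have [I0|Ipos] := posnP #|I|.
  rewrite I0 !mul0r oppr0 expR0 mulr1.
  by rewrite (le_trans (probability_le1 P mdev))// lee_fin ler1n.
pose Z i w := r^-1 * z u i w.
have mZ i : measurable_fun setT (Z i) by exact: measurable_funM.
have indZ : mutually_indep P Z.
  apply: (mutually_indep_map (phi := fun _ x => r^-1 * x)) (indz u) => i.
  exact: measurable_funM.
have EZ i : ('E_P[Z i] = 0)%E.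
  rewrite (_ : Z i = r^-1 \o* z u i); last by apply/funext => w; rewrite /Z/= mulrC.
  rewrite expectationZl; last first.
    by apply: Lfun1_of_fin_num => //; rewrite (expectation_centered_proj (hmom i)).
  by rewrite (expectation_centered_proj (hmom i)) mule0.
have EZ2 i : ('E_P[fun w => (Z i w ^+ 2)%R] = 1)%E.
  rewrite (_ : (fun w => _) = r^-1 ^+ 2 \o* (fun w => z u i w ^+ 2)); last first.
    by apply/funext => w; rewrite /Z/= exprMn mulrC.
  have E := expectation_sqr_centered_proj (hmom i) u.
  rewrite expectationZl; last first.
    by apply: Lfun1_of_fin_num; [exact: measurable_funX|rewrite E].
  by rewrite E -EFinM exprVn r2 mulVf.
have subZ i : subgaussian_rv P sigma2 (Z i).
  move=> lambda; have := subgaussian_centered_proj hS hQ u (@hsub i) (lambda * r^-1).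
  rewrite (_ : (fun w => expR _) = fun w => expR (lambda * Z i w)); last first.
    by apply/funext => w; rewrite /Z mulrA.
  suff -> : (lambda / r) ^+ 2 * (sigma2 * bil Sigma u u) / 2 = lambda ^+ 2 * sigma2 / 2 by [].
  by rewrite -/q -r2; field; rewrite gt_eqF.
have JI' : (#|J| <= #|I|)%N by apply: leq_trans JI; rewrite leq_pmull.
have := block_variance_concentration s20 mZ indZ EZ EZ2 subZ b0 gb JI' tauP.
set B := [set w | _]; set B' := [set w | _].
have JIr : 2 * #|J|%:R <= #|I|%:R :> R by rewrite -natrM ler_nat.
have Ir : 0 < #|I|%:R :> R by rewrite ltr0n.
pose D : R := #|I|%:R - #|J|%:R.
have D0 : 0 < D by rewrite /D; have : 0 <= #|J|%:R :> R by []; lra.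
have B'B : B' `<=` B.
  move=> w; rewrite /B /B'/= bil_pooled_cov_sample -/D.
  have -> : \sum_i Z i w ^+ 2 = q^-1 * \sum_i z u i w ^+ 2.
    by rewrite mulr_sumr; apply: eq_bigr => i _; rewrite exprMn exprVn r2.
  have -> : \sum_j b%:R^-1 * (\sum_(i | g i == j) Z i w) ^+ 2 =
     q^-1 * \sum_j b%:R^-1 * (\sum_(i | g i == j) z u i w) ^+ 2.
    rewrite mulr_sumr; apply: eq_bigr => j _.
    by rewrite -mulr_sumr exprMn exprVn r2; ring.
  rewrite -mulrBr; set V := \sum_i _ - _ => H.
  have -> : q^-1 * V - D = q^-1 * D * (D^-1 * V - q).
    by field; rewrite !gt_eqF.
  rewrite normrM gtr0_norm; last by rewrite mulr_gt0 ?invr_gt0.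
  apply: (@le_lt_trans _ _ (q^-1 * D * (4 * tau * q))); last first.
    by rewrite ltr_pM2l ?mulr_gt0 ?invr_gt0.
  (* By [JI], [2 * D] is at least [#|I|]; this turns the absolute threshold [2 * tau * #|I|] into
     the relative one [4 * tau]. *)
  have -> : q^-1 * D * (4 * tau * q) = 2 * tau * (2 * D).
    by field; rewrite gt_eqF.
  have /andP[tau0 _] := tauP.
  by rewrite ler_wpM2l ?mulr_ge0 ?(ltW tau0)// /D; lra.
move=> PB; apply: (le_trans _ PB); apply: le_measure; rewrite ?inE//.
apply: measurable_norm_gt; apply: measurable_funB => //.
apply: measurable_funB; first by apply: measurable_sum => i; exact: measurable_funX.
apply: measurable_sum => j; apply: measurable_funM => //; apply: measurable_funX.
rewrite (_ : (fun w => _) =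
    fun w => \sum_(i <- [seq i <- index_enum I | g i == j]) Z i w).
  exact: measurable_sum.
by apply/funext => w; rewrite big_filter.
Qed.

Lemma pooled_cov_net (T : finType) (U : T -> 'cV[R]_d) tau :
    0 < tau <= 2 * sqmgf_const sigma2 * sqmgf_radius sigma2 ->
  exists F : set Omega, [/\ measurable F,
    (P F <= (#|T|%:R * (4 * expR (- (#|I|%:R * tau ^+ 2
                                     / (4 * sqmgf_const sigma2)))))%:E)%E &
    forall w, ~ F w -> forall t,
      `|bil (pooled_cov b g (fun i => tuple_col (X i w))) (U t) (U t)
        - bil Sigma (U t) (U t)| <= 4 * tau * bil Sigma (U t) (U t)].
Proof.
move=> tauP.
have [t|t|F [mF PF FU]] := @union_bound T (fun t => [set w |
    4 * tau * bil Sigma (U t) (U t)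
    < `|bil (pooled_cov b g (fun i => tuple_col (X i w))) (U t) (U t)
        - bil Sigma (U t) (U t)|])
  (4 * expR (- (#|I|%:R * tau ^+ 2 / (4 * sqmgf_const sigma2)))).
- apply: measurable_norm_gt; apply: measurable_funB => //.
  exact: measurable_bil_pooled_cov.
- exact: pooled_cov_concentration.
exists F; split => // w Fw t; rewrite leNgt; apply/negP; exact: (FU w Fw t).
Qed.

Lemma block_sums_tail (L : finType) (A : L -> pred I) (v : L -> 'cV[R]_d)
    (p t C0 : R) :
    0 < t -> 0 < p -> 0 < C0 -> (forall l, bil Sigma (v l) (v l) <= C0) ->
    (forall l, #|A l|%:R <= p) ->
  exists F : set Omega, [/\ measurable F,
    (P F <= (#|L|%:R * (2 * expR (- (t ^+ 2 / (2 * (p * (sigma2 * C0)))))))%:E)%E &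
    forall w, ~ F w -> forall l,
      `|\sum_(i | A l i) ((v l)^T *m (tuple_col (X i w) - mu (g i))) 0 0| <= t].
Proof.
move=> t0 p0 C00 vC Ap.
pose S l w := 1 * \sum_(i | A l i) z (v l) i w.
have mS l : measurable_fun setT (S l).
  apply: measurable_funM => //.
  rewrite (_ : (fun w => _) =
      fun w => \sum_(i <- [seq i <- index_enum I | A l i]) z (v l) i w).
    exact: measurable_sum.
  by apply/funext => w; rewrite big_filter.
have param l : sigma2 * bil Sigma (v l) (v l) <= sigma2 * C0.
  by rewrite ler_wpM2l ?(ltW s20).
have subS l : subgaussian_rv P (p * (sigma2 * C0)) (S l).
  have H := @subgaussian_sum _ _ _ P I (z (v l)) (A l) (sigma2 * C0) 1 (mz (v l))
    (indz (v l)) (fun i => subgaussian_rv_le (param l)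
      (subgaussian_centered_proj hS hQ (v l) (@hsub i))).
  apply: subgaussian_rv_le H; rewrite expr1n mul1r ler_wpM2r//.
  by rewrite mulr_ge0 ?ltW.
have [l|l|F [mF PF FU]] := @union_bound L (fun l => [set w | t < `|S l w|])
  (2 * expR (- (t ^+ 2 / (2 * (p * (sigma2 * C0)))))).
- exact: measurable_norm_gt.
- have H := @subgaussian_tail (S l) (p * (sigma2 * C0)) t
    (mulr_gt0 p0 (mulr_gt0 s20 C00)) t0 (mS l) (subS l).
  apply: (le_trans _ H); apply: le_measure; rewrite ?inE.
  + exact: measurable_norm_gt.
  + rewrite -[X in measurable X]setTI; apply: measurable_fun_le => //.
    exact: measurableT_comp.
  + by move=> w /=; exact: ltW.
exists F; split => // w Fw l; have := FU w Fw l; rewrite /= /S mul1r => H.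
by rewrite leNgt; apply/negP.
Qed.

End Concentration.
End PooledCovariance.

(** * Averages over the machines *)

Section Machines.
Context {R : realType}.

Definition pair_dir (d : nat) (p : 'I_d * 'I_d * bool) : 'cV[R]_d :=
  unitv p.1.1 + (-1) ^+ p.2 *: unitv p.1.2.

(** Polarization with the directions [e_j + e_l] and [e_j - e_l]: the off-diagonal entries of
    [Sigma] cancel from the sum of the two relative bounds, so only its diagonal enters. *)
Lemma entry_dev (d : nat) (S Sigma : 'M[R]_d) (C0 tau : R) :
    S^T = S -> Sigma^T = Sigma -> (forall j, Sigma j j <= C0) -> 0 <= tau ->
    (forall p : 'I_d * 'I_d * bool,
       `|bil S (pair_dir p) (pair_dir p) - bil Sigma (pair_dir p) (pair_dir p)|
       <= 4 * tau * bil Sigma (pair_dir p) (pair_dir p)) ->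
  forall j l, `|S j l - Sigma j l| <= 4 * tau * C0.
Proof.
move=> sS sSig SigC tau0 dev j l.
have expand A sg : A^T = A -> bil A (pair_dir (j, l, sg)) (pair_dir (j, l, sg)) =
    A j j + 2 * (-1) ^+ sg * A j l + A l l.
  move=> sA; rewrite /pair_dir/= bilDZ_sqr// !bil_unitv.
  by rewrite -exprM mulnC exprM sqrrN expr1n expr1n mul1r.
have := dev (j, l, false); have := dev (j, l, true).
rewrite !expand//= expr0 expr1 !ler_norml => /andP[? ?] /andP[? ?].
have H : tau * (Sigma j j + Sigma l l) <= tau * (C0 + C0).
  by rewrite ler_wpM2l// lerD.
by apply/andP; split; lra.
Qed.

Lemma normr_mulmx_le (d r : nat) (A : 'M[R]_d) (B : 'M[R]_(d, r)) (e : R) j k :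
    (forall i l, `|A i l| <= e) -> `|(A *m B) j k| <= e * mxnorm 1 1 B.
Proof.
move=> Ae; rewrite mxE; apply: (le_trans (ler_norm_sum _ _ _)).
have e0 : 0 <= e by apply: le_trans (Ae j j).
rewrite mxnorm11E mulr_sumr; apply: ler_sum => i _; rewrite normrM.
apply: ler_pM => //; rewrite (bigD1 k)//= lerDl.
by apply: sumr_ge0.
Qed.

Section Average.
Variables (d K b n M : nat) (y : 'I_M -> 'I_n -> 'I_K).
Variable x : 'I_M -> 'I_n -> 'cV[R]_d.
Hypotheses (M0 : (0 < M)%N) (K0 : (0 < K)%N) (b0 : (0 < b)%N) (hn : n = (K * b)%N).
Hypothesis hy : forall m k, #|[set i | y m i == k]%SET| = b.

Definition machine_class (p : 'I_M * 'I_n) : 'I_M * 'I_K := (p.1, y p.1 p.2).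

Lemma sum_machine_class (V : zmodType) (F : 'I_M * 'I_n -> V) m k :
  \sum_(p | machine_class p == (m, k)) F p = \sum_(i | y m i == k) F (m, i).
Proof.
rewrite (eq_bigl (fun p => (p.1 == m) && (y p.1 p.2 == k))) => [|p]; last first.
  by rewrite /machine_class xpair_eqE.
rewrite (eq_bigr (fun p => F (p.1, p.2))) => [|p _]; last by rewrite -surjective_pairing.
rewrite -(pair_big_dep (fun m' => m' == m) (fun m' i => y m' i == k)
  (fun m' i => F (m', i)))/=.
by rewrite big_pred1_eq.
Qed.

Lemma card_machine_class p : #|[pred q | machine_class q == p]| = b.
Proof.
case: p => m k; rewrite -(hy m k) -[LHS]sum1_card -[RHS]sum1_card.
apply/eqP; rewrite -(eqr_nat int) !natr_sum; apply/eqP.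
rewrite (sum_machine_class (fun=> 1%:R)).
by apply: eq_bigl => i; rewrite inE.
Qed.

Lemma card_class m k : #|[pred i | y m i == k]| = b.
Proof. by rewrite -(hy m k); apply: eq_card => i; rewrite !inE. Qed.

Lemma class_mean_block m k :
  class_mean b (x m) (y m) k
  = block_mean b machine_class (fun p => x p.1 p.2) (m, k).
Proof.
by rewrite /class_mean /block_mean (sum_machine_class (fun p => x p.1 p.2)).
Qed.

Lemma within_covE m : within_cov b (x m) (y m) = pooled_cov b (y m) (x m).
Proof. by rewrite /within_cov /pooled_cov !card_ord. Qed.

(** Every machine has the same [n - K] degrees of freedom, so the normalizations multiply to that of
    [M * K] blocks among [M * n] samples. *)
Lemma avg_within_cov :
  M%:R^-1 *: \sum_m within_cov b (x m) (y m)
  = pooled_cov b machine_class (fun p => x p.1 p.2).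
Proof.
rewrite /pooled_cov !card_prod !card_ord !natrM -mulrBr invfM -scalerA.
congr (_ *: _).
pose G p : 'M[R]_d := \sum_(q | machine_class q == p)
  (x q.1 q.2 - block_mean b machine_class (fun p => x p.1 p.2) p) *m
  (x q.1 q.2 - block_mean b machine_class (fun p => x p.1 p.2) p)^T.
rewrite [in RHS](eq_bigr (fun p => G (p.1, p.2))) => [|p _]; last first.
  by rewrite -surjective_pairing.
rewrite -(pair_bigA _ (fun m k => G (m, k)))/=.
rewrite scaler_sumr; apply: eq_bigr => m _; rewrite /within_cov; congr (_ *: _).
apply: eq_bigr => k _; rewrite /G (sum_machine_class (fun p =>
   (x p.1 p.2 - block_mean b machine_class (fun p => x p.1 p.2) (m, k)) *m
   (x p.1 p.2 - block_mean b machine_class (fun p => x p.1 p.2) (m, k))^T)).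
by apply: eq_bigr => i _; rewrite class_mean_block.
Qed.

Lemma avg_local_U_dev (mu : 'I_K -> 'cV[R]_d) (t : R) :
    (forall j k, `|\sum_(p | y p.1 p.2 == k) (x p.1 p.2 - mu k) j 0| <= t) ->
  forall j k, `|(M%:R^-1 *: (\sum_m local_U b (x m) (y m)) - pop_U mu) j k|
    <= 2 * t / (M%:R * b%:R).
Proof.
move=> Ht j k.
have MN0 : M%:R != 0 :> R by rewrite pnatr_eq0 -lt0n.
have bN0 : b%:R != 0 :> R by rewrite pnatr_eq0 -lt0n.
have KN0 : K%:R != 0 :> R by rewrite pnatr_eq0 -lt0n.
pose T k' := \sum_(p | y p.1 p.2 == k') (x p.1 p.2 - mu k') j 0.
pose c k' := M%:R^-1 * \sum_m class_mean b (x m) (y m) k' j 0.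
have cE k' : c k' = mu k' j 0 + (M%:R * b%:R)^-1 * T k'.
  have -> : T k' = M%:R * b%:R * (c k' - mu k' j 0).
    rewrite /T -(pair_big_dep xpredT (fun m i => y m i == k')
      (fun m i => (x m i - mu k') j 0))/= /c mulrBr mulrACA mulfV// mul1r.
    rewrite mulr_sumr -[M%:R * _ * _]mulrA.
    rewrite (_ : M%:R * (b%:R * mu k' j 0) = \sum_(m < M) b%:R * mu k' j 0); last first.
      by rewrite sumr_const card_ord mulr_natl.
    rewrite -sumrB; apply: eq_bigr => m _.
    rewrite /class_mean [in RHS]mxE mulrA mulfV// mul1r summxE.
    rewrite (eq_bigr (fun i => x m i j 0 - mu k' j 0)) => [|i _]; last by rewrite !mxE.
    rewrite sumrB sumr_const -[#|_|]/(#|[pred i | y m i == k']|) card_class.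
    by rewrite mulr_natl.
  by rewrite mulrA mulVf ?mulf_neq0// mul1r addrC subrK.
(* Balance of the classes makes the grand mean the plain average of the class means. *)
have gm m : grand_mean (x m) j 0 = K%:R^-1 * \sum_k' class_mean b (x m) (y m) k' j 0.
  have nE : n%:R = K%:R * b%:R :> R by rewrite hn natrM.
  rewrite /grand_mean mxE nE invfM -mulrA; congr (_ * _).
  rewrite summxE (partition_big (y m) xpredT)//= mulr_sumr; apply: eq_bigr => k' _.
  by rewrite /class_mean mxE summxE.
have E : (M%:R^-1 *: (\sum_m local_U b (x m) (y m)) - pop_U mu) j k =
   (M%:R * b%:R)^-1 * (T (class_of_col k) - K%:R^-1 * \sum_k' T k').
  rewrite [LHS]mxE [X in X + _]mxE [X in _ + X]mxE summxE.
  have -> : \sum_m local_U b (x m) (y m) j k =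
     M%:R * (c (class_of_col k) - K%:R^-1 * \sum_k' c k').
    rewrite mulrBr /c mulrA mulfV// mul1r.
    rewrite -mulr_sumr [in RHS]exchange_big/= mulrCA [M%:R * _]mulrA mulfV// mul1r.
    rewrite mulr_sumr -sumrB; apply: eq_bigr => m _.
    by rewrite /local_U mxE mxE [X in _ + X]mxE gm.
  have -> : pop_U mu j k = mu (class_of_col k) j 0 - K%:R^-1 * \sum_k' mu k' j 0.
    rewrite /pop_U mxE mxE [X in _ + X]mxE /pop_mean -scaler_sumr; congr (_ - _).
    by rewrite mxE summxE.
  rewrite mulrA mulVf// mul1r (eq_bigr _ (fun k' _ => cE k')) big_split/= cE.
  by rewrite -mulr_sumr; ring.
rewrite E normrM ger0_norm ?invr_ge0 ?mulr_ge0// mulrC ler_wpM2r ?invr_ge0 ?mulr_ge0//.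
apply: (le_trans (ler_normB _ _)).
have TT k' : `|T k'| <= t by exact: Ht.
have : `|K%:R^-1 * \sum_k' T k'| <= t.
  rewrite normrM ger0_norm ?invr_ge0// mulrC ler_pdivrMr ?ltr0n//.
  apply: (le_trans (ler_norm_sum _ _ _)).
  apply: (@le_trans _ _ (\sum_(k' < K) t)); first by apply: ler_sum.
  by rewrite sumr_const card_ord mulr_natr.
by have := TT (class_of_col k); lra.
Qed.

End Average.
End Machines.

(** * One step of the iteration *)

Section Step.
Context {R : realType}.

Lemma dmSLDA_step (d r s M : nat) (S : 'I_M -> 'M[R]_d)
    (U : 'I_M -> 'M[R]_(d, r)) (m1 : 'I_M) (Sigma : 'M[R]_d)
    (W0 W Ws : 'M[R]_(d, r)) (kappa lambda eN en eU : R) :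
    (forall m, (S m)^T = S m) -> (forall z, 0 <= bil (S m1) z z) ->
    0 < kappa -> 0 < lambda -> RE_condition kappa s (S m1) ->
    s = #|msupport Ws| ->
    (forall i l, `|(M%:R^-1 *: (\sum_m S m)) i l - Sigma i l| <= eN) ->
    (forall i l, `|S m1 i l - Sigma i l| <= en) ->
    (forall j k, `|(M%:R^-1 *: (\sum_m U m) - Sigma *m Ws) j k| <= eU) ->
    eU + eN * mxnorm 1 1 Ws + (eN + en) * mxnorm 1 1 (W0 - Ws) <= lambda / 2 ->
    is_argmin (fun V => quad_loss (S m1) (U m1) V
      + mxdot (M%:R^-1 *: (\sum_m gradient (quad_loss (S m) (U m)) W0)
               - gradient (quad_loss (S m1) (U m1)) W0) V
      + lambda * mxnorm 1 1 V) W ->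
  mxnorm 1 1 (W - Ws) <= 12 * lambda * s%:R / kappa /\
  mxnorm 2 2 (W - Ws) <= 3 * lambda * Num.sqrt s%:R / kappa.
Proof.
move=> sS psdS k0 l0 RE sE HN Hn HU Hl opt.
apply: (penalized_argmin_bound (sS m1) psdS k0 l0 RE sE _ opt) => j k.
apply: le_trans Hl.
set Sb := M%:R^-1 *: (\sum_m S m) in HN; set Ub := M%:R^-1 *: (\sum_m U m) in HU.
rewrite !gradient_quad_loss//.
have -> : M%:R^-1 *: (\sum_m gradient (quad_loss (S m) (U m)) W0) = Sb *m W0 - Ub.
  rewrite (eq_bigr (fun m => S m *m W0 - U m)) => [|m _]; last first.
    by rewrite gradient_quad_loss.
  by rewrite sumrB scalerBr -mulmx_suml scalemxAl.
(* The residual at [Ws] splits into the error of the averaged data at [Ws] and a term in the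
   previous error [W0 - Ws]. Only the latter involves the local covariance, and it shrinks as the
   iteration proceeds. *)
have -> : U m1 - (Sb *m W0 - Ub - (S m1 *m W0 - U m1)) - S m1 *m Ws
   = (Ub - Sigma *m Ws) + (Sigma - Sb) *m Ws + (S m1 - Sb) *m (W0 - Ws).
  rewrite !(mulmxBl, mulmxBr); apply/matrixP => i l; rewrite !mxE; ring.
rewrite [X in `|X|]mxE [X in `|X + _|]mxE.
apply: (le_trans (ler_normD _ _)); apply: lerD; last first.
  apply: normr_mulmx_le => i l.
  have -> : (S m1 - Sb) i l = - (Sb i l - Sigma i l) + (S m1 i l - Sigma i l).
    by rewrite !mxE; ring.
  by apply: (le_trans (ler_normD _ _)); rewrite normrN lerD.
apply: (le_trans (ler_normD _ _)); apply: lerD; first exact: HU.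
apply: normr_mulmx_le => i l.
have -> : (Sigma - Sb) i l = - (Sb i l - Sigma i l) by rewrite !mxE; ring.
by rewrite normrN.
Qed.

Lemma expR_ln_natmul (x : R) (p : nat) : 0 < x ->
  expR (- (p%:R * ln x)) = x^-1 ^+ p.
Proof. by move=> x0; rewrite -mulrN expRM_natl expRN lnK. Qed.

(** * Exponents large enough for the union bounds *)

Section Budget.
Variables (delta D q : R).
Hypotheses (d0 : 0 < delta) (d3 : delta < 3^-1) (D1 : 1 <= D)
  (qE : q = delta / D).

Let d1 : delta < 1. Proof. move: d3; lra. Qed.

Let D0 : 0 < D. Proof. exact: lt_le_trans D1. Qed.

Let d2 : delta ^+ 2 <= 9^-1.
Proof.
have -> : 9^-1 = 3^-1 ^+ 2 :> R by field.
by rewrite lerXn2r ?nnegrE ?invr_ge0// ltW.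
Qed.

Let q0 : 0 < q. Proof. by rewrite qE divr_gt0. Qed.

Let qd : q <= delta.
Proof. by rewrite qE ler_pdivrMr// ler_peMr// ltW. Qed.

Let inv : (D / delta)^-1 = q. Proof. by rewrite invf_div qE. Qed.

Let r0 : 0 < D / delta. Proof. by rewrite divr_gt0. Qed.

Lemma ln_ratio_gt0 : 0 < ln (D / delta).
Proof.
rewrite ln_gt0// ltr_pdivlMr// mul1r; apply: lt_le_trans D1; exact: d1.
Qed.

(** Each of the [k.+2] factors [D * 2] of the net is paid by one power of [q], leaving
    [2 * delta < 1]; three spare powers give [4 * delta ^+ 3], at most [delta / 2] because
    [delta < 1 / 3]. *)
Lemma net_budget (k : nat) (e : R) : k.+2%:R + 3 <= e ->
  (D * 2) ^+ k.+2 * (4 * expR (- (e * ln (D / delta)))) <= delta / 2.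
Proof.
move=> ke; have l0 := ln_ratio_gt0.
apply: (@le_trans _ _ ((D * 2) ^+ k.+2 * (4 * q ^+ (k.+2 + 3)))).
  rewrite ler_wpM2l ?exprn_ge0 ?mulr_ge0 ?(ltW D0)// ler_wpM2l//.
  rewrite -inv -expR_ln_natmul// ler_expR lerN2 ler_wpM2r ?(ltW l0)//.
  by rewrite natrD.
have -> : (D * 2) ^+ k.+2 * (4 * q ^+ (k.+2 + 3)) = 4 * ((2 * delta) ^+ k.+2 * q ^+ 3).
  have -> : 2 * delta = D * 2 * q by rewrite qE; field; rewrite gt_eqF.
  rewrite exprD [in RHS]exprMn mulrCA; congr (_ * _).
  by rewrite mulrA.
have h1 : (2 * delta) ^+ k.+2 <= 1.
  by rewrite exprn_ile1 ?mulr_ge0 ?(ltW d0)//; move: d3; lra.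
have h2 : q ^+ 3 <= delta ^+ 3 by rewrite lerXn2r ?nnegrE ?(ltW q0) ?(ltW d0).
have q30 : 0 <= q ^+ 3 by rewrite exprn_ge0 ?ltW.
have := ler_wpM2r q30 h1; rewrite mul1r => h3.
have := ler_wpM2l (ltW d0) d2; rewrite -exprS => h4.
move: h2 h3 h4 d0; generalize (q ^+ 3) => Q; lra.
Qed.

Lemma entry_budget :
  D * D * 2 * (4 * expR (- (4 * ln (D / delta)))) <= delta / 2.
Proof.
rewrite (expR_ln_natmul 4 r0) inv.
have -> : D * D * 2 * (4 * q ^+ 4) = 8 * (delta ^+ 2 * q ^+ 2).
  by rewrite qE; field; rewrite gt_eqF.
have h2 : q ^+ 2 <= delta ^+ 2 by rewrite lerXn2r ?nnegrE ?(ltW q0) ?(ltW d0).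
have d20 : 0 <= delta ^+ 2 by exact: sqr_ge0.
have := ler_wpM2l d20 h2 => h3.
have h4 := ler_wpM2l d20 d2.
have h5 : delta ^+ 2 <= 3^-1 * delta.
  by rewrite expr2 ler_wpM2r ?(ltW d0)// ltW.
move: h3 h4 h5 d0; generalize (q ^+ 2) => Q; lra.
Qed.

Lemma mean_budget (c : R) : 0 <= c <= D ->
  c * (2 * expR (- (2 * ln (D / delta)))) <= delta.
Proof.
move=> /andP[c0 cD]; rewrite (expR_ln_natmul 2 r0) inv.
apply: (@le_trans _ _ (D * (2 * q ^+ 2))).
  by rewrite ler_wpM2r// mulr_ge0// sqr_ge0.
have -> : D * (2 * q ^+ 2) = 2 * (delta * q) by rewrite qE; field; rewrite gt_eqF.
have h1 : delta * q <= delta * delta by rewrite ler_wpM2l ?(ltW d0).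
have h2 : delta * delta <= 3^-1 * delta by rewrite ler_wpM2r ?(ltW d0)// ltW.
move: h1 h2 d0; generalize (delta * q) => Q; lra.
Qed.

End Budget.
End Step.

(** * The high-probability events *)

Section Constants.
Context {R : realType}.

(** [c0] is an arbitrary real; the bound must be positive for the square roots and divisions. *)
Definition diag_bound (c0 : R) : R := `|c0| + 1.

Definition tau_max (sigma2 : R) : R :=
  2 * sqmgf_const sigma2 * sqmgf_radius sigma2.

(** 16 is the product of the factor 4 of [entry_dev] and of the 4 in the choice of [tau], which
    makes the exponent equal to the [4 * ln (d / delta)] of [entry_budget]. *)
Definition cov_rate (c0 sigma2 : R) : R :=
  16 * diag_bound c0 * Num.sqrt (sqmgf_const sigma2).

(** The factor 4 brings the Chernoff exponent of the class sums to twice the logarithm, as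
    [mean_budget] requires. *)
Definition mean_rate (c0 sigma2 : R) : R :=
  4 * Num.sqrt (sigma2 * diag_bound c0).

(* The cap [1/16] makes the relative deviation [4 tau] on the Maurey net at most
   [1/4]; [net_factor] makes [k = net_factor * maxn s 1] satisfy the size
   condition [80 C0 s <= kappa0 (k + 1)] of [RE_transfer]. *)
Definition net_tau (sigma2 : R) : R := Num.min (16^-1) (tau_max sigma2).

Definition net_factor (c0 kappa0 : R) : nat :=
  (Num.trunc (80 * diag_bound c0 / kappa0)).+1.

(** The first term makes the exponent reach [k.+2 + 3] logarithms on the Maurey net; the second
    keeps the entrywise deviation within [tau_max]. *)
Definition sample_rate (c0 kappa0 sigma2 : R) : R :=
  ((net_factor c0 kappa0)%:R + 5) * (4 * sqmgf_const sigma2) / net_tau sigma2 ^+ 2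
  + 16 * sqmgf_const sigma2 / tau_max sigma2 ^+ 2.

Lemma diag_bound_gt0 c0 : 0 < diag_bound c0.
Proof. by rewrite ltr_wpDl. Qed.

Lemma le_diag_bound c0 : c0 <= diag_bound c0.
Proof. by rewrite (le_trans (ler_norm _))// lerDl. Qed.

Variables (c0 kappa0 sigma2 : R).
Hypothesis (s20 : 0 < sigma2).

Lemma tau_max_gt0 : 0 < tau_max sigma2.
Proof.
apply: mulr_gt0; last exact: sqmgf_radius_gt0.
by apply: mulr_gt0 => //; exact: sqmgf_const_gt0.
Qed.

Lemma net_tau_gt0 : 0 < net_tau sigma2.
Proof. by rewrite lt_min invr_gt0 ltr0n tau_max_gt0. Qed.

Lemma cov_rate_gt0 : 0 < cov_rate c0 sigma2.
Proof.
by rewrite !mulr_gt0 ?diag_bound_gt0// sqrtr_gt0 sqmgf_const_gt0.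
Qed.

Lemma mean_rate_gt0 : 0 < mean_rate c0 sigma2.
Proof. by rewrite mulr_gt0// sqrtr_gt0 mulr_gt0// diag_bound_gt0. Qed.

Lemma sample_rate_gt0 : 0 < sample_rate c0 kappa0 sigma2.
Proof.
have C0 := sqmgf_const_gt0 s20.
have n0 : 0 < (net_factor c0 kappa0)%:R + 5 :> R by rewrite ltr_wpDl.
apply: addr_gt0; apply: divr_gt0.
- by apply: mulr_gt0 => //; exact: mulr_gt0.
- by rewrite exprn_gt0// net_tau_gt0.
- exact: mulr_gt0.
- by rewrite exprn_gt0// tau_max_gt0.
Qed.

End Constants.

Section Events.
Context {dO : measure_display} {Omega : measurableType dO} {R : realType}.
Variable P : probability Omega R.
Variables (d b : nat) (I J : finType) (g : I -> J).
Variables (X : I -> {mfun Omega >-> d.-tuple R}) (mu : J -> 'cV[R]_d).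
Variables (Sigma Q : 'M[R]_d) (sigma2 c0 : R).
Hypotheses (s20 : 0 < sigma2) (b0 : (0 < b)%N).
Hypothesis gb : forall j, #|[pred i | g i == j]| = b.
Hypothesis JI : (2 * #|J| <= #|I|)%N.
Hypothesis indX : mutually_independent P X.
Hypotheses (hS : Sigma \in unitmx) (hQ : is_psd_sqrt Sigma Q).
Hypothesis hmom :
  forall i, has_mean_cov P (fun w => tuple_col (X i w)) (mu (g i)) Sigma.
Hypothesis hsub : forall i,
  subgaussian P sigma2 (fun w => invmx Q *m (tuple_col (X i w) - mu (g i))).
Hypothesis hc0 : forall j, Sigma j j <= c0.
Variable delta : R.
Hypotheses (d0 : 0 < delta) (d3 : delta < 3^-1) (dpos : (0 < d)%N).
Hypothesis Ipos : (0 < #|I|)%N.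

Let S w := pooled_cov b g (fun i => tuple_col (X i w)).

Let net := pooled_cov_net s20 b0 gb JI indX hS hQ hmom hsub.

Let D1 : 1 <= d%:R :> R. Proof. by rewrite ler1n. Qed.

Let SigC j : Sigma j j <= diag_bound c0.
Proof. exact: le_trans (hc0 j) (le_diag_bound c0). Qed.

Lemma entry_event :
    16 * sqmgf_const sigma2 * ln (d%:R / delta)
      <= #|I|%:R * tau_max sigma2 ^+ 2 ->
  exists F : set Omega, [/\ measurable F, (P F <= (delta / 2)%:E)%E &
    forall w, ~ F w -> forall j l,
      `|S w j l - Sigma j l|
      <= cov_rate c0 sigma2 * Num.sqrt (ln (d%:R / delta) / #|I|%:R)].
Proof.
move=> hI; pose C := sqmgf_const sigma2.
have C0 : 0 < C by exact: sqmgf_const_gt0.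
have l0 : 0 < ln (d%:R / delta) by exact: (ln_ratio_gt0 d0 d3 D1).
set l := ln _ in hI l0 *; pose N : R := #|I|%:R.
have N0 : 0 < N by rewrite ltr0n.
pose tau := 4 * (Num.sqrt C * Num.sqrt (l / N)).
have lN0 : 0 < l / N by rewrite divr_gt0.
have tau0 : 0 < tau by rewrite !mulr_gt0// sqrtr_gt0.
have tau2 : tau ^+ 2 = 16 * C * l / N.
  by rewrite /tau !exprMn !sqr_sqrtr ?ltW//; ring.
have tau1 : tau <= tau_max sigma2.
  have t0 := tau_max_gt0 s20.
  rewrite -(@ler_pXn2r _ 2)// ?nnegrE ?(ltW tau0) ?(ltW t0)//.
  by rewrite tau2 ler_pdivrMr// [_ * N]mulrC.
have tauP : 0 < tau <= 2 * sqmgf_const sigma2 * sqmgf_radius sigma2.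
  by rewrite tau0.
have [F [mF PF HF]] := net (@pair_dir R d) tauP.
exists F; split => //.
  apply: (le_trans PF); rewrite lee_fin !card_prod card_bool !card_ord !natrM.
  rewrite (_ : #|I|%:R * tau ^+ 2 / (4 * sqmgf_const sigma2) = 4 * l).
    exact: (entry_budget d0 d3 D1 erefl).
  by rewrite tau2 -/C -/N; field; rewrite !gt_eqF.
move=> w Fw j k.
rewrite (_ : cov_rate _ _ * _ = 4 * tau * diag_bound c0); last first.
  by rewrite /cov_rate /tau -/C; ring.
apply: entry_dev => //.
- exact: pooled_cov_sym.
- exact: psd_sqrt_sym hQ.
- exact: ltW.
- exact: HF.
Qed.

Lemma RE_event (kappa0 : R) (s : nat) :
    0 < kappa0 -> RE_condition kappa0 s Sigma ->
    ((net_factor c0 kappa0)%:R + 5) * (4 * sqmgf_const sigma2)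
      * (maxn s 1)%:R * ln (d%:R / delta) <= #|I|%:R * net_tau sigma2 ^+ 2 ->
  exists F : set Omega, [/\ measurable F, (P F <= (delta / 2)%:E)%E &
    forall w, ~ F w -> RE_condition (kappa0 / 2) s (S w)].
Proof.
move=> k0 RE hI; pose C := sqmgf_const sigma2.
have C0 : 0 < C by exact: sqmgf_const_gt0.
have l0 : 0 < ln (d%:R / delta) by exact: (ln_ratio_gt0 d0 d3 D1).
(* With [maxn s 1] in place of [s], the additive 5 of the net budget is absorbed as [5 * maxn s 1],
   also when the support is empty. *)
pose k := (net_factor c0 kappa0 * maxn s 1)%N.
have m1 : 1 <= (maxn s 1)%:R :> R by rewrite ler1n leq_max orbT.
have nt0 := net_tau_gt0 s20.
have tauP : 0 < net_tau sigma2 <= 2 * sqmgf_const sigma2 * sqmgf_radius sigma2.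
  by rewrite nt0 ge_min lexx orbT.
have [F [mF PF HF]] := net (fun t : k.+2.-tuple ('I_d * bool) =>
  unitv_sum (R := R) t) tauP.
exists F; split => //.
  apply: (le_trans PF); rewrite lee_fin card_tuple card_prod card_bool card_ord.
  rewrite natrX natrM.
  have ke : k.+2%:R + 3 <= #|I|%:R * net_tau sigma2 ^+ 2 / (4 * C) / ln (d%:R / delta).
    have C40 : 0 < 4 * C by rewrite pmulr_rgt0.
    rewrite ler_pdivlMr// ler_pdivlMr//.
    apply: le_trans hI; rewrite -/C.
    rewrite (_ : (_ + 5) * (4 * C) * _ * _ =
       ((net_factor c0 kappa0)%:R + 5) * (maxn s 1)%:R * ln (d%:R / delta) * (4 * C)); last by ring.
    apply: ler_wpM2r; first exact: ltW.
    apply: ler_wpM2r; first exact: ltW.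
    rewrite /k -(natr1 _.+1) -natr1 natrM; lra.
  have := net_budget d0 d3 D1 erefl ke.
  by rewrite divfK ?gt_eqF.
move=> w Fw; apply: (@RE_transfer _ _ s k kappa0 (diag_bound c0) Sigma) => //.
- exact: psd_sqrt_sym hQ.
- exact: pooled_cov_sym.
- exact: diag_bound_gt0.
- move=> t; apply: (le_trans (HF w Fw t)).
  rewrite ler_wpM2r ?(bil_psd_sqrt_ge0 hQ)//.
  have : net_tau sigma2 <= 16^-1 by rewrite ge_min lexx.
  lra.
have h1 : 80 * diag_bound c0 / kappa0 <= (net_factor c0 kappa0)%:R.
  exact/ltW/truncnS_gt.
rewrite ler_pdivrMr// in h1.
have h2 : s%:R <= (maxn s 1)%:R :> R by rewrite ler_nat leq_maxl.
apply: (@le_trans _ _ (80 * diag_bound c0 * (maxn s 1)%:R)).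
  by rewrite ler_wpM2l// mulr_ge0// ltW// diag_bound_gt0.
apply: (@le_trans _ _ ((net_factor c0 kappa0)%:R * kappa0 * (maxn s 1)%:R)).
  by rewrite ler_wpM2r.
rewrite (_ : _ * kappa0 * _ = kappa0 * k%:R); last by rewrite /k natrM; ring.
by rewrite ler_wpM2l ?(ltW k0)// ler_nat.
Qed.

End Events.

Section MeanEvent.
Context {dO : measure_display} {Omega : measurableType dO} {R : realType}.
Variable P : probability Omega R.

Lemma card_label (M n K b : nat) (y : 'I_M -> 'I_n -> 'I_K) (k : 'I_K) :
    (forall m k, #|[set i | y m i == k]%SET| = b) ->
  #|[pred p : 'I_M * 'I_n | y p.1 p.2 == k]| = (M * b)%N.
Proof.
move=> hy; rewrite -sum1_card.
rewrite -(pair_big_dep xpredT (fun m i => y m i == k) (fun _ _ => 1%N))/=.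
rewrite (eq_bigr (fun=> b)) => [|m _]; first by rewrite sum_nat_const card_ord.
by rewrite -(hy m k) -sum1_card; apply: eq_bigl => i; rewrite inE.
Qed.

Lemma mean_event (d K b n M N : nat) (y : 'I_M -> 'I_n -> 'I_K)
    (X : 'I_M * 'I_n -> {mfun Omega >-> d.-tuple R}) (mu : 'I_K -> 'cV[R]_d)
    (Sigma Q : 'M[R]_d) (sigma2 c0 delta : R) :
    0 < sigma2 -> (0 < K)%N -> (0 < b)%N -> (0 < M)%N -> (0 < d)%N ->
    n = (K * b)%N -> N = (M * n)%N ->
    (forall m k, #|[set i | y m i == k]%SET| = b) ->
    mutually_independent P X -> Sigma \in unitmx -> is_psd_sqrt Sigma Q ->
    (forall m i, subgaussian P sigma2
       (fun w => invmx Q *m (tuple_col (X (m, i) w) - mu (y m i)))) ->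
    (forall j, Sigma j j <= c0) -> 0 < delta -> delta < 3^-1 ->
  let e := mean_rate c0 sigma2
    * Num.sqrt (K%:R * ln (d%:R * M%:R * K%:R / delta) / N%:R) in
  exists F : set Omega, [/\ measurable F, (P F <= delta%:E)%E &
    forall w, ~ F w -> forall j k,
      `|(M%:R^-1 *: (\sum_m local_U b (fun i => tuple_col (X (m, i) w)) (y m))
         - pop_U mu) j k| <= e].
Proof.
move=> s20 K0 b0 M0 dpos hn NE hy indX hS hQ hsub hc0 d0 d3 e.
have C00 := diag_bound_gt0 c0; set C0 := diag_bound c0 in C00.
have [Mr Kr br dr] : [/\ 0 < M%:R :> R, 0 < K%:R :> R, 0 < b%:R :> R & 0 < d%:R :> R].
  by rewrite !ltr0n.
pose D : R := d%:R * M%:R * K%:R.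
have D1 : 1 <= D by rewrite /D -!natrM ler1n !muln_gt0 dpos M0.
have l0 : 0 < ln (D / delta) by exact: (ln_ratio_gt0 d0 d3 D1).
pose p : R := M%:R * b%:R; have p0 : 0 < p by exact: mulr_gt0.
have KN : K%:R * ln (D / delta) / N%:R = ln (D / delta) / p.
  by rewrite NE hn !natrM /p; field; rewrite !gt_eqF.
have lp0 : 0 < ln (D / delta) / p by rewrite divr_gt0.
have e0 : 0 < e.
  by rewrite /e -/D KN mulr_gt0 ?mean_rate_gt0// sqrtr_gt0.
have e2 : e ^+ 2 = 16 * (sigma2 * C0) * (ln (D / delta) / p).
  rewrite /e -/D KN /mean_rate exprMn sqr_sqrtr ?(ltW lp0)// exprMn sqr_sqrtr.
    by rewrite -/C0; ring.
  by rewrite mulr_ge0 ?ltW.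
(* This is the bound on class sums for which [avg_local_U_dev] returns exactly [e]. *)
pose t := p / 2 * e; have t0 : 0 < t by rewrite mulr_gt0// divr_gt0.
have hsub' q : subgaussian P sigma2
    (fun w => invmx Q *m (tuple_col (X q w) - mu (machine_class y q).2)).
  by case: q => m i; exact: hsub.
have [l|l|F [mF PF HF]] := block_sums_tail (g := machine_class y)
  (mu := fun q => mu q.2) (L := ('I_d * 'I_K)%type)
  (A := fun l q => y q.1 q.2 == l.2) (v := fun l => unitv l.1)
  s20 indX hS hQ hsub' t0 p0 C00.
- by rewrite bil_unitv (le_trans (hc0 _))// le_diag_bound.
- rewrite -[#|_|]/(#|[pred q : 'I_M * 'I_n | y q.1 q.2 == l.2]|).
  by rewrite (card_label _ hy) natrM.
exists F; split => //.
  apply: (le_trans PF); rewrite lee_fin card_prod !card_ord natrM.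
  rewrite (_ : t ^+ 2 / (2 * (p * (sigma2 * C0))) = 2 * ln (D / delta)).
    apply: (mean_budget d0 d3 D1 erefl).
    rewrite mulr_ge0//= /D -mulrA [M%:R * _]mulrC mulrA ler_peMr ?mulr_ge0//.
    by rewrite ler1n.
  by rewrite /t exprMn e2; field; rewrite !gt_eqF.
move=> w Fw j k.
have -> : e = 2 * t / (M%:R * b%:R) by rewrite /t /p; field; rewrite !gt_eqF.
apply: (avg_local_U_dev M0 K0 b0 hn hy) => j' k'.
have := HF w Fw (j', k'); congr (`|_| <= _); apply: eq_bigr => q /eqP yq.
rewrite /= /unitv trmx_delta -rowE [LHS]mxE yq.
by rewrite -surjective_pairing.
Qed.

End MeanEvent.

(** * Assembly of the recursive bounds *)

Lemma rescale_bound (R : realType) (a bn z kappa k q r : R) :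
    0 <= a -> 0 <= bn -> 0 <= z -> 0 < kappa -> 0 <= r -> 4 * k <= q ->
  k * (2 * a + 2 * bn * z) * r / (kappa / 2)
    <= q * a * r / kappa + q * bn * r / kappa * z.
Proof.
move=> a0 bn0 z0 kappa0 r0 kq.
have -> : k * (2 * a + 2 * bn * z) * r / (kappa / 2)
    = 4 * k * ((a + bn * z) * r / kappa) by rewrite invf_div; ring.
have -> : q * a * r / kappa + q * bn * r / kappa * z
    = q * ((a + bn * z) * r / kappa) by ring.
rewrite ler_wpM2r// divr_ge0 ?(ltW kappa0)// mulr_ge0// addr_ge0//.
exact: mulr_ge0.
Qed.

(** The factor 2 in [bn] pays for both covariances: the averaged one, with the full-sample rate [u],
    errs by no more than the local rate [v]. *)
Lemma noise_le_penalty (R : realType) (c u v p e z bn : R) :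
    0 <= c -> 0 <= z -> u <= v -> bn = 2 * c * v ->
  e + c * u * p + (c * u + c * v) * z
    <= (2 * (c * u * p + e) + 2 * bn * z) / 2.
Proof.
move=> c0 z0 uv ->.
have h : (c * u + c * v) * z <= 2 * c * v * z.
  by apply: ler_wpM2r => //; have := ler_wpM2l c0 uv; lra.
lra.
Qed.

Theorem theorem2 (R : realType) (sigma2 c0 kappa0 : R)
    (hsigma2 : 0 < sigma2) (hkappa0 : 0 < kappa0) :
  exists c1 c2 c3 : R, [/\ 0 < c1, 0 < c2 & 0 < c3] /\
  forall (d K b n M N : nat)
    (hK : (2 <= K)%N) (hb : (2 <= b)%N) (hM : (0 < M)%N)
    (hn : n = (K * b)%N) (hN : N = (M * n)%N)
    (delta : R) (hdelta : 0 < delta < 1)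
    (dO : measure_display) (Omega : measurableType dO)
    (P : probability Omega R)
    (y : 'I_M -> 'I_n -> 'I_K)
    (hy : forall m k, #|[set i | y m i == k]%SET| = b)
    (X : 'I_M * 'I_n -> {mfun Omega >-> d.-tuple R})
    (hX : mutually_independent P X)
    (mu : 'I_K -> 'cV[R]_d) (Sigma SigmaRoot : 'M[R]_d)
    (hSigma : Sigma \in unitmx) (hRoot : is_psd_sqrt Sigma SigmaRoot)
    (hmom : forall m i,
       has_mean_cov P (fun w => tuple_col (X (m, i) w)) (mu (y m i)) Sigma)
    (hsub : forall m i,
       subgaussian P sigma2
         (fun w => invmx SigmaRoot *m (tuple_col (X (m, i) w) - mu (y m i))))
    (hc0 : forall j, Sigma j j <= c0)
    (Wstar : 'M[R]_(d, K.-1))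
    (hWstar : is_argmin (quad_loss Sigma (pop_U mu)) Wstar)
    (s : nat) (hs : s = #|msupport Wstar|)
    (hRE : RE_condition kappa0 s Sigma)
    (hn3 : c3 * (maxn s 1)%:R * ln (d%:R / delta) <= n%:R)
    (lambda0 : R) (hlambda0 : 0 < lambda0),
  let a := c1 * Num.sqrt (ln (d%:R * M%:R / delta) / N%:R) * mxnorm 1 1 Wstar
           + c2 * Num.sqrt (K%:R * ln (d%:R * M%:R * K%:R / delta) / N%:R) in
  let bn := 2 * c1 * Num.sqrt (ln (d%:R * M%:R / delta) / n%:R) in
  exists2 E : set Omega, measurable E /\ ((1 - 3 * delta)%:E <= P E)%E &
  forall w, E w ->
  forall (lambda : nat -> R) (W : nat -> 'M[R]_(d, K.-1)),
    lambda 0%N = lambda0 ->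
    (forall t, lambda t.+1 = 2 * a + 2 * bn * mxnorm 1 1 (W t - Wstar)) ->
    is_dmSLDA
      (fun m => local_loss b (fun i => tuple_col (X (m, i) w)) (y m))
      (Ordinal hM) lambda W ->
    forall t,
      mxnorm 2 2 (W t.+1 - Wstar)
        <= 48 * a * Num.sqrt s%:R / kappa0
           + 48 * bn * Num.sqrt s%:R / kappa0 * mxnorm 1 1 (W t - Wstar) /\
      mxnorm 1 1 (W t.+1 - Wstar)
        <= 192 * a * s%:R / kappa0
           + 192 * bn * s%:R / kappa0 * mxnorm 1 1 (W t - Wstar).
Proof.
have le48 : 4 * 3 <= 48 :> R by lra.
have le192 : 4 * 12 <= 192 :> R by lra.
exists (cov_rate c0 sigma2), (mean_rate c0 sigma2), (sample_rate c0 kappa0 sigma2).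
have c1pos := cov_rate_gt0 c0 hsigma2; have c2pos := mean_rate_gt0 c0 hsigma2.
split; first by split=> //; exact: sample_rate_gt0.
set c1 := cov_rate c0 sigma2 in c1pos *; set c2 := mean_rate c0 sigma2 in c2pos *.
move=> d K b n M N hK hb hM hn hN delta /andP[d0 d1] dO Omega P y hy X hX mu Sigma.
(* The exceptional events cost [delta / 2] three times and [delta] once. *)
have dsum : delta / 2 + delta / 2 + (delta / 2 + delta) <= 3 * delta by lra.
move=> SigmaRoot hSigma hRoot hmom hsub hc0 Wstar hWstar s hs hRE hn3 lambda0.
move=> hlambda0 a bn.
pose sN := Num.sqrt (ln (d%:R * M%:R / delta) / N%:R).
pose sn := Num.sqrt (ln (d%:R * M%:R / delta) / n%:R).
pose e := c2 * Num.sqrt (K%:R * ln (d%:R * M%:R * K%:R / delta) / N%:R).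
have aE : a = c1 * sN * mxnorm 1 1 Wstar + e by [].
have bnE : bn = 2 * c1 * sn by [].
clearbody a bn.
have b0 : (0 < b)%N by exact: leq_trans hb.
have K0 : (0 < K)%N by exact: leq_trans hK.
have n0 : (0 < n)%N by rewrite hn muln_gt0 K0.
have N0 : (0 < N)%N by rewrite hN muln_gt0 hM.
have nr : 0 < n%:R :> R by rewrite ltr0n.
have Nr : 0 < N%:R :> R by rewrite ltr0n.
(* For [delta >= 1 / 3] the claimed probability is at most 0 and the empty event will do; the
   budgets require [delta < 1 / 3]. *)
have [d3|d3] := lerP 3^-1 delta.
  exists set0 => //; split=> //; rewrite measure0 lee_fin; lra.
have nrm0 (V : 'M[R]_(d, K.-1)) : 0 <= mxnorm 1 1 V.
  by rewrite mxnorm11E sumr_ge0// => i _; apply: sumr_ge0.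
have a0 : 0 <= a.
  rewrite aE; apply: addr_ge0; last exact: mulr_ge0 (ltW c2pos) (sqrtr_ge0 _).
  exact: mulr_ge0 (mulr_ge0 (ltW c1pos) (sqrtr_ge0 _)) (nrm0 _).
have bn0 : 0 <= bn.
  rewrite bnE; apply: mulr_ge0 (sqrtr_ge0 _); exact: mulr_ge0 (ltW c1pos).
have bound0 (k r x : R) : 0 <= k -> 0 <= r -> 0 <= x ->
    0 <= k * a * r / kappa0 + k * bn * r / kappa0 * x.
  move=> k0 r0 x0; apply: addr_ge0; last apply: mulr_ge0 => //.
    exact: divr_ge0 (mulr_ge0 (mulr_ge0 k0 a0) r0) (ltW hkappa0).
  exact: divr_ge0 (mulr_ge0 (mulr_ge0 k0 bn0) r0) (ltW hkappa0).
(* Without coordinates all error norms are 0, while the logarithmic bounds rest on [1 <= d]. *)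
have [dz|dpos] := posnP d.
  exists setT; first by split=> //; rewrite probability_setT lee_fin; lra.
  move=> w _ lambda W _ _ _ t.
  have no_i (i : 'I_d) : False by case: i => i; rewrite dz.
  rewrite mxnorm22E big1 ?sqrtr0 => [|i]; last by case: (no_i i).
  split; first by rewrite bound0 ?sqrtr_ge0.
  have -> : mxnorm 1 1 (W t.+1 - Wstar) = 0.
    by rewrite mxnorm11E big1// => i; case: (no_i i).
  by rewrite bound0.
pose m1 := Ordinal hM.
have D1 : 1 <= d%:R :> R by rewrite ler1n.
have Mr : 1 <= M%:R :> R by rewrite ler1n.
have l0 : 0 < ln (d%:R / delta) by exact: (ln_ratio_gt0 d0 d3 D1).
set l := ln (d%:R / delta) in hn3 l0.
have dM1 : 1 <= d%:R * M%:R :> R by rewrite mulr_ege1.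
have lM0 : 0 < ln (d%:R * M%:R / delta) by exact: (ln_ratio_gt0 d0 d3 dM1).
(* The covariance events hold at the smaller rate without [M] in the logarithm and are weakened to
   the rates of the statement. *)
have lM : l <= ln (d%:R * M%:R / delta).
  rewrite ler_ln ?posrE ?divr_gt0 ?mulr_gt0 ?ltr0n//.
  by rewrite ler_pM2r ?invr_gt0// ler_peMr// ler0n.
have maxs1 : 1 <= (maxn s 1)%:R :> R by rewrite ler1n leq_max orbT.
have C0 := sqmgf_const_gt0 hsigma2.
have ntau0 := net_tau_gt0 hsigma2; have tmax0 := tau_max_gt0 hsigma2.
have nN : n%:R <= N%:R :> R by rewrite ler_nat hN leq_pmull.
have ml0 : 0 <= (maxn s 1)%:R * l by rewrite mulr_ge0// ltW.
have split_rate (A B : R) : 0 <= A -> 0 <= B ->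
    sample_rate c0 kappa0 sigma2 = A + B -> A * ((maxn s 1)%:R * l) <= n%:R
    /\ B * ((maxn s 1)%:R * l) <= n%:R.
  move=> A0 B0 E; move: hn3; rewrite E -mulrA mulrDl => H.
  have := mulr_ge0 A0 ml0; have := mulr_ge0 B0 ml0; split; lra.
have [||rateA rateB] := split_rate _ _ _ _ erefl.
- by rewrite divr_ge0 ?sqr_ge0// mulr_ge0 ?addr_ge0// mulr_ge0// ltW.
- by rewrite divr_ge0 ?sqr_ge0// mulr_ge0// ltW.
have rateB' : 16 * sqmgf_const sigma2 * l <= n%:R * tau_max sigma2 ^+ 2.
  rewrite -ler_pdivrMr ?exprn_gt0// -mulrAC (le_trans _ rateB)//.
  rewrite ler_wpM2l//; first by rewrite divr_ge0 ?sqr_ge0// mulr_ge0// ltW.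
  by rewrite ler_peMl// ltW.
have rateBN : 16 * sqmgf_const sigma2 * l <= N%:R * tau_max sigma2 ^+ 2.
  by rewrite (le_trans rateB')// ler_wpM2r ?sqr_ge0.
have rateA' : ((net_factor c0 kappa0)%:R + 5) * (4 * sqmgf_const sigma2)
      * (maxn s 1)%:R * l <= n%:R * net_tau sigma2 ^+ 2.
  rewrite -ler_pdivrMr ?exprn_gt0// (le_trans _ rateA)// le_eqVlt; apply/orP; left.
  by apply/eqP; field; rewrite gt_eqF.
have hX1 : mutually_independent P (fun i => X (m1, i)).
  have inj : injective (fun i : 'I_n => (m1, i)) by move=> i j [].
  exact: (@mutually_indep_inj _ _ _ P _ _ _ _ _ (fun p => X p) inj hX).
have gb1 j : #|[pred i | y m1 i == j]| = b by exact: card_class.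
have JI1 : (2 * #|'I_K| <= #|'I_n|)%N by rewrite !card_ord hn mulnC leq_pmul2l.
have I1 : (0 < #|'I_n|)%N by rewrite card_ord.
have gbM := card_machine_class hy.
have JIM : (2 * #|{: 'I_M * 'I_K}| <= #|{: 'I_M * 'I_n}|)%N.
  by rewrite !card_prod !card_ord hn mulnCA leq_pmul2l// mulnC leq_pmul2l.
have IM : (0 < #|{: 'I_M * 'I_n}|)%N by rewrite card_prod !card_ord -hN.
have cn : #|'I_n| = n by exact: card_ord.
have cN : #|{: 'I_M * 'I_n}| = N by rewrite card_prod !card_ord.
have := RE_event (g := y m1) (mu := mu) hsigma2 b0 gb1 JI1 hX1
  hSigma hRoot (hmom m1) (hsub m1) hc0 d0 d3 dpos hkappa0 hRE.
rewrite cn => /(_ rateA')[F1 [mF1 PF1 H1]].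
have := entry_event (g := y m1) (mu := mu) hsigma2 b0 gb1 JI1 hX1
  hSigma hRoot (hmom m1) (hsub m1) hc0 d0 d3 dpos I1.
rewrite cn => /(_ rateB')[F2 [mF2 PF2 H2]].
have hmomM p : has_mean_cov P (fun w => tuple_col (X p w))
    (mu (machine_class y p).2) Sigma by case: p => m i; exact: hmom.
have hsubM p : subgaussian P sigma2 (fun w => invmx SigmaRoot *m
    (tuple_col (X p w) - mu (machine_class y p).2)) by case: p => m i; exact: hsub.
have := entry_event (g := machine_class y) (mu := fun p => mu p.2) hsigma2 b0
  gbM JIM hX hSigma hRoot hmomM hsubM hc0 d0 d3 dpos IM.
rewrite cN => /(_ rateBN)[F3 [mF3 PF3 H3]].
have := mean_event hsigma2 K0 b0 hM dpos hn hN hy hX hSigma hRoot hsub hc0 d0 d3.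
rewrite -/c2 => -[F4 [mF4 PF4 H4]].
have mF : measurable ((F1 `|` F2) `|` (F3 `|` F4)).
  by apply: measurableU; apply: measurableU.
exists (~` ((F1 `|` F2) `|` (F3 `|` F4))).
  split; first exact: measurableC.
  rewrite probability_setC// EFinB leeB//.
  have /le_trans := measureU2 P (measurableU _ _ mF1 mF2) (measurableU _ _ mF3 mF4).
  apply; apply: (@le_trans _ _ ((P F1 + P F2) + (P F3 + P F4))%E).
    by apply: leeD; exact: measureU2.
  apply: (@le_trans _ _ (((delta / 2)%:E + (delta / 2)%:E) + ((delta / 2)%:E + delta%:E))%E).
    by apply: leeD; exact: leeD.
  by rewrite -!EFinD lee_fin.
move=> w /not_orP[/not_orP[nF1 nF2] /not_orP[nF3 nF4]] lambda W _ hlam [_ hstep] t.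
have sSig := psd_sqrt_sym hRoot.
have U0 := argmin_quad_loss sSig hWstar.
pose x m i := tuple_col (X (m, i) w).
have lN : Num.sqrt (l / N%:R) <= sN.
  by rewrite ler_sqrt ?divr_ge0 ?(ltW lM0)// ler_pM2r ?invr_gt0.
have ln' : Num.sqrt (l / n%:R) <= sn.
  by rewrite ler_sqrt ?divr_ge0 ?(ltW lM0)// ler_pM2r ?invr_gt0.
have sNn : sN <= sn.
  rewrite ler_sqrt ?divr_ge0 ?(ltW lM0)// ler_pM2l// lef_pV2 ?posrE//.
have dMK1 : 1 <= d%:R * M%:R * K%:R :> R by rewrite -!natrM ler1n !muln_gt0 dpos hM.
have lMK : 0 < ln (d%:R * M%:R * K%:R / delta) by exact: (ln_ratio_gt0 d0 d3 dMK1).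
have e0 : 0 < e by rewrite mulr_gt0// sqrtr_gt0 divr_gt0// mulr_gt0// ltr0n.
set z := mxnorm 1 1 (W t - Wstar).
have z0 : 0 <= z by exact: nrm0.
have lamE : lambda t.+1 = 2 * a + 2 * bn * z by exact: hlam.
have bnz := mulr_ge0 bn0 z0.
(* Strict positivity comes from the mean error term [e], so the penalty is positive even if [Wstar]
   is 0 and the previous error vanishes. *)
have a_gt0 : 0 < a.
  rewrite aE; apply: ltr_wpDl e0.
  exact: mulr_ge0 (mulr_ge0 (ltW c1pos) (sqrtr_ge0 _)) (nrm0 _).
have lam0 : 0 < lambda t.+1.
  by rewrite lamE ltr_wpDr ?mulr_gt0// -mulrA mulr_ge0.
have SE : pooled_cov b (machine_class y) (fun p => x p.1 p.2)
    = pooled_cov b (machine_class y) (fun p => tuple_col (X p w)).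
  by congr pooled_cov; apply/funext => -[].
have [||||||||norm1 norm2] := @dmSLDA_step _ d K.-1 s M
  (fun m => within_cov b (x m) (y m)) (fun m => local_U b (x m) (y m)) m1 Sigma
  (W t) (W t.+1) Wstar (kappa0 / 2) (lambda t.+1) (c1 * sN) (c1 * sn) e _ _ _ lam0
  _ hs _ _ _ _ (hstep t).
- by move=> m; rewrite within_covE; exact: pooled_cov_sym.
- by move=> v; rewrite within_covE; apply: pooled_cov_psd; apply: leq_trans JI1; rewrite leq_pmull.
- by rewrite divr_gt0.
- by rewrite within_covE; exact: H1.
- move=> i j; rewrite avg_within_cov.
  rewrite SE; apply: (le_trans (H3 w nF3 i j)).
  by rewrite ler_wpM2l// ltW.
- move=> i j; rewrite within_covE; apply: (le_trans (H2 w nF2 i j)).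
  by rewrite ler_wpM2l// ltW.
- by move=> i j; rewrite U0; exact: H4.
- rewrite lamE -/z aE; exact: noise_le_penalty (ltW c1pos) z0 sNn bnE.
rewrite lamE in norm1 norm2.
split.
  exact: le_trans norm2 (rescale_bound a0 bn0 z0 hkappa0 (sqrtr_ge0 _) le48).
exact: le_trans norm1 (rescale_bound a0 bn0 z0 hkappa0 (ler0n _ _) le192).
Qed.
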